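(* Let $\Gamma\subset SU(2)$ be the binary icosahedral group and let $D$ be the Dirac operator on the Poincaré homology sphere $SU(2)/\Gamma$ with the round metric and the trivial spin structure. Let $m(\lambda,D)$ denote the multiplicity of $\lambda\in\mathbb{R}$ as an eigenvalue of $D$ ($0$ if $\lambda$ is not an eigenvalue). There are polynomials $P_k(u)$, $k=0,\dots,59$, such that $P_k(3/2+k+60j)=m(3/2+k+60j,D)$ for all $j\in\mathbb{Z}$. They are given by $P_k=0$ whenever $k$ is odd, and, for $k$ even, $P_k(u)=a_k+b_ku+\frac1{60}u^2$ with $(a_k,b_k)$ as follows: $k=0$: $(\frac{39}{80},\frac{59}{60})$; $k=2$: $(-\frac{7}{240},-\frac1{20})$; $k=4$: $(-\frac{11}{240},-\frac1{12})$; $k=6$: $(-\frac1{16},-\frac7{60})$; $k=8$: $(-\frac{19}{240},-\frac3{20})$; $k=10$: $(-\frac{23}{240},-\frac{11}{60})$; $k=12$: $(\frac{31}{80},\frac{47}{60})$; $k=14$: $(-\frac{31}{240},-\frac14)$; $k=16$: $(-\frac7{48},-\frac{17}{60})$; $k=18$: $(-\frac{13}{80},-\frac{19}{60})$; $k=20$: $(\frac{77}{240},\frac{13}{20})$; $k=22$: $(-\frac{47}{240},-\frac{23}{60})$; $k=24$: $(\frac{23}{80},\frac7{12})$; $k=26$: $(-\frac{11}{48},-\frac9{20})$; $k=28$: $(-\frac{59}{240},-\frac{29}{60})$; $k=30$: $(\frac{19}{80},\frac{29}{60})$; $k=32$: $(\frac{53}{240},\frac9{20})$; $k=34$: $(-\frac{71}{240},-\frac7{12})$;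 $k=36$: $(\frac3{16},\frac{23}{60})$; $k=38$: $(-\frac{79}{240},-\frac{13}{20})$; $k=40$: $(\frac{37}{240},\frac{19}{60})$; $k=42$: $(\frac{11}{80},\frac{17}{60})$; $k=44$: $(\frac{29}{240},\frac14)$; $k=46$: $(-\frac{19}{48},-\frac{47}{60})$; $k=48$: $(\frac7{80},\frac{11}{60})$; $k=50$: $(\frac{17}{240},\frac3{20})$; $k=52$: $(\frac{13}{240},\frac7{60})$; $k=54$: $(\frac3{80},\frac1{12})$; $k=56$: $(\frac1{48},\frac1{20})$; $k=58$: $(-\frac{119}{240},-\frac{59}{60})$.
   Context: The binary icosahedral group $\Gamma\subset SU(2)$ is the preimage, under the double cover $SU(2)\to SO(3)$, of the rotation group of a regular icosahedron; it has order $120$ and is unique up to conjugacy. In $\mathfrak{su}(2)$ let $I=\begin{pmatrix} i&0\\0&-i\end{pmatrix}$, $J=\begin{pmatrix}0&1\\-1&0\end{pmatrix}$, $K=\begin{pmatrix}0&i\\i&0\end{pmatrix}$. The round metric on $SU(2)/\Gamma=\{g\Gamma\}$ is induced by the bi-invariant metric on $SU(2)\cong S^3$ for which $X_1=I,\ X_2=J,\ X_3=K$ is an orthonormal basis (the unit 3-sphere). The trivial spin structure is the one corresponding to the lift of the isotropy representation $\Gamma\to SO(3)$ given by the inclusion $\iota:\Gamma\to SU(2)\cong\mathrm{Spin}(3)$, i.e. $SU(2)\times_\iota\mathrm{Spin}(3)$ (equivalently, writing $\mathrm{Spin}(4)=SU(2)\times SU(2)$ with $\Gamma$ acting on $S^3$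 through one factor, the lift $\gamma\mapsto(\gamma,1)$). Concretely, spinor fields are the functions $\psi:SU(2)\to\mathbb{C}^2$ with $\psi(g\gamma)=\gamma^{-1}\psi(g)$ for all $\gamma\in\Gamma$, and $$D\psi = I\,(X_1\psi)+J\,(X_2\psi)+K\,(X_3\psi)-\tfrac32\,\psi,$$ where $(X\psi)(g)=\frac{d}{dt}\big|_{t=0}\psi(g\exp(tX))$. *)

(* Defs.v *)
From HB Require Import structures.
From mathcomp Require Import all_boot all_order all_algebra.
From mathcomp Require Import complex spectral.
From mathcomp Require Import all_classical all_reals all_analysis.
From mathcomp Require Import ring.

Set Implicit Arguments.
Unset Strict Implicit.
Unset Printing Implicit Defensive.

Import Order.TTheory GRing.Theory Num.Theory.
Import numFieldNormedType.Exports.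

Local Open Scope classical_set_scope.
Local Open Scope ring_scope.
Local Open Scope complex_scope.

Definition mx2 (T : Type) (a b c d : T) : 'M[T]_2 :=
  \matrix_(i < 2, j < 2)
    if i == 0 then (if j == 0 then a else b) else (if j == 0 then c else d).

Section UnitaryGroup.
Variable R : realType.
Local Notation C := R[i].

Definition SU2_pred : pred 'M[C]_2 :=
  fun g => (g \is unitarymx) && (\det g == 1).

Record SU2 := MkSU2 { SU2val :> 'M[C]_2; _ : SU2_pred SU2val }.

HB.instance Definition _ := [isSub for SU2val].
HB.instance Definition _ := [Choice of SU2 by <:].

Lemma SU2_one_subproof : SU2_pred 1%:M.
Proof.
rewrite /SU2_pred det1 eqxx andbT.
by apply/unitarymxP; rewrite mul1mx trmx1 map_mx1.
Qed.

Lemma SU2_mul_subproof (g h : SU2) : SU2_pred (SU2val g *m SU2val h).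
Proof.
case: g h => [g /= /andP[gu /eqP gd]] [h /= /andP[hu /eqP hd]].
apply/andP; split; first exact: (mul_unitarymx gu hu).
by apply/eqP; rewrite det_mulmx gd hd mulr1.
Qed.

Lemma SU2_inv_subproof (g : SU2) : SU2_pred (invmx (SU2val g)).
Proof.
case: g => [g /= /andP[gu /eqP gd]].
apply/andP; split; first by rewrite (invmx_unitary gu) trmxC_unitary.
by apply/eqP; rewrite det_inv gd invr1.
Qed.

Definition SU2_one := MkSU2 SU2_one_subproof.
Definition SU2_mul g h := MkSU2 (SU2_mul_subproof g h).
Definition SU2_inv g := MkSU2 (SU2_inv_subproof g).

Lemma SU2_unitmx (g : SU2) : SU2val g \in unitmx.
Proof. by case: g => [g /= /andP[gu _]]; exact: unitarymx_unit. Qed.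

Fact SU2_mulgA : associative SU2_mul.
Proof. by move=> f g h; apply: val_inj; rewrite /= mulmxA. Qed.
Fact SU2_mul1g : left_id SU2_one SU2_mul.
Proof. by move=> g; apply: val_inj; rewrite /= mul1mx. Qed.
Fact SU2_mulg1 : right_id SU2_one SU2_mul.
Proof. by move=> g; apply: val_inj; rewrite /= mulmx1. Qed.
Fact SU2_mulVg : left_inverse SU2_one SU2_inv SU2_mul.
Proof. by move=> g; apply: val_inj; rewrite /= mulVmx ?SU2_unitmx. Qed.
Fact SU2_mulgV : right_inverse SU2_one SU2_inv SU2_mul.
Proof. by move=> g; apply: val_inj; rewrite /= mulmxV ?SU2_unitmx. Qed.

HB.instance Definition _ := isGroup.Build SU2
  SU2_mulgA SU2_mul1g SU2_mulg1 SU2_mulVg SU2_mulgV.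

End UnitaryGroup.

(* The topology of R[i] given by its modulus; complex matrices inherit the
   product topology. *)
#[non_forgetful_inheritance]
HB.instance Definition _ (R : realType) := PseudoPointedMetric.copy R[i] R[i]^o.
#[non_forgetful_inheritance]
HB.instance Definition _ (R : realType) := GRing.ComAlgebra.copy R[i] R[i]^o.
#[non_forgetful_inheritance]
HB.instance Definition _ (R : realType) := NormedModule.copy R[i] R[i]^o.

Section Dirac.
Variable R : realType.
Local Notation C := R[i].
Local Notation SU2 := (SU2 R).

(* subspace topology *)
HB.instance Definition _ := Topological.copy SU2 (initial_topology (@SU2val R)).

Definition qI : 'M[C]_2 := mx2 'i 0 0 (- 'i).
Definition qJ : 'M[C]_2 := mx2 0 1 (- 1) 0.
Definition qK : 'M[C]_2 := mx2 0 'i 'i 0.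

Definition su2_basis (i : 'I_3) : 'M[C]_2 := tnth [tuple qI; qJ; qK] i.

Definition mexp (A : 'M[C]_2) : 'M[C]_2 :=
  lim ((\sum_(k < n) (k`!%:R)^-1 *: A ^+ k) @[n --> \oo]).

Lemma continuous_realC : continuous (fun x : R => x%:C : C).
Proof.
move=> x; apply/cvgrPdist_lt => e e0.
set r := complex.Re e.
have er : 0 < r by move: e0; rewrite ltcE => /andP[].
have -> : e = r%:C by move: e0; rewrite /r ltcE; case: (e) => a b /= /andP[/eqP ->].
clearbody r.
have H : \forall y \near x, `|x - y| < r 
  by exact: (@cvgr_dist_lt _ _ _ _ _ (fun y : R => y) x (@cvg_id _ _) _ er).
near=> y.
rewrite -rmorphB /= normc_def /= expr0n /= addr0 sqrtr_sqr ltcR.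
near: y; exact: H.
Unshelve. all: by end_near.
Qed.

Lemma mexp_sqrN1 (A : 'M[C]_2) (t : R) : A * A = - 1 ->
  mexp (t%:C *: A) = (cos t)%:C *: 1 + (sin t)%:C *: A.
Proof.
move=> AA; apply: cvg_lim; first exact: norm_hausdorff.
have E n : \sum_(k < n) (k`!%:R)^-1 *: (t%:C *: A) ^+ k =
  (series (cos_coeff t) n)%:C *: 1 + (series (sin_coeff t) n)%:C *: A.
  elim: n => [|n IH].
    by rewrite big_ord0 /series /= !big_geq // !scale0r addr0.
  rewrite big_ord_recr /= {}IH /series /= !big_nat_recr //= !rmorphD /=.
  rewrite !scalerDl addrACA; congr (_ + _).
  have AE : A ^+ n = (-1) ^+ n./2 *: (if odd n then A else 1).
    rewrite -{1}(odd_double_half n) exprD -mul2n exprM expr2 AA.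
    rewrite -[in LHS]scaleN1r exprZn expr1n.
    rewrite -scalerAr mulr1.
    by congr (_ *: _); case: (odd n).
  rewrite exprZn scalerA AE scalerA /cos_coeff /sin_coeff /=.
  have cE : ((-1) ^+ n./2 * (t ^+ n / n`!%:R))%:C =
    n`!%:R^-1 * t%:C ^+ n * (-1) ^+ n./2 :> C.
    rewrite !rmorphM /= !rmorphXn /= fmorphV rmorph_nat rmorphN1.
    by rewrite mulrC -mulrA [X in X * _]mulrC mulrA; congr (_ * _); rewrite mulrC.
  case: ifP => on /=.
  - rewrite !mul0r scale0r add0r; congr (_ *: _).
    rewrite -cE; congr (_%:C); rewrite mul1r -mulrA; congr (_ ^+ _ * _).
    by case: (n) on => // m; rewrite /= uphalf_half => /negbTE ->.
  - by rewrite !mul0r scale0r addr0 -cE mul1r -mulrA.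
rewrite (_ : (fun n => _) = (fun n =>
  (series (cos_coeff t) n)%:C *: 1 + (series (sin_coeff t) n)%:C *: A)); last first.
  by apply/funext => n; exact: E.
have cc : (series (cos_coeff t) n)%:C @[n --> \oo] --> (cos t)%:C.
  apply: (@cvg_comp _ _ _ _ (fun x : R => x%:C : C) _ (nbhs (cos t)));
    last exact: continuous_realC.
  rewrite unlock; exact: is_cvg_series_cos_coeff.
have cs : (series (sin_coeff t) n)%:C @[n --> \oo] --> (sin t)%:C.
  apply: (@cvg_comp _ _ _ _ (fun x : R => x%:C : C) _ (nbhs (sin t)));
    last exact: continuous_realC.
  rewrite unlock; exact: is_cvg_series_sin_coeff.
exact: (cvgD (cvgZr_tmp cc) (cvgZr_tmp cs)).
Qed.

Lemma mulmx2 (T : pzRingType) (a b c d a' b' c' d' : T) :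
  mx2 a b c d *m mx2 a' b' c' d' =
  mx2 (a * a' + b * c') (a * b' + b * d') (c * a' + d * c') (c * b' + d * d').
Proof.
apply/matrixP => i j; rewrite !mxE big_ord_recl big_ord1 !mxE /=.
by case: eqP => _; case: eqP.
Qed.

Lemma mx2_1 (T : pzRingType) : mx2 1 0 0 1 = 1%:M :> 'M[T]_2.
Proof. by apply/matrixP => -[[|[|//]] ?] [[|[|//]] ?]; rewrite !mxE. Qed.

Lemma scale_mx2 (T : pzRingType) (x a b c d : T) :
  x *: mx2 a b c d = mx2 (x * a) (x * b) (x * c) (x * d).
Proof. by apply/matrixP => i j; rewrite !mxE; do 2 case: ifP => _. Qed.

Lemma add_mx2 (T : pzRingType) (a b c d a' b' c' d' : T) :
  mx2 a b c d + mx2 a' b' c' d' = mx2 (a + a') (b + b') (c + c') (d + d').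
Proof. by apply/matrixP => i j; rewrite !mxE; do 2 case: ifP => _. Qed.

Lemma su2_basis_sqr i : su2_basis i * su2_basis i = - 1.
Proof.
have -> : - 1 = mx2 (- 1) 0 0 (- 1) :> 'M[C]_2.
  by rewrite -[X in - X]mx2_1 -scaleN1r scale_mx2 !mulr1 !mulr0.
case: i => [[|[|[|//]]] ?]; rewrite /su2_basis (tnth_nth 0) /= -[_ * _]/(_ *m _) mulmx2;
  by congr (mx2 _ _ _ _); simpc.
Qed.

Lemma SU2_quat (a b c d : R) : a ^+ 2 + b ^+ 2 + c ^+ 2 + d ^+ 2 = 1 ->
  SU2_pred (mx2 (a +i* b) (c +i* d) (- c +i* d) (a -i* b)).
Proof.
move=> N; apply/andP; split; last first.
  rewrite (expand_det_row _ 0) big_ord_recl big_ord1 /cofactor !det_mx11 !mxE /=.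
  rewrite expr0 expr1; simpc; apply/eqP; congr (_ +i* _); last by ring.
  by rewrite -N; ring.
apply/unitarymxP.
have -> : map_mx Num.conj (mx2 (a +i* b) (c +i* d) (- c +i* d) (a -i* b))^T =
          mx2 (a -i* b) (- c -i* d) (c -i* d) (a +i* b).
  by apply/matrixP => -[[|[|//]] ?] [[|[|//]] ?]; rewrite !mxE /= /Num.conj /= ?opprK.
rewrite mulmx2 -mx2_1.
by congr (mx2 _ _ _ _); simpc; congr (_ +i* _); (try rewrite -N); ring.
Qed.

Lemma mexp_SU2 i (t : R) : SU2_pred (mexp (t%:C *: su2_basis i)).
Proof.
rewrite mexp_sqrN1 ?su2_basis_sqr // -[1]mx2_1.
have N := cos2Dsin2 t.
have quat (a b c d : R) : a ^+ 2 + b ^+ 2 + c ^+ 2 + d ^+ 2 = 1 -> forall x y z w,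
    x = a +i* b -> y = c +i* d -> z = - c +i* d -> w = a -i* b ->
    SU2_pred (mx2 x y z w) 
  by move=> e x y z w -> -> -> ->; exact: SU2_quat e.
case: i => [[|[|[|//]]] ?]; rewrite /su2_basis (tnth_nth 0) /= !scale_mx2 add_mx2.
- by apply: (quat (cos t) (sin t) 0 0); [rewrite -N; ring|..]; simpc.
- by apply: (quat (cos t) 0 (sin t) 0); [rewrite -N; ring|..]; simpc.
- by apply: (quat (cos t) 0 0 (sin t)); [rewrite -N; ring|..]; simpc.
Qed.

(* i |-> t |-> exp(t X_i), where X_1, X_2, X_3 = I, J, K *)
Definition su2_exp (i : 'I_3) (t : R) : SU2 := MkSU2 (mexp_SU2 i t).

Definition spinor := SU2 -> 'cV[C]_2.

Definition lie_quotient (i : 'I_3) (psi : spinor) (g : SU2) (t : R) : 'cV[C]_2 :=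
  (t^-1)%:C *: (psi (g * su2_exp i t)%g - psi g).

Definition lie_derivable (i : 'I_3) (psi : spinor) : Prop :=
  forall g, cvg (lie_quotient i psi g t @[t --> (0 : R)^']).

Definition lie_derive (i : 'I_3) (psi : spinor) : spinor :=
  fun g => lim (lie_quotient i psi g t @[t --> (0 : R)^']).

(* C^n functions on SU(2): X_1, X_2, X_3 form a global frame of the tangent
   bundle, so it is enough to differentiate along these three fields. *)
Fixpoint Cn (n : nat) (psi : spinor) : Prop :=
  continuous psi /\
  if n is m.+1 then forall i, lie_derivable i psi /\ Cn m (lie_derive i psi)
  else True.

Definition smooth (psi : spinor) : Prop := forall n, Cn n psi.

(* smooth sections of the spinor bundle of SU(2)/Gamma *)
Definition spinor_field (Gamma : set SU2) (psi : spinor) : Prop :=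
  smooth psi /\
  forall g gamma, Gamma gamma ->
    psi (g * gamma)%g = SU2val (gamma^-1)%g *m psi g.

Definition dirac (psi : spinor) : spinor :=
  fun g => (\sum_(i < 3) su2_basis i *m lie_derive i psi g) - (3 / 2) *: psi g.

Definition dirac_eigenspace (Gamma : set SU2) (lambda : R) : set spinor :=
  [set psi | spinor_field Gamma psi /\ dirac psi = lambda%:C *: psi].

(* The double cover SU(2) -> SO(3): the matrix of the adjoint action in the
   basis I, J, K, which is orthonormal for <Y, Z> = - tr(Y Z) / 2. *)
Definition double_cover (g : SU2) : 'M[R]_3 :=
  \matrix_(i, j) (- complex.Re (\tr (su2_basis i *m
    (SU2val g *m su2_basis j *m SU2val (g^-1)%g))) / 2).

Definition golden_ratio : R := (1 + Num.sqrt 5) / 2.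

(* the 12 cyclic permutations of (0, +-1, +-phi); indices are added modulo 3 *)
Definition standard_icosahedron : set 'cV[R]_3 :=
  [set v | exists (c : 'I_3) (e1 e2 : bool),
    [/\ v c 0 = 0, v (c + 1) 0 = (-1) ^+ e1
      & v (c + 2) 0 = (-1) ^+ e2 * golden_ratio]].

(* vertex sets of the regular icosahedra centred at the origin *)
Definition regular_icosahedron (V : set 'cV[R]_3) : Prop :=
  exists (r : R) (Q : 'M[R]_3),
    [/\ 0 < r, Q *m Q^T = 1%:M
      & V = [set r *: (Q *m v) | v in standard_icosahedron]].

Definition rotation_group (V : set 'cV[R]_3) : set 'M[R]_3 :=
  [set A | [/\ A *m A^T = 1%:M, \det A = 1 & [set A *m v | v in V] = V]].

Definition binary_icosahedral (Gamma : set SU2) : Prop :=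
  exists2 V, regular_icosahedron V
    & Gamma = double_cover @^-1` rotation_group V.

End Dirac.

(* E is a linear subspace of dimension n *)
Definition has_dim (K : fieldType) (V : lmodType K) (E : set V) (n : nat) : Prop :=
  exists b : 'I_n -> V,
    (forall c : 'I_n -> K, \sum_i c i *: b i = 0 -> forall i, c i = 0) /\
    E = [set \sum_i c i *: b i | c in [set: 'I_n -> K]].

(* m(lambda, D) = m; in particular m = 0 iff lambda is not an eigenvalue *)
Definition dirac_mult (R : realType) (Gamma : set (SU2 R)) (lambda : R)
  (m : nat) : Prop := has_dim (dirac_eigenspace Gamma lambda) m.

Definition spectral_coefs (R : realType) (k : nat) : R * R :=
  match k with
  | 0%N => (39 / 80, 59 / 60)
  | 2%N => (- (7 / 240), - (1 / 20))
  | 4%N => (- (11 / 240), - (1 / 12))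
  | 6%N => (- (1 / 16), - (7 / 60))
  | 8%N => (- (19 / 240), - (3 / 20))
  | 10%N => (- (23 / 240), - (11 / 60))
  | 12%N => (31 / 80, 47 / 60)
  | 14%N => (- (31 / 240), - (1 / 4))
  | 16%N => (- (7 / 48), - (17 / 60))
  | 18%N => (- (13 / 80), - (19 / 60))
  | 20%N => (77 / 240, 13 / 20)
  | 22%N => (- (47 / 240), - (23 / 60))
  | 24%N => (23 / 80, 7 / 12)
  | 26%N => (- (11 / 48), - (9 / 20))
  | 28%N => (- (59 / 240), - (29 / 60))
  | 30%N => (19 / 80, 29 / 60)
  | 32%N => (53 / 240, 9 / 20)
  | 34%N => (- (71 / 240), - (7 / 12))
  | 36%N => (3 / 16, 23 / 60)
  | 38%N => (- (79 / 240), - (13 / 20))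
  | 40%N => (37 / 240, 19 / 60)
  | 42%N => (11 / 80, 17 / 60)
  | 44%N => (29 / 240, 1 / 4)
  | 46%N => (- (19 / 48), - (47 / 60))
  | 48%N => (7 / 80, 11 / 60)
  | 50%N => (17 / 240, 3 / 20)
  | 52%N => (13 / 240, 7 / 60)
  | 54%N => (3 / 80, 1 / 12)
  | 56%N => (1 / 48, 1 / 20)
  | 58%N => (- (119 / 240), - (59 / 60))
  | _ => (0, 0)
  end.

(* Main.v *)
(* Trivialise the spinor bundle from the other side: put s(g) = g psi(g). Then psi
   is Gamma-equivariant iff s is Gamma-invariant, and D psi = lambda psi iff
   B s = b s with b = lambda - 3/2, for a first order operator B satisfying
   B^2 + 2B = - Laplacian, componentwise. Hence the components of s satisfy the Casimir
   equation - Laplacian = n(n+2) as soon as b = n >= 0 or b = -n-2.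

   A solution f of the Casimir equation of weight n extends to a harmonic
   polynomial of degree n on 2x2 matrices. Its partial derivatives are
   given on SU(2) by operators lowering the weight, and solutions of weight 0 are constant by
   the maximum principle, so iterating Euler's identity yields the Taylor expansion
   f(g) = tr(Y rho_n(g^-1)), rho_n being the n-th symmetric power. No Peter-Weyl
   theorem is needed. On the coefficients Y the operator B becomes a bidiagonal
   matrix acting on one index only, with eigenvalue spaces of dimension n+2 (for n) and
   n (for -n-2), while Gamma acts on the other index. Thus the multiplicities are
   (n+2) d_n and n d_n with d_n the dimension of the Gamma-invariants of rho_n, and no
   eigenvalue occurs at b = -1.

   Finally d_n is the mean of the character of rho_n over Gamma, a Chebyshev
   polynomial of the trace. Up to conjugation Gamma is the group of the
   120 icosians, whose coordinates lie in Z[phi]; the means for n < 60 are evaluated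
   there, and d_(n+60) = d_n + 1 for even n because only +-1 contribute non-periodically. *)

Require Import Defs.
From HB Require Import structures.
From mathcomp Require Import all_boot all_order all_algebra.
From mathcomp Require Import complex spectral.
From mathcomp Require Import all_classical all_reals all_analysis.
From mathcomp Require Import ring lra zify.

Set Implicit Arguments.
Unset Strict Implicit.
Unset Printing Implicit Defensive.

Import Order.TTheory GRing.Theory Num.Theory.
Import numFieldNormedType.Exports.

Local Open Scope classical_set_scope.
Local Open Scope ring_scope.
Local Open Scope complex_scope.

(** In the given frame Gamma acts on the argument and on the values of psi at once. The factor g
    turns B into an operator built from the generators of left translations, which commute with
    right translations by Gamma; hence the two indices of Y separate. The fields X_i are given only
    by limits along three flows, without charts. The relation [X_i, X_(i+1)] = 2 X_(i+2) is
    therefore extracted from the group law, by Schwarz's theorem for f(g e^(s X_i) e^(t X_(i+1))).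
    Apart from the maximum principle and the compactness behind it, the rest is algebra in the
    commutative ring of smooth functions. The period 60 is the least common multiple of the orders
    of the elements of Gamma. That d_n is 0 or 1 for n < 60 reflects Klein's invariants of degrees
    12, 20 and 30. One polynomial serves both ends of the spectrum by reciprocity: the Chebyshev
    recursion run backwards gives chi_(-n-2) = -chi_n, so chi_(58-n) = -chi_n on elements other than
    +-1, and d_n + d_(58-n) = 1 for even n from 0 to 58. The factor n + 2 is u + 1/2 at u = 3/2 + n,
    and u + 1/2 is -n at u = 3/2 - (n+2). *)

Section AbstractCasimir.
Variables (S : comPzRingType) (X0 X1 X2 : {additive S -> S}).
Hypothesis c01 : forall f, X0 (X1 f) = X1 (X0 f) + 2 * X2 f.
Hypothesis c12 : forall f, X1 (X2 f) = X2 (X1 f) + 2 * X0 f.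
Hypothesis c20 : forall f, X2 (X0 f) = X0 (X2 f) + 2 * X1 f.

Let natl (X : {additive S -> S}) f : X (2 * f) = 2 * X f.
Proof. by rewrite !mulr_natl raddfMn. Qed.
Let natn (X : {additive S -> S}) f : X (- (2 * f)) = - (2 * X f).
Proof. by rewrite raddfN natl. Qed.

Let c02 f : X0 (X2 f) = X2 (X0 f) - 2 * X1 f. Proof. by rewrite c20 addrK. Qed.

(** The relations are oriented: every word is brought to the order with [X2] outermost and [X0]
    innermost, a Poincare-Birkhoff-Witt normal form. Centrality of the Casimir element is then left
    to [ring]. *)
Let rules := (raddfD X0, raddfD X1, raddfD X2, natl X0, natl X1, natl X2, natn X0, natn X1, natn X2,
  c01, c12, c02).

Lemma casimir0 f : X0 (X0 (X0 f)) + X1 (X1 (X0 f)) + X2 (X2 (X0 f)) =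
  X0 (X0 (X0 f) + X1 (X1 f) + X2 (X2 f)).
Proof. by rewrite !rules; ring. Qed.
Lemma casimir1 f : X0 (X0 (X1 f)) + X1 (X1 (X1 f)) + X2 (X2 (X1 f)) =
  X1 (X0 (X0 f) + X1 (X1 f) + X2 (X2 f)).
Proof. by rewrite !rules; ring. Qed.
Lemma casimir2 f : X0 (X0 (X2 f)) + X1 (X1 (X2 f)) + X2 (X2 (X2 f)) =
  X2 (X0 (X0 f) + X1 (X1 f) + X2 (X2 f)).
Proof. by rewrite !rules; ring. Qed.

End AbstractCasimir.

(** * The Casimir operator of a triple of derivations *)

Section Lowering.
(** An sl_2 triple of derivations, modelling the complexified left-invariant fields, with
    [(x j, y j)] standing for row j of g. Over an arbitrary commutative ring each identity below
    becomes a normal form computation. *)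
Variables (S : comPzRingType) (H E F : {additive S -> S}) (x y : bool -> S).
Hypothesis HM : forall a b, H (a * b) = H a * b + a * H b.
Hypothesis EM : forall a b, E (a * b) = E a * b + a * E b.
Hypothesis FM : forall a b, F (a * b) = F a * b + a * F b.
Hypothesis EH : forall f, E (H f) = H (E f) - 2 * E f.
Hypothesis FH : forall f, F (H f) = H (F f) + 2 * F f.
Hypothesis EF : forall f, E (F f) = F (E f) + H f.
Hypothesis Hx : forall j, H (x j) = x j.
Hypothesis Hy : forall j, H (y j) = - y j.
Hypothesis Ex : forall j, E (x j) = 0.
Hypothesis Ey : forall j, E (y j) = x j.
Hypothesis Fx : forall j, F (x j) = y j.
Hypothesis Fy : forall j, F (y j) = 0.
Hypothesis det1 : x false * y true - y false * x true = 1.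

Let drv1 (D : {additive S -> S}) : (forall a b, D (a * b) = D a * b + a * D b) -> D 1 = 0.
Proof.
move=> DM; have := DM 1 1; rewrite !mulr1 mul1r => h.
by apply: (addrI (D 1)); rewrite addr0 -h.
Qed.

Let drvn (D : {additive S -> S}) : (forall a b, D (a * b) = D a * b + a * D b) ->
  forall n, D n%:R = 0.
Proof. by move=> DM n; rewrite raddfMn (drv1 DM) mul0rn. Qed.

Let rules := (raddfD H, raddfD E, raddfD F, raddfN H, raddfN E, raddfN F,
  (HM, EM, FM, EH, FH, EF), (Hx, Hy, Ex, Ey, Fx, Fy), (drvn HM, drvn EM, drvn FM)).

(** The left side is the Casimir element H^2 + 2EF + 2FE of sl_2; n(n+2) is its value on the
    irreducible representation of highest weight n. *)
Definition casimir_eq (n : nat) (f : S) : Prop :=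
  H (H f) + 2 * H f + 4 * F (E f) = n%:R * (n%:R + 2) * f.

(* On functions f of weight n, [lower n i j] is twice the partial derivative with respect to
   the entry [minv i j] of the homogeneous extension of f of degree n: Euler's identity is
   [euler_lower], and mixed derivatives commute by [lower_comm]. *)
Definition lower (n : nat) (i j : bool) (f : S) : S :=
  if i then y j * (n%:R * f + H f) - 2 * x j * F f
  else x j * (n%:R * f - H f) - 2 * y j * E f.

(* the inverse of the matrix with rows (x false, y false) and (x true, y true) *)
Definition minv (i j : bool) : S :=
  if i then (if j then x false else - x true) else (if j then - y false else y true).

Lemma casimir_eqE n f : casimir_eq n f -> casimir_eq n (E f).
Proof.
rewrite /casimir_eq => h.
transitivity (E (H (H f) + 2 * H f + 4 * F (E f))); first by rewrite !rules; ring.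
by rewrite h !rules; ring.
Qed.

Lemma casimir_eqF n f : casimir_eq n f -> casimir_eq n (F f).
Proof.
rewrite /casimir_eq => h.
transitivity (F (H (H f) + 2 * H f + 4 * F (E f))); first by rewrite !rules; ring.
by rewrite h !rules; ring.
Qed.

Lemma casimir_eqH n f : casimir_eq n f -> casimir_eq n (H f).
Proof.
rewrite /casimir_eq => h.
transitivity (H (H (H f) + 2 * H f + 4 * F (E f))); first by rewrite !rules; ring.
by rewrite h !rules; ring.
Qed.

Lemma casimir_eq_lower n i j f : casimir_eq n.+1 f -> casimir_eq n (lower n.+1 i j f).
Proof.
move=> h; have hE := casimir_eqE h; have hF := casimir_eqF h; have hH := casimir_eqH h.
(* [z k] is the defect of the Casimir equation at k. The defect of [lower] applied to f is a
   combination of the defects of f, E f, F f and H f, all of which vanish. *)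
pose z k := H (H k) + 2 * H k + 4 * F (E k) - n.+1%:R * (n.+1%:R + 2) * k.
have zf : z f = 0 by rewrite /z h subrr.
have zE : z (E f) = 0 by rewrite /z hE subrr.
have zF : z (F f) = 0 by rewrite /z hF subrr.
have zH : z (H f) = 0 by rewrite /z hH subrr.
rewrite /casimir_eq /lower; case: i.
- transitivity (n%:R * (n%:R + 2) * (y j * (n.+1%:R * f + H f) - 2 * x j * F f) +
   y j * (n.+1%:R * z f + z (H f)) - 2 * x j * z (F f) - 2 * y j * z f); last first.
    by rewrite zf zF zH; ring.
  by rewrite /z !rules; ring.
- transitivity (n%:R * (n%:R + 2) * (x j * (n.+1%:R * f - H f) - 2 * y j * E f) +
   x j * (n.+1%:R * z f - z (H f)) - 2 * y j * z (E f) - 2 * x j * z f); last first.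
    by rewrite zf zE zH; ring.
  by rewrite /z !rules; ring.
Qed.

Lemma lower_comm n i j k l f :
  lower n k l (lower n.+1 i j f) = lower n i j (lower n.+1 k l f).
Proof. by rewrite /lower; case: i; case: k; rewrite !rules; ring. Qed.

(* This is where the Casimir equation enters: the extension of f is harmonic for the
   determinant form. *)
Lemma lower_swap n f : casimir_eq n.+1 f ->
  lower n false false (lower n.+1 true true f) = lower n false true (lower n.+1 true false f).
Proof.
rewrite /casimir_eq => h.
have z0 : H (H f) + 2 * H f + 4 * F (E f) - n.+1%:R * (n.+1%:R + 2) * f = 0 by rewrite h subrr.
rewrite /lower; transitivity
 (x true * ((n%:R : S) * (y false * (n.+1%:R * f + H f) - 2 * x false * F f) -
          H (y false * (n.+1%:R * f + H f) - 2 * x false * F f)) -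
  2 * y true * E (y false * (n.+1%:R * f + H f) - 2 * x false * F f) +
  (y false * x true - y true * x false) *
  (H (H f) + 2 * H f + 4 * F (E f) - n.+1%:R * (n.+1%:R + 2) * f)).
  by rewrite !rules; ring.
by rewrite z0 mulr0 addr0.
Qed.

Lemma euler_lower n f :
  minv false false * lower n false false f + minv false true * lower n false true f +
  minv true false * lower n true false f + minv true true * lower n true true f = 2 * n%:R * f.
Proof.
(* Inserting the determinant, which equals 1, turns the claim into a polynomial identity in the
   coordinates. Later identities that use [det1] are closed by the same device. *)
transitivity ((x false * y true - y false * x true) * (2 * n%:R * f)); last by rewrite det1 mul1r.
by rewrite /lower /minv; ring.
Qed.

(** Leibniz rule for a coordinate: the factor [minv k l] has degree 1, so the remaining derivative
    of f is taken in degree n. *)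
Lemma lower_minv n i j k l f : lower n.+1 i j (minv k l * f) =
  (if (i == k) && (j == l) then 2 * f else 0) + minv k l * lower n i j f.
Proof.
transitivity ((if (i == k) && (j == l) then 2 * f else 0) *
  (x false * y true - y false * x true) + minv k l * lower n i j f); last by rewrite det1 mulr1.
by rewrite /lower /minv; case: i; case: j; case: k; case: l => /=; rewrite !rules; ring.
Qed.

Local Notation L := lower.
Local Notation m := minv.
Local Notation cas := casimir_eq.

Lemma lower_add n i j : {morph L n i j : f g / f + g}.
Proof. by move=> f g; rewrite /lower !raddfD; case: i => /=; ring. Qed.

Lemma lower0 n i j : L n i j 0 = 0.
Proof. by rewrite /lower !raddf0; case: i; ring. Qed.

Lemma lower_sum n i j I (r : seq I) (P : pred I) (f : I -> S) :
  L n i j (\sum_(k <- r | P k) f k) = \sum_(k <- r | P k) L n i j (f k).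
Proof. exact: (big_morph _ (lower_add n i j) (lower0 n i j)). Qed.

Lemma lower_const n i j c f : H c = 0 -> E c = 0 -> F c = 0 ->
  L n i j (c * f) = c * L n i j f.
Proof. by move=> Hc Ec Fc; rewrite /lower HM EM FM Hc Ec Fc; case: i; ring. Qed.

(** Harmonicity for the determinant form identifies the two mixed second derivatives of
    [lower_swap], so a second derivative depends only on the total of the first indices and the
    total of the second ones. *)
Lemma lower_pair n f (i j k l i' j' k' l' : bool) : cas n.+1 f ->
  (k + i = k' + i')%N -> (l + j = l' + j')%N ->
  L n k l (L n.+1 i j f) = L n k' l' (L n.+1 i' j' f).
Proof.
move=> cf; have sw := lower_swap cf; have cm := lower_comm n.
have e1 : L n true true (L n.+1 false false f) = L n false true (L n.+1 true false f).
  by rewrite cm sw.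
have e3 : L n true false (L n.+1 false true f) = L n false true (L n.+1 true false f).
  by rewrite cm.
by case: i; case: i'; case: k; case: k' => //; case: j; case: j'; case: l; case: l' => // _ _;
  rewrite ?e1 ?e3 ?sw //; exact: cm.
Qed.

(* The n-fold derivative of f along any path of index pairs summing to (p, q); the path
   chosen here does not matter by [lcoef_lower]. *)
Fixpoint lcoef (n p q : nat) (f : S) : S :=
  if n is n'.+1 then lcoef n' (p - (0 < p)) (q - (0 < q)) (L n (0 < p)%N (0 < q)%N f) else f.

Lemma split_index n p p' (i i' : bool) : (p + i = p' + i')%N -> (p <= n.+1)%N -> (p' <= n.+1)%N ->
  exists p0 (k k' : bool), [/\ p = (p0 + k)%N, p' = (p0 + k')%N, (k + i = k' + i')%N & (p0 <= n)%N].
Proof.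
case: i; case: i' => e h h'.
- exists (p - (0 < p))%N, (0 < p)%N, (0 < p)%N; split; lia.
- exists p, false, true; split; lia.
- exists p', true, false; split; lia.
- exists (p - (0 < p))%N, (0 < p)%N, (0 < p)%N; split; lia.
Qed.

Lemma pred_index n p0 (a : bool) : (p0 <= n)%N ->
  (p0 + a - (0 < p0 + a) <= n)%N /\ (p0 + a - (0 < p0 + a)%N + (0 < p0 + a)%N = p0 + a)%N.
Proof.
case: a => /=; rewrite ?addn1 ?addn0; first by rewrite subn1.
by case: p0 => // p hp; rewrite /= subn1 addn1; split=> //; exact: ltnW.
Qed.

(** Path independence. By induction both paths may be rerouted through the common remainder
    [(p0, q0)]; they then differ only in two consecutive derivatives, which [lower_pair]
    exchanges. *)
Lemma lcoef_lower n f p q p' q' (i j i' j' : bool) : cas n.+1 f ->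
  (p <= n)%N -> (q <= n)%N -> (p' <= n)%N -> (q' <= n)%N ->
  (p + i = p' + i')%N -> (q + j = q' + j')%N ->
  lcoef n p q (L n.+1 i j f) = lcoef n p' q' (L n.+1 i' j' f).
Proof.
elim: n f p q p' q' i j i' j' => [|n IH] f p q p' q' i j i' j' cf hp hq hp' hq' e1 e2.
  by rewrite /=; congr (L _ _ _ _); apply/eqP; move: i j i' j' e1 e2 => [] [] [] []; lia.
have [p0 [k [k' [Ep Ep' ek hp0]]]] := split_index e1 hp hp'.
have [q0 [l [l' [Eq Eq' el hq0]]]] := split_index e2 hq hq'.
have step g (a b : bool) : cas n.+1 g ->
    lcoef n.+1 (p0 + a) (q0 + b) g = lcoef n p0 q0 (L n.+1 a b g).
  move=> cg; have [a1 a2] := pred_index a hp0; have [b1 b2] := pred_index b hq0.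
  by rewrite /=; apply: IH.
rewrite Ep Eq Ep' Eq' !step; try exact: casimir_eq_lower.
by rewrite (lower_pair (i' := i') (j' := j') (k' := k') (l' := l') cf).
Qed.

Lemma lcoefS n f p q (i j : bool) : cas n.+1 f -> (p <= n)%N -> (q <= n)%N ->
  lcoef n.+1 (p + i) (q + j) f = lcoef n p q (L n.+1 i j f).
Proof. by move=> cf hp hq; apply: lcoef_lower => //; lia. Qed.

(* h shifted by (i, j) and extended by zero, avoiding truncated subtraction *)
Definition guard (h : nat -> nat -> S) (i j : bool) (p q : nat) : S :=
  if (i <= p)%N && (j <= q)%N then h (p - i)%N (q - j)%N else 0.

(* the coefficient of z^p w^q in ((1, z) minv (1, w)^T)^n *)
Fixpoint hcoef (n : nat) : nat -> nat -> S :=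
  if n is n'.+1 then fun p q =>
    \sum_(i : bool) \sum_(j : bool) m i j * guard (hcoef n') i j p q
  else fun p q => ((p == 0) && (q == 0))%:R.

Lemma hcoef_out n p q : (n < p)%N || (n < q)%N -> hcoef n p q = 0.
Proof.
elim: n p q => [|n IH] p q h /=; first by move: p q h => [|p] [|q].
rewrite big1 // => i _; rewrite big1 // => j _; rewrite /guard.
case: ifP => [/andP[h1 h2]|_]; last by rewrite mulr0.
by rewrite IH ?mulr0 //; move: i j h1 h2 => [] []; lia.
Qed.

Lemma shift_sum (n : nat) (k : bool) (G a : nat -> S) : a n.+1 = 0 ->
  \sum_(P < n.+2) G P * (if (k <= P)%N then a (P - k)%N else 0) = \sum_(p < n.+1) G (p + k)%N * a p.
Proof.
move=> a0; case: k => /=.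
  rewrite big_ord_recl /= mulr0 add0r; apply: eq_bigr => i _.
  by rewrite /bump /= add1n subn1 addn1.
rewrite big_ord_recr /= subn0 a0 mulr0 addr0; apply: eq_bigr => i _.
by rewrite subn0 addn0.
Qed.

Lemma shift_sum2 (n : nat) (i j : bool) (G : nat -> nat -> S) :
  \sum_(P < n.+2) \sum_(Q < n.+2) G P Q * guard (hcoef n) i j P Q =
  \sum_(p < n.+1) \sum_(q < n.+1) G (p + i)%N (q + j)%N * hcoef n p q.
Proof.
transitivity (\sum_(P < n.+2) 1 * (if (i <= P)%N then
    \sum_(q < n.+1) G ((P - i) + i)%N (q + j)%N * hcoef n (P - i)%N q else 0)).
  apply: eq_bigr => P _; rewrite mul1r; case: (leqP i P) => h; last first.
    by rewrite big1 // => Q _; rewrite /guard leqNgt h mulr0.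
  rewrite -(shift_sum j (fun Q => G (P - i + i)%N Q) (a := hcoef n (P - i))); last first.
    by rewrite hcoef_out // ltnSn orbT.
  by apply: eq_bigr => Q _; rewrite /guard h /= subnK.
rewrite (shift_sum i (fun=> 1) (a := fun p => \sum_(q < n.+1) G (p + i)%N (q + j)%N * hcoef n p q)).
  by apply: eq_bigr => p _; rewrite mul1r.
by rewrite big1 // => q _; rewrite hcoef_out ?mulr0 // ltnSn.
Qed.

(** Each use of Euler's identity costs a factor twice the degree, whence the total 2^n n!. The
    coefficients [lcoef] have weight 0 here; that they are constants is an analytic fact, supplied
    by [lap_eq0]. *)
Lemma expansion n f : cas n f ->
  (2 ^ n * n`!)%:R * f = \sum_(p < n.+1) \sum_(q < n.+1) lcoef n p q f * hcoef n p q.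
Proof.
elim: n f => [|n IH] f cf.
  by rewrite !big_ord1 /= mul1r mulr1.
have -> : (2 ^ n.+1 * n.+1`!)%:R * f = (2 ^ n * n`!)%:R * (2 * n.+1%:R * f).
  by rewrite expnS factS !natrM; ring.
rewrite -euler_lower.
have e i j : (2 ^ n * n`!)%:R * (m i j * L n.+1 i j f) =
   \sum_(P < n.+2) \sum_(Q < n.+2) lcoef n.+1 P Q f * (m i j * guard (hcoef n) i j P Q).
  transitivity (m i j * \sum_(p < n.+1) \sum_(q < n.+1)
      lcoef n.+1 (p + i) (q + j) f * hcoef n p q).
    rewrite mulrCA (IH _ (casimir_eq_lower i j cf)); congr (_ * _).
    by apply: eq_bigr => p _; apply: eq_bigr => q _; rewrite lcoefS // -ltnS.
  rewrite -(shift_sum2 n i j (fun P Q => lcoef n.+1 P Q f)) mulr_sumr.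
  by apply: eq_bigr => P _; rewrite mulr_sumr; apply: eq_bigr => Q _; rewrite mulrCA.
rewrite 3!(mulrDr (2 ^ n * n`!)%:R) !e -!big_split /=; apply: eq_bigr => P _; rewrite -!big_split /=.
by apply: eq_bigr => Q _; rewrite !big_bool /= -!mulrDr; congr (_ * _); ring.
Qed.

Lemma guard_lower n i j h k l p q :
  L n i j (guard h k l p q) = guard (fun p q => L n i j (h p q)) k l p q.
Proof. by rewrite /guard; case: ifP => // _; rewrite lower0. Qed.

Lemma guardC h i j k l p q : guard (guard h i j) k l p q = guard (guard h k l) i j p q.
Proof.
rewrite /guard; case: i; case: j; case: k; case: l => //=; rewrite ?subn0 //.
all: by case: p => [|[|p]]; case: q => [|[|q]].
Qed.

Lemma guard_scale c h k l p q : guard (fun p q => c * h p q) k l p q = c * guard h k l p q.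
Proof. by rewrite /guard; case: ifP; rewrite ?mulr0. Qed.

Lemma hcoefS n p q : hcoef n.+1 p q = \sum_(i : bool) \sum_(j : bool) m i j * guard (hcoef n) i j p q.
Proof. by []. Qed.

Lemma guard_hcoefS n i j p q : guard (hcoef n.+1) i j p q =
  \sum_(k : bool) \sum_(l : bool) m k l * guard (guard (hcoef n) i j) k l p q.
Proof.
under eq_bigr => k _ do under eq_bigr => l _ do rewrite guardC.
rewrite {1}/guard; case: ifP => h; first by apply: eq_bigr => k _; apply: eq_bigr => l _; rewrite [guard (guard _ _ _) _ _ _ _]/guard h.
by rewrite big1 // => k _; rewrite big1 // => l _; rewrite [guard (guard _ _ _) _ _ _ _]/guard h mulr0.
Qed.

(** The derivative of ((1, z) minv (1, w)^T)^(n+1) in the entry (i, j) is n+1 times z^i w^j times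
    the n-th power; [lower] doubles it and [guard] records the shift by z^i w^j. *)
Lemma lower_hcoef n i j p q : L n.+1 i j (hcoef n.+1 p q) = (2 * n.+1)%:R * guard (hcoef n) i j p q.
Proof.
elim: n i j p q => [|n IH] i j p q.
  have L0 k l : L 0 i j (guard (hcoef 0) k l p q) = 0.
    rewrite guard_lower /guard; case: ifP => // _.
    by rewrite /lower /= !(drvn HM, drvn EM, drvn FM); case: (i); ring.
  rewrite hcoefS !big_bool !lower_add !lower_minv !L0 !mulr0 !addr0.
  by case: i L0; case: j => _ /=; ring.
rewrite hcoefS lower_sum.
under eq_bigr => k _ do (rewrite lower_sum;
  under eq_bigr => l _ do rewrite lower_minv guard_lower).
have e : (\sum_(k : bool) \sum_(l : bool) m k l * guard (fun p q => L n.+1 i j (hcoef n.+1 p q)) k l p q) =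
    (2 * n.+1)%:R * guard (hcoef n.+1) i j p q.
  rewrite guard_hcoefS mulr_sumr; apply: eq_bigr => k _; rewrite mulr_sumr; apply: eq_bigr => l _.
  rewrite mulrCA -(guard_scale (2 * n.+1)%:R); congr (_ * _); rewrite /guard; case: ifP => // _; exact: IH.
transitivity (2 * guard (hcoef n.+1) i j p q + (2 * n.+1)%:R * guard (hcoef n.+1) i j p q).
  rewrite -e !big_bool /=; case: i {IH e}; case: j => /=; ring.
by rewrite -mulrDl -natrD -mulnS.
Qed.

(** Linear independence over the elements killed by H, E and F: a linear relation is differentiated
    along a path leading to the chosen index pair until one coefficient remains. The accumulated
    factor stays in the statement since the ring may have torsion. *)
Lemma hcoef_free n (c : nat -> nat -> S) :
  (forall p q, [/\ H (c p q) = 0, E (c p q) = 0 & F (c p q) = 0]) ->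
  \sum_(p < n.+1) \sum_(q < n.+1) c p q * hcoef n p q = 0 ->
  forall p q, (p <= n)%N -> (q <= n)%N -> (2 ^ n * n`!)%:R * c p q = 0.
Proof.
elim: n c => [|n IH] c Hc.
  rewrite !big_ord1 /= mulr1 => h p q; rewrite !leqn0 => /eqP -> /eqP ->.
  by rewrite h mulr0.
move=> h P Q hP hQ; set i := (0 < P)%N; set j := (0 < Q)%N.
have [p [hp eP]] : exists p, (p <= n)%N /\ P = (p + i)%N by exists (P - i)%N; rewrite /i; lia.
have [q [hq eQ]] : exists q, (q <= n)%N /\ Q = (q + j)%N by exists (Q - j)%N; rewrite /j; lia.
rewrite expnS factS mulnACA natrM mulrC mulrA mulrC.
have -> : c P Q * (2 * n.+1)%:R = (2 * n.+1)%:R * c (p + i)%N (q + j)%N by rewrite -eP -eQ mulrC.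
apply: (IH (fun p q => (2 * n.+1)%:R * c (p + i)%N (q + j)%N)) => //.
  move=> p' q'; have [h1 h2 h3] := Hc (p' + i)%N (q' + j)%N.
  by rewrite !(HM, EM, FM) h1 h2 h3 !(drvn HM, drvn EM, drvn FM) !mulr0 !mul0r addr0.
rewrite -(shift_sum2 n i j (fun P Q => (2 * n.+1)%:R * c P Q)).
transitivity (L n.+1 i j (\sum_(p < n.+2) \sum_(q < n.+2) c p q * hcoef n.+1 p q)); last first.
  by rewrite h lower0.
rewrite lower_sum; apply: eq_bigr => p' _; rewrite lower_sum; apply: eq_bigr => q' _.
have [h1 h2 h3] := Hc p' q'.
by rewrite lower_const // lower_hcoef; ring.
Qed.

(* the Dirac operator without its zeroth order part, conjugated to the frame s = g psi *)
Definition bop (s : bool -> S) (j : bool) : S :=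
  \sum_(k : bool) \sum_(i : bool) m i k * L 0 i j (s k).

(** The left side is row j of g applied to (I X_1 + J X_2 + K X_3) psi. The term 3 s collects the
    derivatives of g^-1, one for each field since -I^2 = -J^2 = -K^2 = 1. *)
Lemma dirac_gauge (s psi : bool -> S) j :
  (forall i, psi i = m i false * s false + m i true * s true) ->
  x j * (- H (psi false) - 2 * F (psi true)) + y j * (H (psi true) - 2 * E (psi false)) =
  3 * s j + bop s j.
Proof.
move=> Epsi; rewrite !Epsi.
transitivity (3 * s j * (x false * y true - y false * x true) + bop s j); last by rewrite det1 mulr1.
rewrite /bop !big_bool /lower /minv /=; case: j; rewrite !rules; ring.
Qed.

Lemma bop_sqr (s : bool -> S) j :
  bop (bop s) j + 2 * bop s j = H (H (s j)) + 2 * H (s j) + 4 * F (E (s j)).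
Proof.
transitivity (bop (bop s) j + 2 * (x false * y true - y false * x true) * bop s j);
  first by rewrite det1 mulr1.
transitivity ((x false * y true - y false * x true) ^+ 2 *
  (H (H (s j)) + 2 * H (s j) + 4 * F (E (s j)))); last by rewrite det1 expr1n mul1r.
rewrite /bop !big_bool /lower /minv /=; case: j; rewrite !rules; ring.
Qed.

(** Passing from weight 0 to weight n adds n times the entries of g to the derivatives, and these
    cancel against [minv]. In this form the operator can be evaluated through [lower_hcoef]. *)
Lemma bop_lower n (s : bool -> S) j :
  bop s j = \sum_(k : bool) \sum_(i : bool) m i k * L n i j (s k) - n%:R * s j.
Proof.
transitivity (\sum_(k : bool) \sum_(i : bool) m i k * L n i j (s k) -
   (x false * y true - y false * x true) * (n%:R * s j)); last by rewrite det1 mul1r.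
by rewrite /bop !big_bool /lower /minv /=; case: j; ring.
Qed.

Lemma casimir_eq_lcoef n p q f : cas n f -> cas 0 (lcoef n p q f).
Proof. by elim: n p q f => [|n IH] p q f cf //=; apply: IH; exact: casimir_eq_lower. Qed.

End Lowering.

(** * Symmetric powers of the standard representation *)

Lemma inord_false : inord false = 0 :> 'I_2.
Proof. by apply/val_inj; rewrite /= inordK. Qed.

Lemma inord_true : inord true = 1 :> 'I_2.
Proof. by apply/val_inj; rewrite /= inordK. Qed.

Section SymmetricPower.
Variable K : fieldType.

Definition lin (m : 'M[K]_2) (i : bool) : {poly K} :=
  (m (inord i) 0)%:P + m (inord i) 1 *: 'X.

Lemma size_lin m i : (size (lin m i) <= 2)%N.
Proof.
rewrite (leq_trans (size_polyD _ _)) // geq_max (leq_trans (size_polyC_leq1 _)) //.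
by rewrite (leq_trans (size_scale_leq _ _)) // size_polyX.
Qed.

Lemma coef_lin_mul m i (P : {poly K}) q :
  (lin m i * P)`_q = m (inord i) 0 * P`_q + (if q is q'.+1 then m (inord i) 1 * P`_q' else 0).
Proof.
rewrite mulrDl coefD mul_polyC coefZ; congr (_ + _).
by rewrite -scalerAl coefZ coefXM; case: q => [|q] //=; rewrite mulr0.
Qed.

Definition binary_form (m : 'M[K]_2) n p : {poly K} := lin m false ^+ (n - p) * lin m true ^+ p.

Lemma size_binary_form m n p : (p <= n)%N -> (size (binary_form m n p) <= n.+1)%N.
Proof.
have sz i k : (size (lin m i ^+ k) <= k.+1)%N.
  elim: k => [|k IH]; first by rewrite expr0 size_poly1.
  rewrite exprS (leq_trans (size_polyMleq _ _)) //.
  by rewrite -[k.+2]/(2 + k.+1).-1 -!subn1 leq_sub2r // leq_add // size_lin.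
move=> pn; rewrite (leq_trans (size_polyMleq _ _)) //.
have := leq_add (sz false (n - p)%N) (sz true p).
by rewrite addSn addnS subnK // -ltnS => h; case: (_ + _)%N h.
Qed.

(** Row p is the image of the p-th monomial under substitution of the rows of m, with the first
    variable set to 1. With this row convention Gamma acts on row vectors from the right. *)
Definition rho n (m : 'M[K]_2) : 'M[K]_n.+1 := \matrix_(p, q) (binary_form m n p)`_q.

(* the homogenisation of degree n of P, evaluated at (a, b) *)
Definition hom n (P : {poly K}) (a b : {poly K}) : {poly K} :=
  \sum_(q < n.+1) P`_q *: (a ^+ (n - q) * b ^+ q).

Lemma hom_lin m i n (P a b : {poly K}) : (size P <= n.+1)%N ->
  hom n.+1 (lin m i * P) a b = (m (inord i) 0 *: a + m (inord i) 1 *: b) * hom n P a b.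
Proof.
move=> sP; rewrite /hom.
under eq_bigr => q _ do rewrite coef_lin_mul scalerDl.
rewrite big_split /= mulrDl; congr (_ + _).
- rewrite big_ord_recr /= (nth_default _ sP) mulr0 scale0r addr0 mulr_sumr.
  apply: eq_bigr => q _; rewrite subSn; last by rewrite -ltnS.
  by rewrite exprS -scalerAl -scalerAr scalerA -!mulrA.
- rewrite big_ord_recl /= scale0r add0r mulr_sumr.
  apply: eq_bigr => q _; rewrite /bump /= subSS exprS -scalerAl -scalerAr scalerA.
  by rewrite mulrCA.
Qed.

Lemma hom_binary_form m n p (a b : {poly K}) : (p <= n)%N ->
  hom n (binary_form m n p) a b =
  (m 0 0 *: a + m 0 1 *: b) ^+ (n - p) * (m 1 0 *: a + m 1 1 *: b) ^+ p.
Proof.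
have hom0 : hom 0 1 a b = 1 by rewrite /hom big_ord1 coefC eqxx /= scale1r expr0 mulr1.
have sz0 k : (size (lin m true ^+ k) <= k.+1)%N.
  by have := size_binary_form m (leqnn k); rewrite /binary_form subnn expr0 mul1r.
have H1 k : hom k (lin m true ^+ k) a b = (m 1 0 *: a + m 1 1 *: b) ^+ k.
  elim: k => [|k IH]; first by rewrite !expr0 hom0.
  by rewrite exprS hom_lin // IH inord_true -exprS.
move=> pn; rewrite /binary_form; have e : n = (n - p + p)%N by rewrite subnK.
move: (n - p)%N e => k ->; elim: k => [|k IH]; first by rewrite add0n !expr0 !mul1r H1.
rewrite addSn exprS -mulrA hom_lin.
  by rewrite IH inord_false mulrA -exprS.
by have := @size_binary_form m (k + p) p (leq_addl _ _); rewrite /binary_form addnK.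
Qed.

(** Substituting the linear forms of [m2] into the monomials in the linear forms of [m1] gives the
    monomials in those of the product. *)
Lemma rhoM n (m1 m2 : 'M[K]_2) : rho n (m1 *m m2) = rho n m1 *m rho n m2.
Proof.
apply/matrixP => p r; rewrite !mxE.
have -> : binary_form (m1 *m m2) n p = hom n (binary_form m1 n p) (lin m2 false) (lin m2 true).
  rewrite hom_binary_form; last by rewrite -ltnS.
  rewrite /binary_form; congr (_ ^+ _ * _ ^+ _);
  rewrite /lin ?inord_false ?inord_true !mxE !big_ord_recl !big_ord0 /= !addr0 !scalerDr !scalerA !scalerDl
    !rmorphD !rmorphM /= -!mul_polyC !rmorphM /=;
  rewrite (_ : lift 0 0 = 1 :> 'I_2); try ring; exact: val_inj.
rewrite /hom coef_sum; apply: eq_bigr => q _.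
by rewrite coefZ !mxE.
Qed.

Lemma rho1 n : rho n 1%:M = 1%:M.
Proof.
apply/matrixP => p q; rewrite !mxE /binary_form /lin inord_false inord_true !mxE /= scale0r addr0 expr1n mul1r.
by rewrite scale1r add0r coefXn -val_eqE eq_sym.
Qed.

Lemma tr_rho_trig n (m : 'M[K]_2) : m 0 1 = 0 ->
  \tr (rho n m) = \sum_(p < n.+1) m 0 0 ^+ (n - p) * m 1 1 ^+ p.
Proof.
move=> m01; apply: eq_bigr => p _; rewrite mxE /binary_form.
rewrite /lin inord_false m01 scale0r addr0 -rmorphXn mul_polyC coefZ; congr (_ * _).
rewrite inord_true; elim: (p : nat) => [|k IH]; first by rewrite !expr0 coefC.
rewrite exprS -/(lin m true) mulrDl coefD mul_polyC coefZ -scalerAl coefZ coefXM /= IH.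
rewrite exprS nth_default ?mulr0 ?add0r //.
have := @size_binary_form m k k (leqnn k); rewrite /binary_form subnn expr0 mul1r /lin inord_true.
by move=> h; apply: leq_trans h _.
Qed.

Definition geom (a d : K) n := \sum_(p < n.+1) a ^+ (n - p) * d ^+ p.

Lemma geom_rec a d n : geom a d n.+2 = (a + d) * geom a d n.+1 - a * d * geom a d n.
Proof.
have g1 k : geom a d k.+1 = a * geom a d k + d ^+ k.+1.
  rewrite /geom big_ord_recr /= subnn expr0 mul1r mulr_sumr; congr (_ + _).
  by apply: eq_bigr => p _; rewrite mulrA -exprS subSn // -ltnS.
by rewrite !g1 !exprS; ring.
Qed.

(* (U_n(t/2), U_(n+1)(t/2)) for the Chebyshev polynomials of the second kind *)
Fixpoint cheb (t : K) n : K * K :=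
  if n is n'.+1 then let: (u, v) := cheb t n' in (v, t * v - u) else (1, t).

Lemma geom_cheb a d n : a * d = 1 -> cheb (a + d) n = (geom a d n, geom a d n.+1).
Proof.
move=> ad; elim: n => [|n IH] /=.
  by rewrite /geom big_ord1 big_ord_recr big_ord1 /= ?(subn0, subnn, expr0, expr1, mulr1, mul1r).
by rewrite IH geom_rec ad mul1r.
Qed.

(* the coefficient of z^p w^q in ((1, z) m (1, w)^T)^n *)
Definition hc (m : 'M[K]_2) n p q : K := 'C(n, p)%:R * (binary_form m n p)`_q.

Definition hpoly (m : 'M[K]_2) n p : {poly K} := 'C(n, p)%:R *: binary_form m n p.

Lemma hpolyS m n p : hpoly m n.+1 p =
  lin m false * hpoly m n p + (if p is p'.+1 then lin m true * hpoly m n p' else 0).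
Proof.
rewrite /hpoly /binary_form; case: p => [|p].
  by rewrite !bin0 !subn0 !scale1r !expr0 !mulr1 addr0 exprS.
rewrite binS natrD scalerDl -!scalerAr; congr (_ + _); last first.
  by rewrite subSS mulrCA -exprS.
case: (ltnP p n) => h; last by rewrite bin_small // !scale0r.
by rewrite mulrA -exprS subSS -subSn.
Qed.

Lemma deriv_hpoly m n p : (hpoly m n.+1 p)^`() =
  n.+1%:R *: (m 0 1 *: hpoly m n p + (if p is p'.+1 then m 1 1 *: hpoly m n p' else 0)).
Proof.
have dl i : (lin m i)^`() = (m (inord i) 1)%:P.
  by rewrite /lin derivD derivC derivZ derivX add0r alg_polyC.
rewrite /hpoly /binary_form derivZ derivM !deriv_exp !dl inord_false inord_true !mul_polyC scalerDr scalerDr.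
congr (_ + _).
- rewrite mulrnAl -scalerAl -scaler_nat !scalerA.
  have := mul_bin_down n.+1 p; rewrite /= => /(congr1 (fun k => k%:R : K)); rewrite !natrM => e.
  case: (leqP p n) => h.
    rewrite subSn //= -subSn //; congr (_ *: _).
    by rewrite [_ * _%:R]mulrC -e; ring.
  have -> : (n.+1 - p = 0)%N by apply/eqP.
  by rewrite mulr0 mul0r scale0r bin_small // mulr0 scale0r.
- case: p => [|p]; first by rewrite mulr0n mulr0 !scaler0.
  rewrite subSS -scaler_nat -!scalerAr !scalerA.
  have := mul_bin_diag n.+1 p; rewrite /= => /(congr1 (fun k => k%:R : K)); rewrite !natrM => e.
  by congr (_ *: _); rewrite mulrA [_ * p.+1%:R]mulrC -e; ring.
Qed.

(** Compare the coefficients of z^p w^r in the w-derivative of ((1, z) m (1, w)^T)^(n+1). *)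
Lemma hc_index1 (m : 'M[K]_2) n p r :
  n.+1%:R * (m 0 1 * hc m n p r + (if p is p'.+1 then m 1 1 * hc m n p' r else 0)) =
  r.+1%:R * hc m n.+1 p r.+1.
Proof.
have hcE k q s : hc m k q s = (hpoly m k q)`_s by rewrite /hc /hpoly coefZ.
rewrite !hcE [RHS]mulr_natl -coef_deriv deriv_hpoly [RHS]coefZ; congr (_ * _).
rewrite [RHS]coefD; congr (_ + _); first by rewrite [RHS]coefZ.
by case: p => [|p]; rewrite ?coef0 // [RHS]coefZ hcE.
Qed.

Lemma hc_rec (m : 'M[K]_2) n p q : hc m n.+1 p q =
  m 0 0 * hc m n p q + (if q is q'.+1 then m 0 1 * hc m n p q' else 0) +
  (if p is p'.+1 then m 1 0 * hc m n p' q + (if q is q'.+1 then m 1 1 * hc m n p' q' else 0) else 0).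
Proof.
have hcE k j s : hc m k j s = (hpoly m k j)`_s by rewrite /hc /hpoly coefZ.
rewrite hcE hpolyS coefD coef_lin_mul inord_false hcE; congr (_ + _ + _).
  by case: q => // q; rewrite hcE.
case: p => [|p]; first by rewrite coef0.
by rewrite coef_lin_mul inord_true hcE; case: q => // q; rewrite hcE.
Qed.

(** The same for the derivative in the homogeneous partner of w; Euler's relation, in the form of
    [hc_rec], reduces it to [hc_index1]. *)
Lemma hc_index0 (m : 'M[K]_2) n p r : (r <= n.+1)%N ->
  n.+1%:R * (m 0 0 * hc m n p r + (if p is p'.+1 then m 1 0 * hc m n p' r else 0)) =
  (n.+1 - r)%:R * hc m n.+1 p r.
Proof.
move=> rn; rewrite natrB // mulrBl.
case: r rn => [|r] rn; first by rewrite hc_rec; case: p => [|p]; ring.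
by rewrite -hc_index1; case: p => [|p]; rewrite hc_rec; ring.
Qed.

End SymmetricPower.

(** * Calculus on SU(2) *)

Section Quaternions.
Variable R : realType.
Local Notation C := R[i].
Local Notation SU2 := (SU2 R).

Definition mxq (a b c d : R) : 'M[C]_2 :=
  mx2 (a +i* b) (c +i* d) (- c +i* d) (a -i* b).

Definition q0 (g : SU2) : R := complex.Re (SU2val g 0 0).
Definition q1 (g : SU2) : R := complex.Im (SU2val g 0 0).
Definition q2 (g : SU2) : R := complex.Re (SU2val g 0 1).
Definition q3 (g : SU2) : R := complex.Im (SU2val g 0 1).

Lemma mx2_eta (T : Type) (M : 'M[T]_2) : M = mx2 (M 0 0) (M 0 1) (M 1 0) (M 1 1).
Proof.
apply/matrixP => -[[|[|//]] i] [[|[|//]] j]; rewrite !mxE /=; congr (M _ _);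
  exact: val_inj.
Qed.

Lemma det_mx2 (T : comPzRingType) (a b c d : T) :
  \det (mx2 a b c d) = a * d - b * c.
Proof.
rewrite (expand_det_row _ 0) big_ord_recl big_ord1 /cofactor !det_mx11 !mxE /=.
by rewrite expr0 expr1; ring.
Qed.

Lemma mx2_inj (T : Type) (a b c d a' b' c' d' : T) :
  mx2 a b c d = mx2 a' b' c' d' -> [/\ a = a', b = b', c = c' & d = d'].
Proof.
move=> /matrixP E; have := (E 0 0, E 0 1, E 1 0, E 1 1).
by rewrite !mxE /= => -[[[-> ->] ->] ->].
Qed.

Lemma SU2_mxq (g : SU2) : SU2val g = mxq (q0 g) (q1 g) (q2 g) (q3 g).
Proof.
rewrite /q0 /q1 /q2 /q3; case: g => g /= /andP[gu /eqP gd].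
have gV := unitarymx_unit gu.
have E1 : g *m (map_mx Num.conj g^T) = 1%:M by apply/unitarymxP.
move: gd E1; rewrite (mx2_eta g) det_mx2.
set a := g 0 0; set b := g 0 1; set c := g 1 0; set d := g 1 1 => gd.
have -> : map_mx Num.conj (mx2 a b c d)^T = mx2 a^* c^* b^* d^*.
  by apply/matrixP => -[[|[|//]] ?] [[|[|//]] ?]; rewrite !mxE.
rewrite mulmx2 -mx2_1 => M1; have [E1 E2 E3 E4] := mx2_inj M1.
rewrite !mxE /= /mxq.
(* Multiplying by |a|^2 + |b|^2 = 1 and eliminating with the determinant and the orthogonality of
   the rows isolates d, and likewise c. *)
have dE : d = a^*.
  transitivity (d * (a * a^* + b * b^*)); first by rewrite E1 mulr1.
  transitivity (a^* * (a * d - b * c) + b^* * (c * a^* + d * b^*) - b^* * (c * a^* + d * b^*)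
    + b * (c * a^* + d * b^*)); last by rewrite gd E3; ring.
  ring.
have cE : c = - b^*.
  transitivity (c * (a * a^* + b * b^*)); first by rewrite E1 mulr1.
  transitivity (- b^* * (a * d - b * c) + a * (c * a^* + d * b^*)); last by rewrite gd E3; ring.
  ring.
rewrite dE cE; case: (a) (b) => [x y] [z w] /=.
by rewrite /Num.conj /=; congr (mx2 _ _ _ _); simpc.
Qed.

Lemma mxq_inj (a b c d a' b' c' d' : R) :
  mxq a b c d = mxq a' b' c' d' -> [/\ a = a', b = b', c = c' & d = d'].
Proof. by move=> E; have [[-> ->] [-> ->] _ _] := mx2_inj E. Qed.

Lemma SU2_mxq_eq (g : SU2) (a b c d : R) : SU2val g = mxq a b c d ->
  [/\ q0 g = a, q1 g = b, q2 g = c & q3 g = d].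
Proof. by rewrite SU2_mxq => /mxq_inj. Qed.

Lemma SU2_norm (g : SU2) : q0 g ^+ 2 + q1 g ^+ 2 + q2 g ^+ 2 + q3 g ^+ 2 = 1.
Proof.
have: \det (SU2val g) = 1 by case: g => g /= /andP[_ /eqP].
rewrite SU2_mxq /mxq det_mx2; simpc => -[<- _]; ring.
Qed.

Lemma SU2_eqP (g h : SU2) :
  q0 g = q0 h -> q1 g = q1 h -> q2 g = q2 h -> q3 g = q3 h -> g = h.
Proof. by move=> e0 e1 e2 e3; apply: val_inj; rewrite /= !SU2_mxq e0 e1 e2 e3. Qed.

Lemma mul_mxq (a b c d a' b' c' d' : R) : mxq a b c d *m mxq a' b' c' d' =
  mxq (a * a' - b * b' - c * c' - d * d') (a * b' + b * a' + c * d' - d * c')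
      (a * c' - b * d' + c * a' + d * b') (a * d' + b * c' - c * b' + d * a').
Proof.
rewrite /mxq mulmx2.
by congr (mx2 _ _ _ _); simpc; congr (_ +i* _); ring.
Qed.

Lemma q_mul (g h : SU2) :
  [/\ q0 (g * h)%g = q0 g * q0 h - q1 g * q1 h - q2 g * q2 h - q3 g * q3 h,
      q1 (g * h)%g = q0 g * q1 h + q1 g * q0 h + q2 g * q3 h - q3 g * q2 h,
      q2 (g * h)%g = q0 g * q2 h - q1 g * q3 h + q2 g * q0 h + q3 g * q1 h
    & q3 (g * h)%g = q0 g * q3 h + q1 g * q2 h - q2 g * q1 h + q3 g * q0 h].
Proof.
apply: SU2_mxq_eq; rewrite -mul_mxq -!SU2_mxq; reflexivity.
Qed.

Lemma mxq_id : mxq 1 0 0 0 = 1%:M.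
Proof. by rewrite -mx2_1 /mxq; congr (mx2 _ _ _ _); rewrite ?oppr0. Qed.

Lemma q_one : [/\ q0 1%g = 1, q1 1%g = 0, q2 1%g = 0 & q3 1%g = 0].
Proof. by apply: SU2_mxq_eq; rewrite mxq_id. Qed.

Definition mkq (a b c d : R) (N : a ^+ 2 + b ^+ 2 + c ^+ 2 + d ^+ 2 = 1) : SU2 :=
  MkSU2 (SU2_quat N).

Lemma q_mkq a b c d N : let g := @mkq a b c d N in
  [/\ q0 g = a, q1 g = b, q2 g = c & q3 g = d].
Proof. exact: SU2_mxq_eq. Qed.

Lemma q_inv (g : SU2) :
  [/\ q0 g^-1%g = q0 g, q1 g^-1%g = - q1 g, q2 g^-1%g = - q2 g & q3 g^-1%g = - q3 g].
Proof.
have N : q0 g ^+ 2 + (- q1 g) ^+ 2 + (- q2 g) ^+ 2 + (- q3 g) ^+ 2 = 1.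
  by rewrite !sqrrN SU2_norm.
suff -> : g^-1%g = mkq N by exact: q_mkq.
have [k0 k1 k2 k3] := q_mkq N.
have [u0 u1 u2 u3] := q_one.
have [m0 m1 m2 m3] := q_mul g (mkq N).
have E : (g * mkq N)%g = 1%g.
  have NN := SU2_norm g.
  apply: SU2_eqP.
  - by rewrite m0 k0 k1 k2 k3 u0 -NN; ring.
  - by rewrite m1 k0 k1 k2 k3 u1; ring.
  - by rewrite m2 k0 k1 k2 k3 u2; ring.
  - by rewrite m3 k0 k1 k2 k3 u3; ring.
by apply: (mulgI g); rewrite mulgV E.
Qed.

Definition qdelta (i : 'I_3) (k : nat) : R := (val i == k)%:R.

Lemma q_exp (i : 'I_3) (t : R) :
  [/\ q0 (su2_exp i t) = cos t, q1 (su2_exp i t) = qdelta i 0 * sin t,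
      q2 (su2_exp i t) = qdelta i 1 * sin t & q3 (su2_exp i t) = qdelta i 2 * sin t].
Proof.
apply: SU2_mxq_eq; rewrite /= mexp_sqrN1 ?su2_basis_sqr // -[1]mx2_1.
rewrite /qdelta; case: i => [[|[|[|//]]] ?];
  rewrite /su2_basis (tnth_nth 0) /= !scale_mx2 add_mx2 /mxq;
  by congr (mx2 _ _ _ _); simpc.
Qed.

Lemma su2_exp0 i : su2_exp i (0 : R) = 1%g.
Proof.
have [e0 e1 e2 e3] := q_exp i 0; have [u0 u1 u2 u3] := q_one.
by apply: SU2_eqP; rewrite ?(e0, e1, e2, e3, u0, u1, u2, u3) ?cos0 ?sin0 ?mulr0.
Qed.

Lemma su2_expD i (s t : R) : su2_exp i (s + t) = (su2_exp i s * su2_exp i t)%g.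
Proof.
have [e0 e1 e2 e3] := q_exp i (s + t).
have [a0 a1 a2 a3] := q_exp i s.
have [b0 b1 b2 b3] := q_exp i t.
have [m0 m1 m2 m3] := q_mul (su2_exp i s) (su2_exp i t).
apply: SU2_eqP; rewrite ?(e0, e1, e2, e3, m0, m1, m2, m3).
all: rewrite !(a0, a1, a2, a3, b0, b1, b2, b3) ?cosD ?sinD /qdelta.
all: by case: i {e0 e1 e2 e3 a0 a1 a2 a3 b0 b1 b2 b3 m0 m1 m2 m3} => [[|[|[|//]]] ?] /=; ring.
Qed.

(** The four component equations are packed into one tuple so that a single [rewrite] selects
    whichever applies; the same holds for [qE], [qV] and [qone]. *)
Definition qM := (fun g h => let: And4 a _ _ _ := q_mul g h in a,
                  fun g h => let: And4 _ a _ _ := q_mul g h in a,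
                  fun g h => let: And4 _ _ a _ := q_mul g h in a,
                  fun g h => let: And4 _ _ _ a := q_mul g h in a).
Definition qE := (fun i t => let: And4 a _ _ _ := q_exp i t in a,
                  fun i t => let: And4 _ a _ _ := q_exp i t in a,
                  fun i t => let: And4 _ _ a _ := q_exp i t in a,
                  fun i t => let: And4 _ _ _ a := q_exp i t in a).
Definition qV := (fun g => let: And4 a _ _ _ := q_inv g in a,
                  fun g => let: And4 _ a _ _ := q_inv g in a,
                  fun g => let: And4 _ _ a _ := q_inv g in a,
                  fun g => let: And4 _ _ _ a := q_inv g in a).
Definition qone := (let: And4 a _ _ _ := q_one in a,
                  let: And4 _ a _ _ := q_one in a,
                  let: And4 _ _ a _ := q_one in a,
                  let: And4 _ _ _ a := q_one in a).

End Quaternions.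

(** * Reduction of convergence to real coordinates *)

Section ComplexLimits.
Variable R : realType.
Local Notation C := R[i].

Lemma normc_ltR (z : C) (e : R) : `|z| < e%:C -> `|complex.Re z| < e /\ `|complex.Im z| < e.
Proof.
rewrite normc_def ltcR; case: z => x y /= H.
have e0 : 0 < e by rewrite (le_lt_trans _ H) ?sqrtr_ge0.
split; apply: le_lt_trans H.
  by rewrite -sqrtr_sqr ler_wsqrtr // lerDl sqr_ge0.
by rewrite -sqrtr_sqr ler_wsqrtr // lerDr sqr_ge0.
Qed.

Lemma normc_leD (x y : R) : `|x +i* y| <= (`|x| + `|y|)%:C.
Proof.
rewrite normc_def lecR /= -[leRHS]ger0_norm ?addr_ge0 // -sqrtr_sqr ler_wsqrtr //.
rewrite sqrrD !real_normK ?num_real // -addrA [_ *+ 2 + _]addrC addrA lerDl.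
by rewrite mulrn_wge0 ?mulr_ge0.
Qed.

Lemma pos_complexE (e : C) : 0 < e -> e = (complex.Re e)%:C /\ 0 < complex.Re e.
Proof. by case: e => a b; rewrite ltcE /= => /andP[/eqP -> ->]. Qed.

Lemma cvg_complexP T (F : set_system T) (FF : Filter F) (u : T -> C) (z : C) :
  (u x @[x --> F] --> z) <->
  ((complex.Re (u x) @[x --> F] --> complex.Re z) /\
   (complex.Im (u x) @[x --> F] --> complex.Im z)).
Proof.
split=> [/cvgrPdist_lt H | [/cvgrPdist_lt H1 /cvgrPdist_lt H2]].
  have H' (e : R) : 0 < e -> \forall x \near F, `|z - u x| < e%:C.
    by move=> e0; apply: H; rewrite ltcR.
  split; apply/cvgrPdist_lt => e /H'; apply: filterS => x /normc_ltR.
    by case: (z) (u x) => [a b] [c d] /= [].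
  by case: (z) (u x) => [a b] [c d] /= [].
apply/cvgrPdist_lt => e /pos_complexE[-> e0].
have e2 : 0 < complex.Re e / 2 by rewrite divr_gt0.
near=> x; have h1 : `|complex.Re z - complex.Re (u x)| < complex.Re e / 2.
  by near: x; exact: H1.
have h2 : `|complex.Im z - complex.Im (u x)| < complex.Re e / 2.
  by near: x; exact: H2.
have -> : z - u x = (complex.Re z - complex.Re (u x)) +i* (complex.Im z - complex.Im (u x)).
  by case: (z) (u x) => [a b] [c d].
by apply: le_lt_trans (normc_leD _ _) _; rewrite ltcR [ltRHS]splitr ltrD.
Unshelve. all: by end_near. Qed.

Lemma cvg_mxP T (K : topologicalType) m n (F : set_system T) (FF : Filter F)
    (u : T -> 'M[K]_(m, n)) (M : 'M[K]_(m, n)) :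
  (u x @[x --> F] --> M) <-> (forall i j, u x i j @[x --> F] --> M i j).
Proof.
split=> [H i j A Aij|H A [P MP /= PA]].
  apply: (H [set N | A (N i j)]).
  exists (fun i' j' => [set y | (i' == i) && (j' == j) -> A y]).
    move=> i' j' /=; case: (i' =P i) => [->|_]; last exact: filterE.
    case: (j' =P j) => [->|_]; last exact: filterE.
    by apply: filterS Aij => y Ay _.
  by move=> N /= /(_ i j); rewrite !eqxx; apply.
have : \forall x \near F, forall i j, P i j (u x i j).
  by apply: filter_forall => i; apply: filter_forall => j; exact: H (MP i j).
by apply: filterS => x Px; apply: PA.
Qed.

End ComplexLimits.

Section SU2Topology.
Variable R : realType.
Local Notation C := R[i].
Local Notation SU2 := (SU2 R).

Lemma cvg_SU2valP T (F : set_system T) (FF : Filter F) (u : T -> SU2) (g : SU2) :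
  (u x @[x --> F] --> g) <-> (SU2val (u x) @[x --> F] --> SU2val g).
Proof.
split=> [H|H A].
  exact: (cvg_comp _ _ H (@initial_continuous _ _ (@SU2val R) g)).
rewrite /= nbhsE /= => -[_ [[B Bop <-] /= Bg] BA].
have HB := H B (open_nbhs_nbhs (conj Bop Bg)).
by apply: (@filterS _ F FF _ _ _ HB) => x Bx; exact: BA.
Qed.

Lemma cvg_SU2P T (F : set_system T) (FF : Filter F) (u : T -> SU2) (g : SU2) :
  (u x @[x --> F] --> g) <->
  [/\ q0 (u x) @[x --> F] --> q0 g, q1 (u x) @[x --> F] --> q1 g,
      q2 (u x) @[x --> F] --> q2 g & q3 (u x) @[x --> F] --> q3 g].
Proof.
rewrite cvg_SU2valP cvg_mxP; split=> [H|[h0 h1 h2 h3] i j].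
  have [h0 h1] := (cvg_complexP _ _ _).1 (H 0 0).
  by have [h2 h3] := (cvg_complexP _ _ _).1 (H 0 1).
apply/cvg_complexP; rewrite (SU2_mxq g) !mxE.
under eq_cvg do rewrite SU2_mxq mxE.
under [X in _ /\ X]eq_cvg do rewrite SU2_mxq mxE.
have nh2 := cvgN h2; have nh1 := cvgN h1.
by do 2 case: ifP => _ /=; split=> //; [exact: nh2|exact: nh1].
Qed.

Lemma q_continuous : [/\ continuous (@q0 R), continuous (@q1 R), continuous (@q2 R)
  & continuous (@q3 R)].
Proof.
have H (g : SU2) : x @[x --> nbhs g] --> g by exact: cvg_id.
by split=> g; have [] := (cvg_SU2P _ _ _).1 (H g).
Qed.

Lemma mulg_cvg T (F : set_system T) {FF : Filter F} (u v : T -> SU2) (g h : SU2) :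
  u x @[x --> F] --> g -> v x @[x --> F] --> h -> (u x * v x)%g @[x --> F] --> (g * h)%g.
Proof.
move=> /cvg_SU2P[a0 a1 a2 a3] /cvg_SU2P[b0 b1 b2 b3]; apply/cvg_SU2P.
split; under eq_cvg do rewrite qM; rewrite qM.
- exact: (cvgB (cvgB (cvgB (cvgM a0 b0) (cvgM a1 b1)) (cvgM a2 b2)) (cvgM a3 b3)).
- exact: (cvgB (cvgD (cvgD (cvgM a0 b1) (cvgM a1 b0)) (cvgM a2 b3)) (cvgM a3 b2)).
- exact: (cvgD (cvgD (cvgB (cvgM a0 b2) (cvgM a1 b3)) (cvgM a2 b0)) (cvgM a3 b1)).
- exact: (cvgD (cvgB (cvgD (cvgM a0 b3) (cvgM a1 b2)) (cvgM a2 b1)) (cvgM a3 b0)).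
Qed.

Lemma su2_exp_continuous i : continuous (@su2_exp R i).
Proof.
move=> t; apply/cvg_SU2P.
have cs := @continuous_sin R t; have cc := @continuous_cos R t.
split; under eq_cvg do rewrite qE; rewrite qE; first exact: cc.
all: by apply: cvgM; [exact: cvg_cst|exact: cs].
Qed.

End SU2Topology.

(** * Second derivatives in one and two real variables *)

Section OneVariable.
Variable R : realType.

Lemma is_derive0P (phi : R -> R) (d : R) :
  (h^-1 * (phi h - phi 0) @[h --> 0^'] --> d) <-> is_derive (0 : R) (1 : R) phi d.
Proof.
have E : (fun h : R => h^-1 *: ((phi \o shift 0) (h *: 1) - phi 0)) =
  (fun h => h^-1 * (phi h - phi 0)).
  by apply/funext => h /=; rewrite addr0 [h *: 1]mulr1.
split=> [H|[H1 H2]].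
  have dd : derivable phi 0 1 by rewrite /derivable E; apply/cvg_ex; exists d.
  by apply: DeriveDef => //; rewrite /derive E; exact: cvg_lim H.
by move: H1 H2; rewrite /derivable /derive E => H1 <-.
Qed.

(** A positive second derivative would make [dphi] positive just to the right of 0, and the mean
    value theorem would give values above the maximum. The second derivative is used at 0 only. *)
Lemma second_derivative_max (phi dphi : R -> R) (d : R) :
  (forall t, is_derive (t : R) (1 : R) phi (dphi t)) -> is_derive (0 : R) (1 : R) dphi d ->
  (forall t, phi t <= phi 0) -> d <= 0.
Proof.
move=> H1 H2 mx.
have c1 : continuous phi.
  by move=> t; apply: differentiable_continuous; apply/derivable1_diffP; case: (H1 t).
have MV a b : a < b -> exists2 c, a < c < b & phi b - phi a = dphi c * (b - a).
  move=> ab; have [|c cab ->] := @MVT _ phi dphi a b ab (fun x _ => H1 x).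
    exact: continuous_subspaceT.
  by exists c => //; move: cab; rewrite in_itv.
have d0 : dphi 0 = 0.
  have c0 : {for 0, continuous dphi}.
    by apply: differentiable_continuous; apply/derivable1_diffP; case: H2.
  apply/eqP; case: (ltgtP (dphi 0) 0) => // h; exfalso.
  - have /nbhs_ballP[e /= e0 He] : \forall x \near (0 : R), dphi x < 0.
      exact: (cvgr_lt _ c0 _ h).
    have [|c /andP[c1' c2] E] := MV (- (e / 2)) 0; first by rewrite oppr_lt0 divr_gt0.
    have := He c; rewrite /ball /= sub0r normrN => /(_ _).
    have -> : `|c| < e by rewrite ltr0_norm //; lra.
    move=> /(_ isT) hc; have := mx (- (e / 2)).
    have : 0 < - dphi c * (e / 2) by rewrite mulr_gt0 ?oppr_gt0 ?divr_gt0.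
    lra.
  - have /nbhs_ballP[e /= e0 He] : \forall x \near (0 : R), 0 < dphi x.
      exact: (cvgr_gt _ c0 _ h).
    have [|c /andP[c1' c2] E] := MV 0 (e / 2); first by rewrite divr_gt0.
    have := He c; rewrite /ball /= sub0r normrN => /(_ _).
    have -> : `|c| < e by rewrite gtr0_norm //; lra.
    move=> /(_ isT) hc; have := mx (e / 2).
    have : 0 < dphi c * (e / 2) by rewrite mulr_gt0 ?divr_gt0.
    lra.
rewrite leNgt; apply/negP => dpos.
move/is_derive0P: H2; rewrite d0 => H2.
have [e /= e0 He] := cvgr_gt _ H2 _ dpos.
have [|c /andP[c1' c2] E] := MV 0 (e / 2); first by rewrite divr_gt0.
have := He c; rewrite /ball /= sub0r normrN subr0 => /(_ _ _).
have -> : `|c| < e by rewrite gtr0_norm //; lra.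
move=> /(_ isT); rewrite gt_eqF // => /(_ isT).
rewrite pmulr_rgt0 ?invr_gt0 // => hc; have := mx (e / 2).
have : 0 < dphi c * (e / 2) by rewrite mulr_gt0 ?divr_gt0.
lra.
Qed.

(** Schwarz's theorem: the second difference of u over the square of side e is e^2 times a value of
    either mixed derivative at a point inside the square. *)
Lemma mixed_partials (u us ut ust uts : R -> R -> R) :
  (forall s t, is_derive (s : R) (1 : R) (fun x => u x t) (us s t)) ->
  (forall s t, is_derive (t : R) (1 : R) (u s) (ut s t)) ->
  (forall s t, is_derive (s : R) (1 : R) (fun x => ut x t) (ust s t)) ->
  (forall s t, is_derive (t : R) (1 : R) (us s) (uts s t)) ->
  {for (0, 0), continuous (fun x : R * R => ust x.1 x.2)} ->
  {for (0, 0), continuous (fun x : R * R => uts x.1 x.2)} ->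
  ust 0 0 = uts 0 0.
Proof.
move=> Hs Ht Hst Hts cst cts.
have cont (f df : R -> R) : (forall x, is_derive (x : R) (1 : R) f (df x)) -> continuous f.
  by move=> H t; apply: differentiable_continuous; apply/derivable1_diffP; case: (H t).
have MV (f df : R -> R) a b : (forall x, is_derive (x : R) (1 : R) f (df x)) -> a < b ->
    exists2 c, a < c < b & f b - f a = df c * (b - a).
  move=> H ab; have [|c cab ->] := @MVT _ f df a b ab (fun x _ => H x).
    exact: continuous_subspaceT (cont _ _ H).
  by exists c => //; move: cab; rewrite in_itv.
apply/eqP; rewrite -subr_eq0 -normr_le0; apply/ler_addgt0Pl => d d0; rewrite addr0.
have d2 : 0 < d / 2 by rewrite divr_gt0.
have /nbhs_ballP[e1 /= e10 H1] : nbhs (0 : R, 0 : R)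
    (fun x => `|ust 0 0 - ust x.1 x.2| < d / 2) by exact: cvgr_dist_lt _ _ cst _ d2.
have /nbhs_ballP[e2 /= e20 H2] : nbhs (0 : R, 0 : R)
    (fun x => `|uts 0 0 - uts x.1 x.2| < d / 2) by exact: cvgr_dist_lt _ _ cts _ d2.
pose e := Num.min e1 e2 / 2.
have m0 : 0 < Num.min e1 e2 by rewrite lt_min e10 e20.
have e0 : 0 < e by rewrite divr_gt0.
have in1 x y : 0 < x < e -> 0 < y < e ->
    ball (0 : R, 0 : R) e1 (x, y) /\ ball (0 : R, 0 : R) e2 (x, y).
  move=> /andP[x0 xe] /andP[y0 ye].
  have : e < e1 /\ e < e2.
    by split; apply: (@lt_le_trans _ _ (Num.min e1 e2));
       rewrite ?ge_min ?lexx ?orbT // /e ltr_pdivrMr // mulr_natr mulr2n ltrDl.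
  move=> [h1 h2].
  by split; split; rewrite /ball /= sub0r normrN gtr0_norm //;
    (apply: lt_trans h1 || apply: lt_trans h2).
have [s1 s1e E1] := MV (fun x => u x e - u x 0) (fun x => us x e - us x 0) 0 e
  (fun x => is_deriveB (Hs x e) (Hs x 0)) e0.
have [t1 t1e E2] := MV (us s1) (uts s1) 0 e (Hts s1) e0.
have [t2 t2e E3] := MV (fun y => u e y - u 0 y) (fun y => ut e y - ut 0 y) 0 e
  (fun y => is_deriveB (Ht e y) (Ht 0 y)) e0.
have [s2 s2e E4] := MV (fun x => ut x t2) (fun x => ust x t2) 0 e (fun x => Hst x t2) e0.
have E : uts s1 t1 = ust s2 t2.
  have ee : e * e != 0 by rewrite mulf_neq0 // gt_eqF.
  apply: (mulIf ee); move: E1 E2 E3 E4; rewrite !subr0 !mulrA => E1 <- E3 <-.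
  by rewrite -E1 -E3; ring.
have [_ B2] := in1 _ _ s1e t1e; have [B1 _] := in1 _ _ s2e t2e.
have := H1 _ B1; have := H2 _ B2; rewrite /= E => h2 h1.
have -> : ust 0 0 - uts 0 0 = (ust 0 0 - ust s2 t2) - (uts 0 0 - ust s2 t2) by ring.
by rewrite (le_trans (ler_normB _ _)) // [leRHS]splitr lerD // ltW.
Qed.

End OneVariable.

(** * Derivatives along the one-parameter subgroups *)

Section LieDerivative.
Variable R : realType.
Local Notation SU2 := (SU2 R).

Definition orbit_map (f : SU2 -> R) (i : 'I_3) (g : SU2) : R -> R :=
  fun t => f (g * su2_exp i t)%g.

Definition dR (i : 'I_3) (f : SU2 -> R) (g : SU2) : R := derive1 (orbit_map f i g) 0.

Definition drv (i : 'I_3) (f : SU2 -> R) : Prop :=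
  forall g, derivable (orbit_map f i g) 0 1.

Fixpoint CnR (n : nat) (f : SU2 -> R) : Prop :=
  continuous f /\
  if n is m.+1 then forall i, drv i f /\ CnR m (dR i f) else True.

Lemma dRP i f : drv i f -> forall g, is_derive (0 : R) (1 : R) (orbit_map f i g) (dR i f g).
Proof. by move=> H g; apply: DeriveDef => //; rewrite /dR derive1E. Qed.

Lemma dR_unique i f g d : is_derive (0 : R) (1 : R) (orbit_map f i g) d -> dR i f g = d.
Proof. by move=> H; rewrite /dR derive1E derive_val. Qed.

Lemma dR_flow i f : drv i f -> forall g (t : R),
  is_derive (t : R) (1 : R) (orbit_map f i g) (dR i f (g * su2_exp i t)%g).
Proof.
move=> H g t.
have -> : orbit_map f i g = orbit_map f i (g * su2_exp i t)%g \o (fun s => s - t).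
  by apply/funext => s; rewrite /orbit_map /= -mulgA -su2_expD addrC subrK.
have H0 := dRP H (g * su2_exp i t)%g.
have H1 : is_derive (t : R) (1 : R) (fun s : R => s - t) 1.
  have := is_deriveB (is_derive_id t (1 : R)) (is_derive_cst t t (1 : R)).
  by rewrite subr0.
rewrite -[dR _ _ _]mulr1.
by apply: is_derive1_comp => /=; rewrite subrr.
Qed.

Lemma dR_MVT i f : drv i f -> forall g (t : R), exists2 c : R, `|c| <= `|t| &
  f (g * su2_exp i t)%g - f g = dR i f (g * su2_exp i c)%g * t.
Proof.
move=> H g t.
have fl := dR_flow H g.
have cf : continuous (orbit_map f i g).
  by move=> x; apply: differentiable_continuous; apply/derivable1_diffP; case: (fl x).
have E0 : f g = orbit_map f i g 0 by rewrite /orbit_map su2_exp0 mulg1.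
case: (ltgtP t 0) => [t0|t0|->].
- have [|c /[!in_itv]/= /andP[h1 h2] E] :=
    @MVT _ (orbit_map f i g) _ t 0 t0 (fun x _ => fl x).
    exact: continuous_subspaceT.
  exists c; first by rewrite !ltr0_norm // lerN2 ltW.
  by rewrite E0 -[f _]/(orbit_map f i g t) -opprB E; ring.
- have [|c /[!in_itv]/= /andP[h1 h2] E] :=
    @MVT _ (orbit_map f i g) _ 0 t t0 (fun x _ => fl x).
    exact: continuous_subspaceT.
  exists c; first by rewrite !gtr0_norm // ltW.
  by rewrite E0 -[f _]/(orbit_map f i g t) E subr0.
- by exists 0 => //; rewrite su2_exp0 mulg1 subrr mulr0.
Qed.

Lemma su2_exp_cvg i (p : R -> R) (F : set_system R) {FF : Filter F} :
  p x @[x --> F] --> 0 -> su2_exp i (p x) @[x --> F] --> (1 : SU2)%g.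
Proof.
move=> H; rewrite -(su2_exp0 R i).
exact: (cvg_comp _ _ H (@su2_exp_continuous R i 0)).
Qed.

(* Along [theta s * exp (p s X_i)] the increment in the last factor is [p s] times a
   value of [dR i f] near [g], by the mean value theorem. *)
Lemma dR_path i f (g : SU2) (theta : R -> SU2) (p : R -> R) (p' : R) :
  drv i f -> continuous (dR i f) ->
  theta s @[s --> (0 : R)^'] --> g -> p 0 = 0 -> is_derive (0 : R) (1 : R) p p' ->
  s^-1 * (f (theta s * su2_exp i (p s))%g - f (theta s)) @[s --> (0 : R)^'] -->
    dR i f g * p'.
Proof.
move=> df cdf cth p0 dp.
(* [c] picks intermediate points of the mean value theorem; the bound by |p s| gives its convergence
   to 0, whatever the choice. *)
have /choice[c Hc] : forall s, exists c, `|c| <= `|p s| /\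
    f (theta s * su2_exp i (p s))%g - f (theta s) = dR i f (theta s * su2_exp i c)%g * p s.
  by move=> s; have [c c1 c2] := dR_MVT df (theta s) (p s); exists c.
have cp : p s @[s --> (0 : R)^'] --> 0.
  have : {for 0, continuous p}.
    by apply: differentiable_continuous; apply/derivable1_diffP; case: dp.
  rewrite /prop_for /continuous_at p0 => /(cvg_within_filter _); exact.
have cc : c s @[s --> (0 : R)^'] --> 0.
  apply/cvgrPdist_lt => e e0; near=> s.
  rewrite sub0r normrN (le_lt_trans (proj1 (Hc s))) // -normrN -sub0r.
  by near: s; exact: cvgr_dist_lt _ _ cp _ e0.
move/is_derive0P: dp; rewrite p0 => dp.
have E : (fun s => s^-1 * (f (theta s * su2_exp i (p s))%g - f (theta s))) =
    (fun s => dR i f (theta s * su2_exp i (c s))%g * (s^-1 * (p s - 0))).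
  by apply/funext => s; have [_ ->] := Hc s; rewrite subr0; ring.
rewrite E; apply: cvgM => //.
have H : (theta s * su2_exp i (c s))%g @[s --> (0 : R)^'] --> g.
  have e : (g * 1 = g)%g by rewrite mulg1.
  rewrite -[X in _ --> X]e; apply: mulg_cvg => //; exact: su2_exp_cvg.
exact: (cvg_comp _ _ H (cdf g)).
Unshelve. all: by end_near. Qed.

(** The increment telescopes over the three factors. [dR_path] treats each of them along a base path
    tending to g, and the two outer factors give the coefficient 2. *)
Lemma dR_palindrome i k f (g : SU2) (p r : R -> R) (p' r' : R) :
  (forall j, drv j f) -> (forall j, continuous (dR j f)) ->
  p 0 = 0 -> r 0 = 0 ->
  is_derive (0 : R) (1 : R) p p' -> is_derive (0 : R) (1 : R) r r' ->
  is_derive (0 : R) (1 : R)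
    (fun s => f (g * (su2_exp i (p s) * su2_exp k (r s) * su2_exp i (p s)))%g)
    (2 * p' * dR i f g + r' * dR k f g).
Proof.
move=> df cdf p0 r0 dp dr.
have c0 (q : R -> R) q' : q 0 = 0 -> is_derive (0 : R) (1 : R) q q' ->
    q s @[s --> (0 : R)^'] --> 0.
  move=> q0 dq.
  have : {for 0, continuous q}.
    by apply: differentiable_continuous; apply/derivable1_diffP; case: dq.
  by rewrite /prop_for /continuous_at q0 => /(cvg_within_filter _); exact.
have ep : su2_exp i (p s) @[s --> (0 : R)^'] --> (1 : SU2)%g.
  exact: su2_exp_cvg (c0 _ _ p0 dp).
have er : su2_exp k (r s) @[s --> (0 : R)^'] --> (1 : SU2)%g.
  exact: su2_exp_cvg (c0 _ _ r0 dr).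
have t1 : (fun=> g) s @[s --> (0 : R)^'] --> g by exact: cvg_cst.
have t2 : (g * su2_exp i (p s))%g @[s --> (0 : R)^'] --> g.
  have e : (g * 1 = g)%g by rewrite mulg1.
  rewrite -[X in _ --> X]e; exact: mulg_cvg.
have t3 : (g * su2_exp i (p s) * su2_exp k (r s))%g @[s --> (0 : R)^'] --> g.
  have e : (g * 1 = g)%g by rewrite mulg1.
  rewrite -[X in _ --> X]e; exact: mulg_cvg.
have D1 := dR_path (df i) (cdf i) t1 p0 dp.
have D2 := dR_path (df k) (cdf k) t2 r0 dr.
have D3 := dR_path (df i) (cdf i) t3 p0 dp.
apply/is_derive0P.
have -> : 2 * p' * dR i f g + r' * dR k f g =
  dR i f g * p' + dR k f g * r' + dR i f g * p' by ring.
apply: cvg_trans (cvgD (cvgD D1 D2) D3).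
apply: near_eq_cvg; near=> s => /=.
rewrite p0 r0 !su2_exp0 !mulg1 !mulgA !fctE; ring.
Unshelve. all: by end_near. Qed.

End LieDerivative.

(** * The commutation relations from the group law *)

Section Commutator.
Variable R : realType.
Local Notation SU2 := (SU2 R).

(* Rewriting e^(sX_i) e^(tX_j) as e^(tX_j) times a palindromic product, for which only
   first derivatives at the identity matter, replaces the adjoint action. *)
Lemma palindrome (i : 'I_3) (t s p r : R) :
  cos r * cos (2 * p) = cos s -> cos r * sin (2 * p) = cos (2 * t) * sin s ->
  sin r = sin (2 * t) * sin s ->
  (su2_exp i s * su2_exp (i + 1) t)%g =
  (su2_exp (i + 1) t * (su2_exp i p * su2_exp (i + 2) r * su2_exp i p))%g :> SU2.
Proof.
move=> h1 h2 h3.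
have e2 (x : R) : 2 * x = x + x by ring.
have c2 : cos (2 * t) = cos t ^+ 2 - sin t ^+ 2 by rewrite e2 cosD; ring.
have s2 : sin (2 * t) = 2 * sin t * cos t by rewrite e2 sinD; ring.
have cs := cos2Dsin2 t; have csp := cos2Dsin2 p.
have k1 : cos r * (cos p * cos p - sin p * sin p) = cos s by rewrite -h1 e2 cosD.
have k2 : cos r * (cos p * sin p + sin p * cos p) = (cos t ^+ 2 - sin t ^+ 2) * sin s.
  by rewrite -c2 -h2 e2 sinD; congr (_ * _); ring.
have k3 : sin r = 2 * sin t * cos t * sin s by rewrite -s2.
(* Moving X_(i+2) past a factor exp(p X_i) inverts that factor, so the palindrome has no X_(i+1)
   component. It equals cos s + sin s (cos 2t X_i + sin 2t X_(i+2)), the conjugate of exp(s X_i) by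
   exp(t X_(i+1)). *)
have M : [/\ q0 (su2_exp i p * su2_exp (i + 2) r * su2_exp i p)%g = cos s,
  q1 (su2_exp i p * su2_exp (i + 2) r * su2_exp i p)%g =
    (qdelta R i 0 * (cos t ^+ 2 - sin t ^+ 2) + qdelta R (i + 2) 0 * (2 * sin t * cos t)) * sin s,
  q2 (su2_exp i p * su2_exp (i + 2) r * su2_exp i p)%g =
    (qdelta R i 1 * (cos t ^+ 2 - sin t ^+ 2) + qdelta R (i + 2) 1 * (2 * sin t * cos t)) * sin s
  & q3 (su2_exp i p * su2_exp (i + 2) r * su2_exp i p)%g =
    (qdelta R i 2 * (cos t ^+ 2 - sin t ^+ 2) + qdelta R (i + 2) 2 * (2 * sin t * cos t)) * sin s].
  have G x y : (x * (cos t ^+ 2 - sin t ^+ 2) + y * (2 * sin t * cos t)) * sin s =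
      x * (cos r * (cos p * sin p + sin p * cos p)) + y * (sin r * (cos p ^+ 2 + sin p ^+ 2)).
    by rewrite k2 k3 csp; ring.
  rewrite !G -k1 {G}.
  by case: i => [[|[|[|//]]] ?]; split; rewrite !qM !qE /qdelta /=; ring.
have [M0 M1 M2 M3] := M.
have w x : x = x * (cos t ^+ 2 + sin t ^+ 2) by rewrite cs mulr1.
case: i {k1 k2 k3 h1 h2 h3 M} M0 M1 M2 M3 => [[|[|[|//]]] ?] M0 M1 M2 M3;
  apply: SU2_eqP; rewrite ![LHS]qM ![RHS]qM.
all: rewrite ?M0 ?M1 ?M2 ?M3. all: rewrite !qE /qdelta /=.
all: rewrite [in LHS](w (sin s)); ring.
Qed.

End Commutator.

Section Commutator2.
Variable R : realType.
Local Notation SU2 := (SU2 R).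

(* explicit solutions p = ang, r = tlt of the hypotheses of [palindrome] *)
Let ang (x s : R) := atan (x * tan s) / 2.
Let tlt (z s : R) := asin (z * sin s).

Lemma is_derive_ang x : is_derive (0 : R) (1 : R) (ang x) (x / 2).
Proof.
have h1 : is_derive (0 : R) (1 : R) tan (cos (0 : R) ^- 2).
  by apply: is_derive_tan; rewrite cos0 oner_neq0.
have h2 : is_derive (0 : R) (1 : R) (fun s => x * tan s) x.
  have := is_deriveZ x h1; rewrite cos0 expr1n invr1.
  by rewrite [x *: 1]mulr1.
have h3 : is_derive (x * tan 0) (1 : R) (@atan R) (1 + (x * tan 0) ^+ 2)^-1 by exact: is_derive1_atan.
have h4 : is_derive (0 : R) (1 : R) ((@atan R) \o (fun s => x * tan s)) x.
  have := @is_derive1_comp R atan (fun s => x * tan s) 0 _ _ h3 h2; rewrite tan0 mulr0 expr0n addr0 invr1 mul1r; exact.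
have := is_deriveZ (2^-1 : R) h4.
rewrite [_ *: x]mulrC; congr is_derive.
by apply/funext => s; rewrite /ang fctE /= [_ *: _]mulrC.
Qed.

Lemma is_derive_tlt z : is_derive (0 : R) (1 : R) (tlt z) z.
Proof.
have h1 : is_derive (0 : R) (1 : R) (@sin R) (cos 0) by exact: is_derive_sin.
have h2 : is_derive (0 : R) (1 : R) (fun s => z * sin s) z.
  by have := is_deriveZ z h1; rewrite cos0 [z *: 1]mulr1.
have h3 : is_derive (z * sin 0) (1 : R) (@asin R) (Num.sqrt (1 - (z * sin 0) ^+ 2))^-1.
  by apply: is_derive1_asin; rewrite sin0 mulr0 oppr_lt0 ltr01.
have := @is_derive1_comp R asin (fun s => z * sin s) 0 _ _ h3 h2.
by rewrite sin0 mulr0 expr0n subr0 sqrtr1 invr1 mul1r.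
Qed.

(** The quotient of the first two equations is tan 2p = x tan s. Positivity of cos s makes it agree
    with the nonnegative square root that expresses the cosine of the arcsine. *)
Lemma ang_tlt (x z s : R) : x ^+ 2 + z ^+ 2 = 1 -> 0 < cos s ->
  [/\ cos (tlt z s) * cos (2 * ang x s) = cos s,
      cos (tlt z s) * sin (2 * ang x s) = x * sin s & sin (tlt z s) = z * sin s].
Proof.
move=> xz c0.
have z1 : z ^+ 2 <= 1 by rewrite -xz lerDr sqr_ge0.
have s1 : sin s ^+ 2 <= 1 by rewrite -(cos2Dsin2 s) lerDr sqr_ge0.
have zs : (z * sin s) ^+ 2 <= 1 by rewrite exprMn mulr_ile1 ?sqr_ge0.
have zb : -1 <= z * sin s <= 1.
  by rewrite -ler_norml -(@expr_le1 _ 2) ?normr_ge0 // real_normK ?num_real.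
have e2 : 2 * ang x s = atan (x * tan s).
  by rewrite /ang mulrC divfK.
set y := x * tan s in e2 *.
have y0 : 0 < 1 + y ^+ 2 by rewrite ltr_wpDr ?sqr_ge0.
have q0 : 0 < Num.sqrt (1 + y ^+ 2) by rewrite sqrtr_gt0.
have cr : cos (tlt z s) = cos s * Num.sqrt (1 + y ^+ 2).
  rewrite /tlt cos_asin // -[cos s]gtr0_norm // -sqrtr_sqr -sqrtrM ?sqr_ge0 //.
  congr Num.sqrt; rewrite /y /tan.
  have -> : cos s ^+ 2 * (1 + (x * (sin s / cos s)) ^+ 2) = cos s ^+ 2 + x ^+ 2 * sin s ^+ 2.
    by field; rewrite gt_eqF.
  have -> : x ^+ 2 = 1 - z ^+ 2 by rewrite -xz; ring.
  have -> : cos s ^+ 2 = 1 - sin s ^+ 2 by rewrite -(cos2Dsin2 s) addrK.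
  by ring.
have ca : cos (2 * ang x s) = (Num.sqrt (1 + y ^+ 2))^-1 by rewrite e2 cos_atan.
have sa : sin (2 * ang x s) = y * (Num.sqrt (1 + y ^+ 2))^-1.
  have ne : cos (atan y) != 0 by rewrite cos_atan invr_eq0 gt_eqF.
  by rewrite e2 -{1}[y in RHS](atanK y) /tan -cos_atan divfK.
have nz : Num.sqrt (1 + y ^+ 2) != 0 by rewrite gt_eqF.
split.
- by rewrite cr ca mulfK.
- rewrite cr sa mulrACA [X in _ * X]mulfV // mulr1 /y /tan; field; rewrite gt_eqF //.
- by rewrite /tlt asinK // in_itv.
Qed.

(** Transporting X_i past exp(t X_(i+1)) rotates it by the angle 2t towards X_(i+2). *)
Lemma dR_flow2 i (f : SU2 -> R) (g : SU2) (s t : R) :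
  (forall j, drv j f) -> (forall j, continuous (dR j f)) ->
  is_derive (s : R) (1 : R) (fun x => f (g * su2_exp i x * su2_exp (i + 1) t)%g)
   (cos (2 * t) * dR i f (g * su2_exp i s * su2_exp (i + 1) t)%g +
    sin (2 * t) * dR (i + 2) f (g * su2_exp i s * su2_exp (i + 1) t)%g).
Proof.
move=> df cdf; set h := (g * su2_exp i s * su2_exp (i + 1) t)%g.
set d : R := (X in is_derive _ _ _ X).
pose F x := f (g * su2_exp i (s + x) * su2_exp (i + 1) t)%g.
have xz : cos (2 * t) ^+ 2 + sin (2 * t) ^+ 2 = 1 by rewrite cos2Dsin2.
have a0 : ang (cos (2 * t)) 0 = 0 by rewrite /ang tan0 mulr0 atan0 mul0r.
have t0 : tlt (sin (2 * t)) 0 = 0.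
  rewrite /tlt sin0 mulr0 -{1}(@sin0 R) sinK // in_itv /= oppr_le0.
  by rewrite divr_ge0 ?pi_ge0.
have D : is_derive (0 : R) (1 : R) F d.
  have := @dR_palindrome R i (i + 2) f h _ _ _ _ df cdf a0 t0 (is_derive_ang _) (is_derive_tlt _).
  rewrite [2 * (_ / _)]mulrC divfK // -/d => /is_derive0P H.
  apply/is_derive0P; apply: cvg_trans H; apply: near_eq_cvg.
  apply: (@cvg_within _ (nbhs (0 : R))).
  have c0 : \forall x \near (0 : R), 0 < cos x.
    have := @continuous_cos R 0; rewrite /continuous_at cos0 => H.
    exact: (cvgr_gt _ H _ ltr01).
  near=> x; have cx : 0 < cos x by near: x.
  have [p1 p2 p3] := ang_tlt xz cx.
  rewrite /F a0 t0 !su2_exp0 !mulg1 addr0; congr (_ * (f _ - _)).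
  by rewrite /h -[LHS]mulgA -(palindrome _ p1 p2 p3) su2_expD !mulgA.
have -> : (fun x => f (g * su2_exp i x * su2_exp (i + 1) t)%g) = F \o (fun x => x - s).
  by apply/funext => x; rewrite /F /= [s + _]addrC subrK.
have H1 : is_derive (s : R) (1 : R) (fun x : R => x - s) 1.
  have := is_deriveB (is_derive_id s (1 : R)) (is_derive_cst s s (1 : R)).
  by rewrite subr0.
rewrite -[d]mulr1; apply: is_derive1_comp => /=; by rewrite subrr.
Unshelve. all: by end_near. Qed.

End Commutator2.

(** * Real functions with continuous iterated derivatives *)

Section SmoothReal.
Variable R : realType.
Local Notation SU2 := (SU2 R).

Lemma CnR_cont n (f : SU2 -> R) : CnR n f -> continuous f.
Proof. by case: n => [|n] []. Qed.
Arguments CnR_cont [n f] _ _.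

Lemma CnR_drv n (f : SU2 -> R) i : CnR n.+1 f -> drv i f.
Proof. by case=> _ /(_ i)[]. Qed.
Arguments CnR_drv [n f] i _ _.

Lemma CnR_dR n (f : SU2 -> R) i : CnR n.+1 f -> CnR n (dR i f).
Proof. by case=> _ /(_ i)[]. Qed.
Arguments CnR_dR [n f] i _.

Lemma CnRW n (f : SU2 -> R) : CnR n.+1 f -> CnR n f.
Proof.
elim: n f => [|n IH] f [cf df]; split => // i.
by have [d1 d2] := df i; split => //; exact: IH.
Qed.

Lemma dR_cst i (c : R) : drv i (fun _ : SU2 => c) /\ dR i (fun _ : SU2 => c) = (fun=> 0).
Proof.
have H g : is_derive (0 : R) (1 : R) (orbit_map (fun=> c) i g) 0 by exact: is_derive_cst.
by split=> [g|]; [case: (H g)|apply/funext => g; exact: dR_unique].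
Qed.

Lemma dR_add i (f h : SU2 -> R) : drv i f -> drv i h ->
  drv i (fun g => f g + h g) /\ dR i (fun g => f g + h g) = (fun g => dR i f g + dR i h g).
Proof.
move=> df dh.
have H g : is_derive (0 : R) (1 : R) (orbit_map (fun g => f g + h g) i g) (dR i f g + dR i h g).
  exact: (is_deriveD (dRP df g) (dRP dh g)).
by split=> [g|]; [case: (H g)|apply/funext => g; exact: dR_unique].
Qed.

Lemma dR_mul i (f h : SU2 -> R) : drv i f -> drv i h ->
  drv i (fun g => f g * h g) /\
  dR i (fun g => f g * h g) = (fun g => dR i f g * h g + f g * dR i h g).
Proof.
move=> df dh.
have H g : is_derive (0 : R) (1 : R) (orbit_map (fun g => f g * h g) i g)
    (dR i f g * h g + f g * dR i h g).
  have := is_deriveM (dRP df g) (dRP dh g).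
  rewrite /orbit_map su2_exp0 mulg1 => K.
  have -> : dR i f g * h g + f g * dR i h g = f g *: dR i h g + h g *: dR i f g.
    by rewrite /GRing.scale /=; ring.
  exact: K.
by split=> [g|]; [case: (H g)|apply/funext => g; exact: dR_unique].
Qed.

Lemma CnR_cst n (c : R) : CnR n (fun _ : SU2 => c).
Proof.
have ct (c' : R) : continuous (fun _ : SU2 => c').
  by move=> g; exact: (@cvg_cst _ c' _ (nbhs g)).
elim: n c => [|n IH] c; first by split.
by split=> // i; have [d ->] := dR_cst i c; split.
Qed.

Lemma CnR_add n (f h : SU2 -> R) : CnR n f -> CnR n h -> CnR n (fun g => f g + h g).
Proof.
elim: n f h => [|n IH] f h Hf Hh.
  by split=> // g; exact: (cvgD (CnR_cont Hf g) (CnR_cont Hh g)).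
split=> [g|i]; first exact: (cvgD (CnR_cont Hf g) (CnR_cont Hh g)).
have [d ->] := dR_add (CnR_drv i Hf) (CnR_drv i Hh).
by split=> //; apply: IH; exact: CnR_dR.
Qed.

Lemma CnR_mul n (f h : SU2 -> R) : CnR n f -> CnR n h -> CnR n (fun g => f g * h g).
Proof.
elim: n f h => [|n IH] f h Hf Hh.
  by split=> // g; exact: (cvgM (CnR_cont Hf g) (CnR_cont Hh g)).
split=> [g|i]; first exact: (cvgM (CnR_cont Hf g) (CnR_cont Hh g)).
have [d ->] := dR_mul (CnR_drv i Hf) (CnR_drv i Hh).
split=> //; apply: CnR_add; apply: IH; try exact: CnR_dR; exact: CnRW.
Qed.

Lemma dR_trig i (f : SU2 -> R) (b : SU2 -> R) :
  (forall g t, f (g * su2_exp i t)%g = f g * cos t + b g * sin t) ->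
  drv i f /\ dR i f = b.
Proof.
move=> E.
have H g : is_derive (0 : R) (1 : R) (orbit_map f i g) (b g).
  have h1 := is_deriveZ (f g) (is_derive_cos (0 : R)).
  have h2 := is_deriveZ (b g) (is_derive_sin (0 : R)).
  have := is_deriveD h1 h2.
  rewrite sin0 cos0 oppr0 scaler0 add0r [_ *: 1]mulr1.
  by congr is_derive; apply/funext => t; rewrite /orbit_map E.
by split=> [g|]; [case: (H g)|apply/funext => g; exact: dR_unique].
Qed.

Lemma dR_q i :
  [/\ drv i (@q0 R) /\ dR i (@q0 R) = (fun g => - (qdelta R i 0 * q1 g + qdelta R i 1 * q2 g + qdelta R i 2 * q3 g)),
   drv i (@q1 R) /\ dR i (@q1 R) = (fun g => qdelta R i 0 * q0 g + qdelta R i 2 * q2 g - qdelta R i 1 * q3 g),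
   drv i (@q2 R) /\ dR i (@q2 R) = (fun g => qdelta R i 1 * q0 g - qdelta R i 2 * q1 g + qdelta R i 0 * q3 g)
  & drv i (@q3 R) /\ dR i (@q3 R) = (fun g => qdelta R i 2 * q0 g + qdelta R i 1 * q1 g - qdelta R i 0 * q2 g)].
Proof. by split; apply: dR_trig => g t; rewrite qM !qE; ring. Qed.

(** Derivatives permute the coordinates up to sign, so the induction on n runs over all linear
    combinations at once. *)
Lemma CnR_lin n (a b c d : R) :
  CnR n (fun g => a * q0 g + b * q1 g + c * q2 g + d * q3 g).
Proof.
have [c0 c1 c2 c3] := q_continuous R.
have ct (a' b' c' d' : R) : continuous (fun g => a' * q0 g + b' * q1 g + c' * q2 g + d' * q3 g).
  suff : CnR 0 (fun g => a' * q0 g + b' * q1 g + c' * q2 g + d' * q3 g) by case.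
  have C x (q : SU2 -> R) : continuous q -> CnR 0 (fun g => x * q g).
    by move=> cq; apply: CnR_mul; [exact: CnR_cst|split].
  exact: (CnR_add (CnR_add (CnR_add (C _ _ c0) (C _ _ c1)) (C _ _ c2)) (C _ _ c3)).
elim: n a b c d => [|n IH] a b c d; first by split.
split=> // i.
have [[d0 e0] [d1 e1] [d2 e2] [d3 e3]] := dR_q i.
have sc x f : drv i f -> drv i (fun g => x * f g) /\ dR i (fun g : SU2 => x * f g) = fun g => x * dR i f g.
  move=> df; have [dc ec] := dR_cst i x; have [dm em] := dR_mul dc df.
  by split=> //; rewrite em ec; apply/funext => g; rewrite mul0r add0r.
have [m0 n0] := sc a _ d0; have [m1 n1] := sc b _ d1.
have [m2 n2] := sc c _ d2; have [m3 n3] := sc d _ d3.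
have [s1 f1] := dR_add m0 m1; have [s2 f2] := dR_add s1 m2; have [s3 f3] := dR_add s2 m3.
split=> //; rewrite f3 f2 f1 n0 n1 n2 n3 e0 e1 e2 e3.
set D := qdelta R i.
rewrite (_ : (fun g => _) = (fun g =>
  (b * D 0%N + c * D 1%N + d * D 2%N) * q0 g + (- a * D 0%N - c * D 2%N + d * D 1%N) * q1 g +
  (- a * D 1%N + b * D 2%N - d * D 0%N) * q2 g + (- a * D 2%N - b * D 1%N + c * D 0%N) * q3 g)).
  exact: IH.
by apply/funext => g; ring.
Qed.

(** Both mixed derivatives of f(g e^(s X_i) e^(t X_(i+1))) are taken at the origin. Differentiating
    the factor sin 2t of [dR_flow2] produces the bracket term 2 X_(i+2). *)
Lemma dR_comm i (f : SU2 -> R) (g : SU2) : CnR 2 f ->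
  dR i (dR (i + 1) f) g = dR (i + 1) (dR i f) g + 2 * dR (i + 2) f g.
Proof.
move=> Cf; set j := i + 1; set k := i + 2.
have df l : drv l f by exact: CnR_drv Cf.
have cdf l : continuous (dR l f) by exact: CnR_cont (CnR_dR l Cf).
have ddf l m : drv m (dR l f) by exact: CnR_drv (CnR_dR l Cf).
have cddf l m : continuous (dR m (dR l f)) by exact: CnR_cont (CnR_dR m (CnR_dR l Cf)).
pose pt s t : SU2 := (g * su2_exp i s * su2_exp j t)%g.
have f1 : fst x @[x --> (0 : R, 0 : R)] --> (0 : R).
  exact: (@cvg_fst R R (nbhs (0 : R)) (nbhs (0 : R))).
have f2 : snd x @[x --> (0 : R, 0 : R)] --> (0 : R).
  exact: (@cvg_snd R R (nbhs (0 : R)) (nbhs (0 : R))).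
have cpt : (pt x.1 x.2) @[x --> (0 : R, 0 : R)] --> g.
  have e : (g * su2_exp i (0 : R) * su2_exp j (0 : R))%g = g by rewrite !su2_exp0 !mulg1.
  rewrite -[X in _ --> X]e; apply: mulg_cvg; first apply: mulg_cvg.
  - exact: cvg_cst.
  - exact: (cvg_comp _ _ f1 (@su2_exp_continuous R i 0)).
  - exact: (cvg_comp _ _ f2 (@su2_exp_continuous R j 0)).
have cF (F : SU2 -> R) : continuous F -> F (pt x.1 x.2) @[x --> (0 : R, 0 : R)] --> F g.
  move=> cF; exact: (cvg_comp _ _ cpt (cF g)).
have m2 : 2 * x.2 @[x --> (0 : R, 0 : R)] --> (2 * 0 : R).
  by apply: cvgM => //; exact: cvg_cst.
have c2 : cos (2 * x.2) @[x --> (0 : R, 0 : R)] --> cos (2 * 0 : R).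
  exact: (cvg_comp _ _ m2 (@continuous_cos R _)).
have s2 : sin (2 * x.2) @[x --> (0 : R, 0 : R)] --> sin (2 * 0 : R).
  exact: (cvg_comp _ _ m2 (@continuous_sin R _)).
have pt0 : pt 0 0 = g by rewrite /pt !su2_exp0 !mulg1.
have dm (t : R) : is_derive t (1 : R) (fun x => 2 * x) 2.
  by have := is_deriveZ (2 : R) (is_derive_id t (1 : R)); rewrite [2 *: 1]mulr1.
have dcos (t : R) : is_derive t (1 : R) (fun x => cos (2 * x)) (- sin (2 * t) * 2).
  exact: (@is_derive1_comp R cos (fun x => 2 * x) t _ _ (is_derive_cos _) (dm t)).
have dsin (t : R) : is_derive t (1 : R) (fun x => sin (2 * x)) (cos (2 * t) * 2).
  exact: (@is_derive1_comp R sin (fun x => 2 * x) t _ _ (is_derive_sin _) (dm t)).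
pose us s t := cos (2 * t) * dR i f (pt s t) + sin (2 * t) * dR k f (pt s t).
pose ust s t := cos (2 * t) * dR i (dR j f) (pt s t) + sin (2 * t) * dR k (dR j f) (pt s t).
pose uts s t := - sin (2 * t) * 2 * dR i f (pt s t) + cos (2 * t) * dR j (dR i f) (pt s t) +
     (cos (2 * t) * 2 * dR k f (pt s t) + sin (2 * t) * dR j (dR k f) (pt s t)).
have H1 s t : is_derive (s : R) (1 : R) (fun x => f (pt x t)) (us s t).
  exact: (@dR_flow2 R i f g s t df cdf).
have H2 s t : is_derive (t : R) (1 : R) (fun y => f (pt s y)) (dR j f (pt s t)).
  exact: (dR_flow (df j)).
have H3 s t : is_derive (s : R) (1 : R) (fun x => dR j f (pt x t)) (ust s t).
  exact: (@dR_flow2 R i (dR j f) g s t (ddf j) (cddf j)).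
have H4 s t : is_derive (t : R) (1 : R) (us s) (uts s t).
  have H l : is_derive (t : R) (1 : R) (fun y => dR l f (pt s y)) (dR j (dR l f) (pt s t)).
    exact: (dR_flow (ddf l j)).
  have K := is_deriveD (is_deriveM (dcos t) (H i)) (is_deriveM (dsin t) (H k)).
  apply: (is_derive_eq K); rewrite /uts.
  by congr (_ + _); rewrite addrC; congr (_ + _); exact: mulrC.
have c5 : {for (0, 0), continuous (fun x : R * R => ust x.1 x.2)}.
  rewrite /prop_for /continuous_at /= /ust pt0.
  by apply: cvgD; apply: cvgM => //; exact: cF.
have c6 : {for (0, 0), continuous (fun x : R * R => uts x.1 x.2)}.
  rewrite /prop_for /continuous_at /= /uts pt0.
  apply: cvgD; apply: cvgD; apply: cvgM => //; try exact: cF.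
  + by apply: cvgM; [exact: cvgN|exact: cvg_cst].
  + by apply: cvgM; [|exact: cvg_cst].
have := mixed_partials H1 H2 H3 H4 c5 c6.
rewrite /ust /uts pt0.
move: (dR i (dR j f) g) (dR k (dR j f) g) (dR i f g) (dR j (dR i f) g) (dR k f g)
  (dR j (dR k f) g) => a1 a2 a3 a4 a5 a6.
by rewrite mulr0 cos0 sin0 !(oppr0, mul0r, mul1r, addr0, add0r).
Qed.

End SmoothReal.
Arguments CnR_cont {R n f} _ _.
Arguments CnR_drv {R n f} i _ _.
Arguments CnR_dR {R n f} i _.

(** * Euler angles and compactness of SU(2) *)

Section Compactness.
Variable R : realType.
Local Notation SU2 := (SU2 R).

Lemma circle_angle (x y : R) : x ^+ 2 + y ^+ 2 = 1 ->
  exists2 t : R, - pi <= t <= pi & x = cos t /\ y = sin t.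
Proof.
move=> xy.
have xb : -1 <= x <= 1.
  have x1 : x ^+ 2 <= 1 by rewrite -xy lerDl sqr_ge0.
  by rewrite -ler_norml -(@expr_le1 _ 2) ?normr_ge0 // real_normK ?num_real.
have sE : Num.sqrt (1 - x ^+ 2) = `|y| by rewrite -xy addrC addKr sqrtr_sqr.
have a0 := acos_ge0 xb; have api := acos_lepi xb; have pi0 := pi_ge0 R.
have [y0|/ltW y0] := leP 0 y.
  exists (acos x); first by rewrite api andbT (le_trans _ a0) ?oppr_le0.
  by rewrite acosK ?in_itv //= sin_acos // sE ger0_norm.
exists (- acos x); first by rewrite lerN2 api /= (le_trans _ pi0) ?oppr_le0.
by rewrite cosN sinN acosK ?in_itv //= sin_acos // sE ler0_norm // opprK.
Qed.

Lemma scaled_angle (x y r : R) : x ^+ 2 + y ^+ 2 = r ^+ 2 ->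
  exists2 t : R, - pi <= t <= pi & x = r * cos t /\ y = r * sin t.
Proof.
have [->|r0] := eqVneq r 0.
  rewrite expr0n => /eqP; rewrite paddr_eq0 ?sqr_ge0 // !sqrf_eq0 => /andP[/eqP -> /eqP ->].
  by exists 0; rewrite ?oppr_le0 ?pi_ge0 // !mul0r.
move=> xy; have [|t tb [hx hy]] := @circle_angle (x / r) (y / r).
  by rewrite !expr_div_n -mulrDl xy divff // expf_neq0.
by exists t => //; rewrite -hx -hy ![r * _]mulrC !divfK.
Qed.

Let I0 : 'I_3 := 0.
Let I1 : 'I_3 := 1.

Definition euler (x : R * (R * R)) : SU2 :=
  (su2_exp I0 x.1 * su2_exp I1 x.2.1 * su2_exp I0 x.2.2)%g.

Lemma eulerP (g : SU2) : exists a b c : R,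
  [/\ - pi <= a <= pi, - pi <= b <= pi, - pi <= c <= pi & g = euler (a, (b, c))].
Proof.
have N := SU2_norm g.
pose r := Num.sqrt (q0 g ^+ 2 + q1 g ^+ 2); pose s := Num.sqrt (q2 g ^+ 2 + q3 g ^+ 2).
have r2 : q0 g ^+ 2 + q1 g ^+ 2 = r ^+ 2 by rewrite sqr_sqrtr // addr_ge0 ?sqr_ge0.
have s2 : q2 g ^+ 2 + q3 g ^+ 2 = s ^+ 2 by rewrite sqr_sqrtr // addr_ge0 ?sqr_ge0.
have [|b bb [rb sb]] := @circle_angle r s; first by rewrite -r2 -s2 addrA.
have [A /andP[A1 A2] [a0 a1]] := scaled_angle r2.
have [B /andP[B1 B2] [b0 b1]] := scaled_angle s2.
(* The polar angles A of (q0, q1) and B of (q2, q3) are the sum and the difference of the outer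
   Euler angles; the radii are cos b and sin b. *)
exists ((A + B) / 2), b, ((A - B) / 2); split=> //; try (by apply/andP; split; lra).
have eA : A = (A + B) / 2 + (A - B) / 2 by field.
have eB : B = (A + B) / 2 - (A - B) / 2 by field.
have cb := cos2Dsin2 b.
rewrite eA rb cosD sinD in a0 a1; rewrite eB sb cosB sinB in b0 b1.
by apply: SU2_eqP; rewrite ?a0 ?a1 ?b0 ?b1 /euler !qM !qE /qdelta /=; ring.
Qed.

Lemma euler_continuous : continuous euler.
Proof.
move=> [a [b c]].
have f1 : x.1 @[x --> (a, (b, c))] --> a by exact: (@cvg_fst _ _ (nbhs a) (nbhs (b, c))).
have f2 : x.2 @[x --> (a, (b, c))] --> (b, c) by exact: (@cvg_snd _ _ (nbhs a) (nbhs (b, c))).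
have f3 : y.1 @[y --> (b, c)] --> b by exact: (@cvg_fst _ _ (nbhs b) (nbhs c)).
have f4 : y.2 @[y --> (b, c)] --> c by exact: (@cvg_snd _ _ (nbhs b) (nbhs c)).
have h3 := cvg_comp _ _ f2 f3; have h4 := cvg_comp _ _ f2 f4.
apply: mulg_cvg; first apply: mulg_cvg.
- exact: (cvg_comp _ _ f1 (@su2_exp_continuous R I0 a)).
- exact: (cvg_comp _ _ h3 (@su2_exp_continuous R I1 b)).
- exact: (cvg_comp _ _ h4 (@su2_exp_continuous R I0 c)).
Qed.

Lemma SU2_compact : compact [set: SU2].
Proof.
have -> : [set: SU2] = euler @` (`[- pi, pi] `*` (`[- pi, pi] `*` `[- pi, pi])).
  apply/seteqP; split=> // g _; have [a [b [c [ha hb hc ->]]]] := eulerP g.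
  by exists (a, (b, c)) => //=; rewrite !in_itv.
apply: continuous_compact.
  by apply: continuous_subspaceT; exact: euler_continuous.
by apply: compact_setX; [|apply: compact_setX]; exact: segment_compact.
Qed.

Lemma SU2_max (f : SU2 -> R) : continuous f -> exists g0, forall g, f g <= f g0.
Proof.
move=> cf.
have [||g0 _ H] := @compact_EVT_max SU2 R f [set: SU2] _ SU2_compact.
- by exists 1%g.
- exact: continuous_subspaceT.
- by exists g0 => g; apply: H; rewrite inE.
Qed.

Lemma dR_eq0_const (f : SU2 -> R) : (forall i, drv i f) -> (forall i g, dR i f g = 0) ->
  forall g, f g = f 1%g.
Proof.
move=> df f0.
have inv g i t : f (g * su2_exp i t)%g = f g.
  have [c _] := dR_MVT (df i) g t.
  by rewrite f0 mul0r => /eqP; rewrite subr_eq0 => /eqP.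
by move=> g; have [a [b [c [_ _ _ ->]]]] := eulerP g; rewrite /euler !inv -[su2_exp _ _]mul1g inv.
Qed.

Lemma dR_dR_max (f : SU2 -> R) g0 i : CnR 2 f -> (forall g, f g <= f g0) ->
  dR i (dR i f) g0 <= 0.
Proof.
move=> Cf mx.
apply: (@second_derivative_max R (orbit_map f i g0) (orbit_map (dR i f) i g0)).
- by move=> t; apply: dR_flow; exact: CnR_drv Cf.
- by apply: dRP; exact: CnR_drv (CnR_dR i Cf).
- by move=> t; rewrite /orbit_map su2_exp0 mulg1.
Qed.

End Compactness.

(** * The ring of smooth functions *)

Section SmoothFunctions.
Variable R : realType.
Local Notation SU2 := (SU2 R).
Local Notation C := R[i].

Definition smoothC (f : SU2 -> C) : Prop :=
  forall n, CnR n (fun g => complex.Re (f g)) /\ CnR n (fun g => complex.Im (f g)).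

Definition smooth_pred : {pred SU2 -> C} := [pred f | `[< smoothC f >]].

Lemma smoothC_cst (c : C) : smoothC (fun=> c).
Proof. by move=> n; split; exact: CnR_cst. Qed.

Lemma CnR_opp n (f : SU2 -> R) : CnR n f -> CnR n (fun g => - f g).
Proof.
move=> Hf; have := CnR_mul (CnR_cst n (-1)) Hf.
by congr CnR; apply/funext => g; rewrite mulN1r.
Qed.

Lemma smoothC_sub (f h : SU2 -> C) : smoothC f -> smoothC h -> smoothC (f - h).
Proof.
move=> Hf Hh n; have [f1 f2] := Hf n; have [h1 h2] := Hh n.
split; [have := CnR_add f1 (CnR_opp h1)|have := CnR_add f2 (CnR_opp h2)];
  by congr CnR; apply/funext => g; rewrite [(f - h) g]/(f g - h g); case: (f g) (h g) => [? ?] [? ?].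
Qed.

Lemma smoothC_mul (f h : SU2 -> C) : smoothC f -> smoothC h -> smoothC (f * h).
Proof.
move=> Hf Hh n; have [f1 f2] := Hf n; have [h1 h2] := Hh n.
split; [have := CnR_add (CnR_mul f1 h1) (CnR_opp (CnR_mul f2 h2))|
        have := CnR_add (CnR_mul f1 h2) (CnR_mul f2 h1)];
  congr CnR; apply/funext => g; rewrite [(f * h) g]/(f g * h g);
  case: (f g) (h g) => [? ?] [? ?] //=.
Qed.

Fact smooth_subring_closed : subring_closed smooth_pred.
Proof.
split; first by apply/asboolP; exact: (smoothC_cst 1).
- by move=> f h /asboolP Hf /asboolP Hh; apply/asboolP; exact: smoothC_sub.
- by move=> f h /asboolP Hf /asboolP Hh; apply/asboolP; exact: smoothC_mul.
Qed.

HB.instance Definition _ := GRing.isSubringClosed.Build (SU2 -> C) smooth_pred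
  smooth_subring_closed.

(** Bundling the smooth functions as a commutative ring makes [ring] available and lets the abstract
    sl_2 computations be instantiated. *)
Record smoothfun := MkSfun { sfval : SU2 -> C ; _ : sfval \in smooth_pred }.

HB.instance Definition _ := [isSub for sfval].
HB.instance Definition _ := [Choice of smoothfun by <:].
HB.instance Definition _ := GRing.SubChoice_isSubComPzRing.Build (SU2 -> C) smooth_pred smoothfun smooth_subring_closed.

Lemma sfunP (f : smoothfun) : smoothC (sfval f).
Proof. by case: f => f Hf; apply/asboolP; exact: Hf. Qed.

Definition mksf (f : SU2 -> C) (H : smoothC f) : smoothfun := MkSfun (asboolT H : f \in smooth_pred).

Lemma sfun_ext (f h : smoothfun) : sfval f =1 sfval h -> f = h.
Proof. by move=> E; apply: val_inj; apply/funext. Qed.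

Lemma svalD f h g : sfval (f + h) g = sfval f g + sfval h g.
Proof. by []. Qed.
Lemma svalM f h g : sfval (f * h) g = sfval f g * sfval h g.
Proof. by []. Qed.
Lemma svalN f g : sfval (- f) g = - sfval f g.
Proof. by []. Qed.
Lemma sval0 g : sfval 0 g = 0.
Proof. by []. Qed.

Definition sev (g : SU2) (f : smoothfun) : C := sfval f g.

Fact sev_zmod g : zmod_morphism (sev g). Proof. by []. Qed.
Fact sev_mon g : monoid_morphism (sev g). Proof. by []. Qed.
HB.instance Definition _ g := GRing.isZmodMorphism.Build smoothfun C (sev g) (sev_zmod g).
HB.instance Definition _ g := GRing.isMonoidMorphism.Build smoothfun C (sev g) (sev_mon g).

Definition scst (c : C) : smoothfun := mksf (@smoothC_cst c).
Fact scst_zmod : zmod_morphism scst.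
Proof. by move=> a b; apply: sfun_ext. Qed.
Fact scst_mon : monoid_morphism scst.
Proof. by split=> [|a b]; apply: sfun_ext. Qed.
HB.instance Definition _ := GRing.isZmodMorphism.Build C smoothfun scst scst_zmod.
HB.instance Definition _ := GRing.isMonoidMorphism.Build C smoothfun scst scst_mon.

Definition XC (i : 'I_3) (f : SU2 -> C) (g : SU2) : C :=
  dR i (fun g => complex.Re (f g)) g +i* dR i (fun g => complex.Im (f g)) g.

Lemma XC_smooth i f : smoothC f -> smoothC (XC i f).
Proof. by move=> H n; have [h1 h2] := H n.+1; split; exact: CnR_dR. Qed.

Definition sX i (f : smoothfun) : smoothfun := mksf (XC_smooth i (sfunP f)).

Lemma sfun_drv (f : smoothfun) i : drv i (fun g => complex.Re (sfval f g)) /\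
  drv i (fun g => complex.Im (sfval f g)).
Proof. by have [h1 h2] := sfunP f 1%N; split; [exact: (CnR_drv i h1)|exact: (CnR_drv i h2)]. Qed.

Lemma dR_opp i (f : SU2 -> R) : drv i f ->
  drv i (fun g => - f g) /\ dR i (fun g => - f g) = (fun g => - dR i f g).
Proof.
move=> df; have [dc ec] := dR_cst i (-1 : R); have [dm em] := dR_mul dc df.
have E : (fun g => - f g) = (fun g => -1 * f g) by apply/funext => g; rewrite mulN1r.
by rewrite E em ec; split=> //; apply/funext => g; rewrite mul0r add0r mulN1r.
Qed.

Lemma sX_sub i : zmod_morphism (sX i).
Proof.
move=> f h; apply: sfun_ext => g.
have [f1 f2] := sfun_drv f i; have [h1 h2] := sfun_drv h i.
have [k1 e1] := dR_opp h1; have [k2 e2] := dR_opp h2.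
have [_ E1] := dR_add f1 k1; have [_ E2] := dR_add f2 k2.
rewrite [RHS]/(XC i (sfval f) g - XC i (sfval h) g) /= /XC.
transitivity (dR i (fun g => complex.Re (sfval f g) + - complex.Re (sfval h g)) g +i*
              dR i (fun g => complex.Im (sfval f g) + - complex.Im (sfval h g)) g).
  by congr (dR i _ g +i* dR i _ g); apply/funext => g';
    rewrite [(sfval f - sfval h) g']/(sfval f g' - sfval h g'); case: (sfval f g') (sfval h g') => [? ?] [? ?].
by rewrite E1 E2 e1 e2.
Qed.
HB.instance Definition _ i := GRing.isZmodMorphism.Build smoothfun smoothfun (sX i) (@sX_sub i).

Lemma sX_mul i f h : sX i (f * h) = sX i f * h + f * sX i h.
Proof.
apply: sfun_ext => g.
have [f1 f2] := sfun_drv f i; have [h1 h2] := sfun_drv h i.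
have [m11 e11] := dR_mul f1 h1; have [m22 e22] := dR_mul f2 h2.
have [m12 e12] := dR_mul f1 h2; have [m21 e21] := dR_mul f2 h1.
have [k1 e1] := dR_opp m22.
have [_ E1] := dR_add m11 k1; have [_ E2] := dR_add m12 m21.
rewrite svalD !svalM /= {1}/XC.
transitivity (dR i (fun g => complex.Re (sfval f g) * complex.Re (sfval h g) +
   - (complex.Im (sfval f g) * complex.Im (sfval h g))) g +i*
   dR i (fun g => complex.Re (sfval f g) * complex.Im (sfval h g) +
     complex.Im (sfval f g) * complex.Re (sfval h g)) g).
  by congr (dR i _ g +i* dR i _ g); apply/funext => g';
    rewrite [(sfval f * sfval h) g']/(sfval f g' * sfval h g');
    case: (sfval f g') (sfval h g') => [? ?] [? ?].
rewrite E1 E2 e1 e11 e22 e12 e21 /XC.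
case: (sfval f g) (sfval h g) => [a b] [c d] /=; simpc; congr (_ +i* _); ring.
Qed.

Lemma sX_cst i c : sX i (scst c) = 0.
Proof.
apply: sfun_ext => g; rewrite /= /XC.
by have [_ ->] := dR_cst i (complex.Re c); have [_ ->] := dR_cst i (complex.Im c).
Qed.

Lemma sX_comm i f : sX i (sX (i + 1) f) = sX (i + 1) (sX i f) + 2 * sX (i + 2) f.
Proof.
apply: sfun_ext => g; have [h1 h2] := sfunP f 2%N.
rewrite svalD svalM /= /XC /= (dR_comm _ _ h1) (dR_comm _ _ h2).
rewrite [(1 + 1) g]/(1 + 1 : C) mulrDl mul1r; simpc; congr (_ +i* _); ring.
Qed.

End SmoothFunctions.

(** * The maximum principle *)

Section MaximumPrinciple.
Variable R : realType.
Local Notation SU2 := (SU2 R).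
Local Notation C := R[i].
Local Notation smoothfun := (smoothfun R).

Lemma smoothC_conj (f : SU2 -> C) : smoothC f -> smoothC (fun g => (f g)^*).
Proof.
move=> H n; have [h1 h2] := H n; split; [have := h1|have := CnR_opp h2];
  by congr CnR; apply/funext => g; case: (f g).
Qed.

Definition sconj (f : smoothfun) : smoothfun := mksf (smoothC_conj (sfunP f)).

Lemma sX_conj i (f : smoothfun) : sX i (sconj f) = sconj (sX i f).
Proof.
apply: sfun_ext => g /=; rewrite /XC.
have [_ h2] := sfun_drv f i; have [_ e2] := dR_opp h2.
transitivity (dR i (fun g => complex.Re (sfval f g)) g +i* dR i (fun g => - complex.Im (sfval f g)) g).
  by congr (dR i _ g +i* dR i _ g); apply/funext => g'; case: (sfval f g').
by rewrite e2.
Qed.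

Definition lap (f : smoothfun) : smoothfun := sX 0 (sX 0 f) + sX 1 (sX 1 f) + sX 2 (sX 2 f).

Lemma I3_addE : (1 + 1 = 2 :> 'I_3) * (2 + 1 = 0 :> 'I_3) * (0 + 1 = 1 :> 'I_3) *
  (0 + 2 = 2 :> 'I_3) * (1 + 2 = 0 :> 'I_3) * (2 + 2 = 1 :> 'I_3).
Proof. by do !split; apply: val_inj. Qed.

Lemma sX_comm3 (f : smoothfun) :
  [/\ sX 0 (sX 1 f) = sX 1 (sX 0 f) + 2 * sX 2 f,
      sX 1 (sX 2 f) = sX 2 (sX 1 f) + 2 * sX 0 f
    & sX 2 (sX 0 f) = sX 0 (sX 2 f) + 2 * sX 1 f].
Proof.
by split; [have := sX_comm 0 f|have := sX_comm 1 f|have := sX_comm 2 f]; rewrite !I3_addE.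
Qed.

Lemma lap_sX i (f : smoothfun) : lap (sX i f) = sX i (lap f).
Proof.
rewrite /lap.
have c1 h : sX 0 (sX 1 h) = sX 1 (sX 0 h) + 2 * sX 2 h :> smoothfun by case: (sX_comm3 h).
have c2 h : sX 1 (sX 2 h) = sX 2 (sX 1 h) + 2 * sX 0 h :> smoothfun by case: (sX_comm3 h).
have c3 h : sX 2 (sX 0 h) = sX 0 (sX 2 h) + 2 * sX 1 h :> smoothfun by case: (sX_comm3 h).
have : i \in [:: 0; 1; 2] by case: i => [[|[|[|//]]] ?].
rewrite !inE => /or3P[]/eqP ->.
- exact: (casimir0 c1 c2 c3).
- exact: (casimir1 c1 c2 c3).
- exact: (casimir2 c1 c2 c3).
Qed.

Definition nsq (z : C) : R := complex.Re z ^+ 2 + complex.Im z ^+ 2.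
Lemma nsq_ge0 z : 0 <= nsq z. Proof. by rewrite addr_ge0 ?sqr_ge0. Qed.
Lemma nsq_conj (f : smoothfun) g : complex.Re (sfval (f * sconj f) g) = nsq (sfval f g).
Proof.
by rewrite svalM /= /nsq; case: (sfval f g) => [a b]; rewrite /= mulrN opprK !expr2.
Qed.
Lemma nsq_eq0 z : nsq z = 0 -> z = 0.
Proof.
case: z => a b /eqP; rewrite /nsq /= paddr_eq0 ?sqr_ge0 // !sqrf_eq0.
by move=> /andP[/eqP -> /eqP ->].
Qed.

Lemma sconjD (f h : smoothfun) : sconj (f + h) = sconj f + sconj h.
Proof. by apply: sfun_ext => g; rewrite /= [(sfval f + sfval h) g]/(sfval f g + sfval h g) rmorphD. Qed.

Lemma lap_sq (f : smoothfun) : lap (f * sconj f) = lap f * sconj f + f * sconj (lap f) +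
  2 * (sX 0 f * sconj (sX 0 f) + sX 1 f * sconj (sX 1 f) + sX 2 f * sconj (sX 2 f)).
Proof. by rewrite /lap !sconjD; do 2 rewrite !(sX_mul, raddfD, sX_conj) /=; ring. Qed.

Lemma sfun_max (u : smoothfun) : exists g0, (forall g, complex.Re (sfval u g) <= complex.Re (sfval u g0))
  /\ complex.Re (sfval (lap u) g0) <= 0.
Proof.
have [h1 h2] := sfunP u 2%N.
have [g0 H] := SU2_max (CnR_cont h1); exists g0; split=> //.
have K i : complex.Re (sfval (sX i (sX i u)) g0) <= 0 by exact: dR_dR_max.
rewrite /lap !svalD; move: (K 0) (K 1) (K 2).
move: (sfval (sX 0 (sX 0 u)) g0) (sfval (sX 1 (sX 1 u)) g0) (sfval (sX 2 (sX 2 u)) g0).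
by move=> [a ?] [b ?] [c ?] /=; lra.
Qed.

Lemma ReD (x y : C) : complex.Re (x + y) = complex.Re x + complex.Re y.
Proof. by case: x y => [a b] [c d]. Qed.

Lemma Re2 (z : C) : complex.Re (2 * z) = 2 * complex.Re z.
Proof. by rewrite !mulr_natl !mulr2n ReD. Qed.

(* At a maximum of |f|^2 one has 0 >= Laplacian |f|^2 = 2|f|^2 + 2|grad f|^2. *)
Lemma lap_eq_id (f : smoothfun) : lap f = f -> f = 0.
Proof.
move=> Lf; have [g0 [H K]] := sfun_max (f * sconj f).
pose s := sX 0 f * sconj (sX 0 f) + sX 1 f * sconj (sX 1 f) + sX 2 f * sconj (sX 2 f).
have E : lap (f * sconj f) = f * sconj f + f * sconj f + 2 * s by rewrite lap_sq Lf.
have E2 : complex.Re (sfval (2 * s) g0) =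
    2 * (nsq (sfval (sX 0 f) g0) + nsq (sfval (sX 1 f) g0) + nsq (sfval (sX 2 f) g0)).
  by rewrite [sfval _ _](_ : _ = 2 * sfval s g0) // Re2 /s !svalD !ReD !nsq_conj.
move: K; rewrite E !svalD !ReD !nsq_conj E2.
have n0 := nsq_ge0 (sfval (sX 0 f) g0); have n1 := nsq_ge0 (sfval (sX 1 f) g0).
have n2 := nsq_ge0 (sfval (sX 2 f) g0) => K.
apply: sfun_ext => g; rewrite sval0; apply: nsq_eq0; apply/le_anti; rewrite nsq_ge0 andbT.
by rewrite -nsq_conj (le_trans (H g)) // nsq_conj; lra.
Qed.

Lemma sum3_eq0 (a b c : R) : 0 <= a -> 0 <= b -> 0 <= c -> a + b + c = 0 ->
  [/\ a = 0, b = 0 & c = 0].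
Proof. by move=> *; split; lra. Qed.

Lemma last_term_le0 (a b d e : R) : 0 <= a -> 0 <= b -> 0 <= d -> a + b + d + e <= 0 -> e <= 0.
Proof. by lra. Qed.

(* If f is harmonic then the Laplacian of |grad f|^2 + c|f|^2 is at least 2c|grad f|^2, so that
   grad f vanishes at a maximum of this function; now let c tend to 0. *)
Lemma lap_eq0 (f : smoothfun) : lap f = 0 -> f = scst (sfval f 1%g).
Proof.
move=> Lf.
pose grad g := nsq (sfval (sX 0 f) g) + nsq (sfval (sX 1 f) g) + nsq (sfval (sX 2 f) g).
have grad_ge0 (g : SU2) : 0 <= grad g by exact: (addr_ge0 (addr_ge0 (nsq_ge0 _) (nsq_ge0 _)) (nsq_ge0 _)).
have [gM [HM _]] := sfun_max (f * sconj f).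
pose M := nsq (sfval f gM).
(* The Laplacian commutes with the fields, so each X_j f is harmonic too and |grad f|^2 has a
   nonnegative Laplacian. *)
have Lj j : lap (sX j f) = 0 by rewrite lap_sX Lf raddf0.
have bound (c : R) (g : SU2) : 0 < c -> grad g <= c * M.
  move=> c0.
  pose s := sX 0 f * sconj (sX 0 f) + sX 1 f * sconj (sX 1 f) + sX 2 f * sconj (sX 2 f).
  pose u := s + scst c%:C * (f * sconj f).
  have uE h : complex.Re (sfval u h) = grad h + c * nsq (sfval f h).
    rewrite /u /s !svalD !ReD !nsq_conj; congr (_ + _).
    rewrite -nsq_conj [sfval _ _](_ : _ = c%:C * sfval (f * sconj f) h) //.
    by case: (sfval _ h) => a b /=; rewrite mul0r subr0.
  have [g0 [H K]] := sfun_max u.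
  have s0 : sconj 0 = 0.
    by have := sconjD 0 0; rewrite addr0 -{1}[sconj 0]addr0 => /addrI <-.
  have Lsq (h : smoothfun) : lap h = 0 -> lap (h * sconj h) = 2 * (sX 0 h * sconj (sX 0 h) +
     sX 1 h * sconj (sX 1 h) + sX 2 h * sconj (sX 2 h)).
    by move=> Lh; rewrite lap_sq Lh s0 mulr0 mul0r !add0r.
  have lapD (h k : smoothfun) : lap (h + k) = lap h + lap k by rewrite /lap !raddfD /=; ring.
  have lapc (h : smoothfun) : lap (scst c%:C * h) = scst c%:C * lap h.
    by rewrite /lap !(sX_mul, sX_cst, mul0r, add0r); ring.
  have pos (h : smoothfun) : 0 <= complex.Re (sfval (2 * (sX 0 h * sconj (sX 0 h) +
     sX 1 h * sconj (sX 1 h) + sX 2 h * sconj (sX 2 h))) g0).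
    rewrite [sfval _ _](_ : _ = 2 * sfval (sX 0 h * sconj (sX 0 h) +
     sX 1 h * sconj (sX 1 h) + sX 2 h * sconj (sX 2 h)) g0) // Re2.
    by rewrite !svalD !ReD !nsq_conj mulr_ge0 //; exact: (addr_ge0 (addr_ge0 (nsq_ge0 _) (nsq_ge0 _)) (nsq_ge0 _)).
  have grad0 : grad g0 = 0.
    apply/le_anti; rewrite grad_ge0 andbT.
    move: K; rewrite /u /s !lapD lapc !Lsq // !svalD !ReD.
    have p0 := pos (sX 0 f); have p1 := pos (sX 1 f); have p2 := pos (sX 2 f).
    have -> : complex.Re (sfval (scst c%:C * (2 * (sX 0 f * sconj (sX 0 f) +
     sX 1 f * sconj (sX 1 f) + sX 2 f * sconj (sX 2 f)))) g0) = c * (2 * grad g0).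
      rewrite [sfval _ _](_ : _ = c%:C * (2 * sfval (sX 0 f * sconj (sX 0 f) +
        sX 1 f * sconj (sX 1 f) + sX 2 f * sconj (sX 2 f)) g0)) //.
      rewrite -[c%:C * _]/(c%:C * _) /grad -!nsq_conj -!ReD -!svalD.
      move: (sfval _ g0) => z; rewrite -Re2; case: (2 * z) => a b /=.
      by rewrite mul0r subr0.
    by move=> /(last_term_le0 p0 p1 p2); rewrite pmulr_rle0 // pmulr_rle0.
  have := H g; rewrite !uE grad0 add0r => Hg.
  apply: le_trans (le_trans Hg _); first by rewrite lerDl mulr_ge0 ?nsq_ge0 // ltW.
  by rewrite ler_pM2l // /M -!nsq_conj.
have g0 (g : SU2) : grad g = 0.
  apply/le_anti; rewrite grad_ge0 andbT.
  have M0 : 0 <= M by exact: nsq_ge0.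
  apply/ler_addgt0Pl => e e0; rewrite addr0.
  (* M may vanish, hence the denominator M + 1. *)
  apply: le_trans (bound (e / (M + 1)) g _) _; first by rewrite divr_gt0 // ltr_wpDl.
  rewrite mulrAC ler_pdivrMr ?ltr_wpDl //; have := ltW e0 => e0'.
  by apply: ler_wpM2l => //; rewrite lerDl.
have X0 i g : sfval (sX i f) g = 0.
  have [h0 h1 h2] := sum3_eq0 (nsq_ge0 _) (nsq_ge0 _) (nsq_ge0 _) (g0 g).
  have : i \in [:: 0; 1; 2] by case: i => [[|[|[|//]]] ?].
  by rewrite !inE => /or3P[]/eqP ->; [exact: (nsq_eq0 h0)|exact: (nsq_eq0 h1)|exact: (nsq_eq0 h2)].
apply: sfun_ext => g /=.
have dr i := sfun_drv f i.
have H1 := dR_eq0_const (fun i => (dr i).1) (fun i g => congr1 (@complex.Re R) (X0 i g)) g.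
have H2 := dR_eq0_const (fun i => (dr i).2) (fun i g => congr1 (@complex.Im R) (X0 i g)) g.
by move: H1 H2; case: (sfval f g) (sfval f 1%g) => [a b] [c d] /= -> ->.
Qed.

End MaximumPrinciple.

(** * The double cover onto SO(3) *)

Section RotationMatrices.
Variable R : realType.
Local Notation SU2 := (SU2 R).
Local Notation C := R[i].

Definition mx3 (l : seq (seq R)) : 'M[R]_3 := \matrix_(i, j) nth 0 (nth [::] l i) j.

Definition rot (a b c d : R) : 'M[R]_3 := mx3
  [:: [:: a ^+ 2 + b ^+ 2 - c ^+ 2 - d ^+ 2; 2 * (b * c - a * d); 2 * (b * d + a * c)];
      [:: 2 * (b * c + a * d); a ^+ 2 - b ^+ 2 + c ^+ 2 - d ^+ 2; 2 * (c * d - a * b)];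
      [:: 2 * (b * d - a * c); 2 * (c * d + a * b); a ^+ 2 - b ^+ 2 - c ^+ 2 + d ^+ 2]].

Lemma I3_cases (P : 'I_3 -> Prop) : P 0 -> P 1 -> P 2 -> forall i, P i.
Proof.
move=> h0 h1 h2 [[|[|[|//]]] h].
- by rewrite (_ : Ordinal h = 0) //; apply: val_inj.
- by rewrite (_ : Ordinal h = 1) //; apply: val_inj.
- by rewrite (_ : Ordinal h = 2) //; apply: val_inj.
Qed.

Lemma su2_basis_mxq : [/\ su2_basis R 0 = mxq 0 1 0 0, su2_basis R 1 = mxq 0 0 1 0
  & su2_basis R 2 = mxq 0 0 0 1].
Proof. by split; rewrite /su2_basis (tnth_nth 0) /= /mxq; congr (mx2 _ _ _ _); simpc. Qed.

Lemma Re_tr_mxq (a b c d : R) : complex.Re (\tr (mxq a b c d)) = 2 * a.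
Proof. by rewrite /mxtrace !big_ord_recl big_ord0 !mxE /=; ring. Qed.

Lemma double_coverE (g : SU2) : double_cover g = rot (q0 g) (q1 g) (q2 g) (q3 g).
Proof.
have [v0 v1 v2 v3] := q_inv g.
have gV : SU2val g^-1%g = mxq (q0 g) (- q1 g) (- q2 g) (- q3 g).
  by rewrite SU2_mxq v0 v1 v2 v3.
have [b0 b1 b2] := su2_basis_mxq.
have half (x y : R) : x = - (2 * y) -> - x / 2 = y by move=> ->; field.
apply/matrixP => i j; rewrite !mxE gV SU2_mxq.
by elim/I3_cases: i; elim/I3_cases: j; rewrite ?b0 ?b1 ?b2 !mul_mxq Re_tr_mxq /=; apply: half; ring.
Qed.

Lemma mx3_eqP (A B : 'M[R]_3) : [/\ A 0 0 = B 0 0, A 0 1 = B 0 1 & A 0 2 = B 0 2] ->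
  [/\ A 1 0 = B 1 0, A 1 1 = B 1 1 & A 1 2 = B 1 2] ->
  [/\ A 2 0 = B 2 0, A 2 1 = B 2 1 & A 2 2 = B 2 2] -> A = B.
Proof.
move=> [? ? ?] [? ? ?] [? ? ?]; apply/matrixP => i j.
by elim/I3_cases: i; elim/I3_cases: j.
Qed.

Lemma sum3 (f : 'I_3 -> R) : \sum_i f i = f 0 + f 1 + f 2.
Proof.
rewrite !big_ord_recl big_ord0 addr0 addrA; congr (_ + f _ + f _); exact: val_inj.
Qed.

Lemma double_coverM (g h : SU2) : double_cover (g * h)%g = double_cover g *m double_cover h.
Proof.
rewrite !double_coverE !qM; apply: mx3_eqP; split; rewrite ?mxE ?sum3 !mxE /=; ring.
Qed.

Lemma double_cover1 : double_cover (1 : SU2)%g = 1%:M.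
Proof.
rewrite !double_coverE !qone; apply: mx3_eqP; split; rewrite !mxE /=; ring.
Qed.

Lemma double_cover_orth (g : SU2) : double_cover g *m (double_cover g)^T = 1%:M.
Proof.
have N := SU2_norm g.
have N2 : (q0 g ^+ 2 + q1 g ^+ 2 + q2 g ^+ 2 + q3 g ^+ 2) ^+ 2 = 1 by rewrite N expr1n.
rewrite double_coverE; apply: mx3_eqP; split; rewrite !mxE sum3 !mxE /=; try ring; rewrite -[RHS]N2; ring.
Qed.

Lemma det_mx3 (a b c d e f g h i : R) :
  \det (mx3 [:: [:: a; b; c]; [:: d; e; f]; [:: g; h; i]]) =
  a * (e * i - f * h) - b * (d * i - f * g) + c * (d * h - e * g).
Proof.
rewrite (expand_det_row _ 0) sum3 /cofactor.
rewrite !(expand_det_row _ ord0) !big_ord_recl !big_ord0 /cofactor !det_mx11 !mxE /=.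
rewrite /bump /= !(expr0, expr1, addn0, add0n, addn1); ring.
Qed.

Lemma mx3_eta (A : 'M[R]_3) : A =
  mx3 [:: [:: A 0 0; A 0 1; A 0 2]; [:: A 1 0; A 1 1; A 1 2]; [:: A 2 0; A 2 1; A 2 2]].
Proof. by apply: mx3_eqP; split; rewrite !mxE. Qed.

Lemma det_double_cover (g : SU2) : \det (double_cover g) = 1.
Proof.
have N := SU2_norm g.
have N3 : (q0 g ^+ 2 + q1 g ^+ 2 + q2 g ^+ 2 + q3 g ^+ 2) ^+ 3 = 1 by rewrite N expr1n.
by rewrite double_coverE det_mx3 -[RHS]N3; ring.
Qed.

Lemma double_coverV (g : SU2) : double_cover g^-1%g = (double_cover g)^T.
Proof.
rewrite !double_coverE !qV; apply: mx3_eqP; split; rewrite !mxE /=; ring.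
Qed.

(** Comparing the two diagonal entries with the norm gives q1^2 + q3^2 = 0 and q1^2 + q2^2 = 0.
    Columns 1 and 2 are what the vertices (0, 1, phi) and (0, 1, -phi) determine. *)
Lemma double_cover_fix (g : SU2) :
  (forall i, double_cover g i 1 = (1%:M : 'M[R]_3) i 1) ->
  (forall i, double_cover g i 2 = (1%:M : 'M[R]_3) i 2) ->
  [/\ q1 g = 0, q2 g = 0, q3 g = 0 & q0 g = 1 \/ q0 g = - 1].
Proof.
move=> /(_ 1) h1 /(_ 2) h2; have N := SU2_norm g.
move: h1 h2; rewrite double_coverE !mxE /= => h1 h2.
have sq (a b c : R) : 0 <= a ^+ 2 /\ 0 <= b ^+ 2 /\ 0 <= c ^+ 2 by rewrite !sqr_ge0.
have [p1 [p2 p3]] := sq (q1 g) (q2 g) (q3 g).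
have e1 : q1 g = 0 by apply/eqP; rewrite -sqrf_eq0; apply/eqP; lra.
have e2 : q2 g = 0 by apply/eqP; rewrite -sqrf_eq0; apply/eqP; lra.
have e3 : q3 g = 0 by apply/eqP; rewrite -sqrf_eq0; apply/eqP; lra.
split=> //; move: N; rewrite e1 e2 e3 expr0n !addr0 => /eqP.
by rewrite -[X in _ == X](expr1n _ 2) eqf_sqr => /orP[]/eqP; [left|right].
Qed.

Lemma double_cover_exp0 (t : R) : double_cover (su2_exp 0 t) = mx3
  [:: [:: 1; 0; 0]; [:: 0; cos (2 * t); - sin (2 * t)]; [:: 0; sin (2 * t); cos (2 * t)]].
Proof.
have e2 : 2 * t = t + t by ring.
have N := cos2Dsin2 t.
rewrite double_coverE e2 cosD sinD; apply: mx3_eqP; split; rewrite !mxE !qE /qdelta /= -?[RHS]N; ring.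
Qed.

Lemma double_cover_exp2 (t : R) : double_cover (su2_exp 2 t) = mx3
  [:: [:: cos (2 * t); - sin (2 * t); 0]; [:: sin (2 * t); cos (2 * t); 0]; [:: 0; 0; 1]].
Proof.
have e2 : 2 * t = t + t by ring.
have N := cos2Dsin2 t.
rewrite double_coverE e2 cosD sinD; apply: mx3_eqP; split; rewrite !mxE !qE /qdelta /= -?[RHS]N; ring.
Qed.

(** Euler angles: [h1] carries the first basis vector to the first column of A, and the remaining
    factor [B] fixes that vector, so it is a rotation about it. All angles are halved because the
    cover doubles them. *)
Lemma double_cover_surj (A : 'M[R]_3) : A *m A^T = 1%:M -> \det A = 1 ->
  exists h : SU2, double_cover h = A.
Proof.
move=> AAT dA.
have ATA : A^T *m A = 1%:M by exact: mulmx1C.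
pose x := A 0 0; pose r := Num.sqrt (A 1 0 ^+ 2 + A 2 0 ^+ 2).
have r2 : A 1 0 ^+ 2 + A 2 0 ^+ 2 = r ^+ 2 by rewrite sqr_sqrtr // addr_ge0 ?sqr_ge0.
have c0 : A 0 0 ^+ 2 + A 1 0 ^+ 2 + A 2 0 ^+ 2 = 1.
  by have := congr1 (fun M : 'M[R]_3 => M 0 0) ATA; rewrite !mxE sum3 !mxE /= !expr2.
have [b _ [b1 b2]] := scaled_angle r2.
have [|a _ [a1 a2]] := @circle_angle R (A 0 0) r; first by rewrite -r2 addrA.
pose h1 : SU2 := (su2_exp 0 (b / 2) * su2_exp 2 (a / 2))%g.
have hb : 2 * (b / 2) = b by field.
have ha : 2 * (a / 2) = a by field.
pose B := (double_cover h1)^T *m A.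
have Bo : B *m B^T = 1%:M.
  rewrite /B trmx_mul trmxK mulmxA -[_ *m A *m _]mulmxA AAT mulmx1.
  by rewrite -double_coverV -double_coverM mulVg double_cover1.
have Bo' : B^T *m B = 1%:M by exact: mulmx1C.
have dB : \det B = 1 by rewrite det_mulmx det_tr det_double_cover dA mulr1.
have dh : double_cover h1 = mx3 [:: [:: cos a; - sin a; 0];
     [:: cos b * sin a; cos b * cos a; - sin b]; [:: sin b * sin a; sin b * cos a; cos b]].
  rewrite /h1 double_coverM double_cover_exp0 double_cover_exp2 hb ha.
  by apply: mx3_eqP; split; rewrite ?mxE ?sum3 !mxE /=; ring.
have Na := cos2Dsin2 a; have Nb := cos2Dsin2 b.
have B00 : B 0 0 = 1.
  rewrite /B dh mxE sum3 !mxE /= b1 b2 a1 a2.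
  transitivity (cos a ^+ 2 + sin a ^+ 2 * (cos b ^+ 2 + sin b ^+ 2)); first by ring.
  by rewrite Nb mulr1 Na.
have B10 : B 1 0 = 0.
  rewrite /B dh mxE sum3 !mxE /= b1 b2 a1 a2.
  transitivity (cos a * sin a * ((cos b ^+ 2 + sin b ^+ 2) - 1)); first by ring.
  by rewrite Nb subrr mulr0.
have B20 : B 2 0 = 0.
  by rewrite /B dh mxE sum3 !mxE /= b1 b2 a1 a2; ring.
have AE : double_cover h1 *m B = A.
  by rewrite /B mulmxA -double_coverV -double_coverM mulgV double_cover1 mul1mx.
clearbody B.
have row0 := congr1 (fun M : 'M[R]_3 => M 0 0) Bo.
rewrite !mxE sum3 !mxE /= B00 mul1r in row0.
have [B01 B02] : B 0 1 = 0 /\ B 0 2 = 0.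
  have s1 := sqr_ge0 (B 0 1); have s2 := sqr_ge0 (B 0 2).
  by split; apply/eqP; rewrite -sqrf_eq0; apply/eqP; rewrite !expr2 in s1 s2 *; lra.
have c11 : B 1 1 * B 1 1 + B 2 1 * B 2 1 = 1.
  by have := congr1 (fun M : 'M[R]_3 => M 1 1) Bo'; rewrite !mxE sum3 !mxE B01 mul0r add0r.
have c12 : B 1 1 * B 1 2 + B 2 1 * B 2 2 = 0.
  by have := congr1 (fun M : 'M[R]_3 => M 1 2) Bo'; rewrite !mxE sum3 !mxE B01 mul0r add0r.
have dB' := dB; rewrite (mx3_eta B) det_mx3 B00 B01 B02 B10 B20 in dB'.
have [|t _ [t1 t2]] := @circle_angle R (B 1 1) (B 2 1).
  by rewrite !expr2.
have e22 : B 2 2 = B 1 1.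
  transitivity (B 1 1 * (B 1 1 * B 2 2 - B 1 2 * B 2 1) +
     B 2 1 * (B 1 1 * B 1 2 + B 2 1 * B 2 2) + B 2 2 * (1 - (B 1 1 * B 1 1 + B 2 1 * B 2 1))).
    by ring.
  rewrite c11 c12.
  have -> : B 1 1 * B 2 2 - B 1 2 * B 2 1 = 1 by rewrite -dB'; ring.
  by ring.
have e12 : B 1 2 = - B 2 1.
  transitivity (- B 2 1 * (B 1 1 * B 2 2 - B 1 2 * B 2 1) +
     B 1 1 * (B 1 1 * B 1 2 + B 2 1 * B 2 2) + B 1 2 * (1 - (B 1 1 * B 1 1 + B 2 1 * B 2 1))).
    by ring.
  rewrite c11 c12.
  have -> : B 1 1 * B 2 2 - B 1 2 * B 2 1 = 1 by rewrite -dB'; ring.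
  by ring.
have ht : 2 * (t / 2) = t by field.
have hB : double_cover (su2_exp 0 (t / 2) : SU2) = B.
  rewrite double_cover_exp0 ht; apply: mx3_eqP; split; rewrite !mxE /=.
  all: rewrite ?B00 ?B01 ?B02 ?B10 ?B20 ?e12 ?e22 -?t1 -?t2 //.
by exists (h1 * su2_exp 0 (t / 2))%g; rewrite double_coverM hB AE.
Qed.

End RotationMatrices.

(** * The binary icosahedral group *)

(* the ring Z[phi], (a, b) standing for a + b phi, in a form suited to computation *)
Definition zphi : Type := (int * int)%type.
Definition zadd (x y : zphi) : zphi := (x.1 + y.1, x.2 + y.2)%R.
Definition zopp (x : zphi) : zphi := (- x.1, - x.2)%R.
Definition zmul (x y : zphi) : zphi :=
  (x.1 * y.1 + x.2 * y.2, x.1 * y.2 + x.2 * y.1 + x.2 * y.2)%R.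
Definition zsub x y := zadd x (zopp y).
Definition zint (n : int) : zphi := (n, 0%R).
Definition znorm (x : zphi) : int := (x.1 ^+ 2 + x.1 * x.2 - x.2 ^+ 2)%R.

Definition zquat : Type := (zphi * zphi * zphi * zphi)%type.
Definition zvec : Type := (zphi * zphi * zphi)%type.

(* the entries are those of the rotation matrix of q, times the squared norm of q *)
Definition zrot (q : zquat) (v : zvec) : zvec :=
  let: (a, b, c, d) := q in let: (x, y, z) := v in
  let two := zint 2 in
  let aa := zmul a a in let bb := zmul b b in let cc := zmul c c in let dd := zmul d d in
  let sum3 (p q r : zphi) := zadd (zadd (zmul p x) (zmul q y)) (zmul r z) in
  (sum3 (zsub (zsub (zadd aa bb) cc) dd) (zmul two (zsub (zmul b c) (zmul a d)))
        (zmul two (zadd (zmul b d) (zmul a c))),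
   sum3 (zmul two (zadd (zmul b c) (zmul a d))) (zsub (zadd (zsub aa bb) cc) dd)
        (zmul two (zsub (zmul c d) (zmul a b))),
   sum3 (zmul two (zsub (zmul b d) (zmul a c))) (zmul two (zadd (zmul c d) (zmul a b)))
        (zadd (zsub (zsub aa bb) cc) dd)).

Definition zscale (x : zphi) (v : zvec) : zvec :=
  (zmul x v.1.1, zmul x v.1.2, zmul x v.2).
Definition zdot (v w : zvec) : zphi :=
  zadd (zadd (zmul v.1.1 w.1.1) (zmul v.1.2 w.1.2)) (zmul v.2 w.2).

Definition zsign (b : bool) (x : zphi) : zphi := if b then zopp x else x.
Definition bools := [:: false; true].
Definition zvertex (c : nat) (e1 e2 : bool) : zvec :=
  let s1 := zsign e1 (1, 0)%R in let s2 := zsign e2 (0, 1)%R in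
  match c with 0%N => (zint 0, s1, s2) | 1%N => (s2, zint 0, s1) | _ => (s1, s2, zint 0) end.
Definition zvertices : seq zvec :=
  [seq zvertex c.1 c.2.1 c.2.2 | c <- allpairs pair [:: 0; 1; 2]%N (allpairs pair bools bools)].

Definition alternating4 : seq (nat * nat * nat * nat) :=
  [:: (0, 1, 2, 3); (0, 2, 3, 1); (0, 3, 1, 2); (1, 0, 3, 2); (1, 2, 0, 3); (1, 3, 2, 0);
      (2, 0, 1, 3); (2, 1, 3, 0); (2, 3, 0, 1); (3, 0, 2, 1); (3, 1, 0, 2); (3, 2, 1, 0)]%N.

(* Twice the icosians: the unit quaternions +-1, +-i, +-j, +-k, (+-1 +-i +-j +-k)/2 and the
   even permutations of (+-phi +-(phi - 1)j +-k)/2, with coordinates in Z[phi]. *)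
Definition icosians : seq zquat :=
  [:: (zint 2, zint 0, zint 0, zint 0); (zint (-2), zint 0, zint 0, zint 0)]
  ++ flatten [seq [:: (zint 0, x, zint 0, zint 0); (zint 0, zint 0, x, zint 0);
                      (zint 0, zint 0, zint 0, x)] | x <- [:: zint 2; zint (-2)]]
  ++ [seq (zsign s.1.1 (zint 1), zsign s.1.2 (zint 1), zsign s.2.1 (zint 1), zsign s.2.2 (zint 1))
        | s <- allpairs pair (allpairs pair bools bools) (allpairs pair bools bools)]
  ++ flatten [seq [seq (let t i := nth (zint 0) [:: zsign s.1 (0, 1)%R; zint 0;
                           zsign s.2.1 (-1, 1)%R; zsign s.2.2 (zint 1)] i in
                        (t p.1.1.1, t p.1.1.2, t p.1.2, t p.2))
                     | s <- allpairs pair bools (allpairs pair bools bools)]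
                | p <- alternating4].

Definition zconj (q : zquat) : zquat := let: (a, b, c, d) := q in (a, zopp b, zopp c, zopp d).
Definition zneg (q : zquat) : zquat := let: (a, b, c, d) := q in (zopp a, zopp b, zopp c, zopp d).
Definition zqnorm (q : zquat) : zphi := let: (a, b, c, d) := q in
  zadd (zadd (zadd (zmul a a) (zmul b b)) (zmul c c)) (zmul d d).
(* Distinctness is tested on norms, since it has to survive the map Z[phi] -> R. *)
Definition zdistinct (q r : zquat) : bool :=
  let: (a, b, c, d) := q in let: (a', b', c', d') := r in
  has (fun x => znorm x != 0%R) [:: zsub a a'; zsub b b'; zsub c c'; zsub d d'].

Lemma icosians_norm : all (fun q => zqnorm q == zint 4) icosians.
Proof. by vm_compute. Qed.
Lemma icosians_act : all (fun q => all (fun v => has (fun w => zrot q v == zscale (zint 4) w)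
  zvertices) zvertices) icosians.
Proof. by vm_compute. Qed.
Lemma icosians_conj : all (fun q => zconj q \in icosians) icosians.
Proof. by vm_compute. Qed.
Lemma icosians_neg : all (fun q => zneg q \in icosians) icosians.
Proof. by vm_compute. Qed.
Lemma icosians_distinct : pairwise zdistinct icosians.
Proof. by vm_compute. Qed.
Lemma size_icosians : size icosians = 120.
Proof. by vm_compute. Qed.

Definition zv0 : zvec := zvertex 0 false false.
Definition zv1 : zvec := zvertex 0 false true.

Lemma zverticesE : all (fun z => has (fun c => has (fun e1 => has (fun e2 =>
  z == zvertex c e1 e2) bools) bools) [:: 0; 1; 2]%N) zvertices.
Proof. by vm_compute. Qed.

(** Transitivity on ordered pairs of vertices with inner product -phi. For all other pairs the
    nonzero norm certifies that the inner products still differ as real numbers. *)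
Lemma icosians_transitive : all (fun v => all (fun w =>
   if zdot v w == zdot zv0 zv1
   then has (fun q => (zrot q zv0 == zscale (zint 4) v) && (zrot q zv1 == zscale (zint 4) w)) icosians
   else znorm (zsub (zdot v w) (zdot zv0 zv1)) != 0%R) zvertices) zvertices.
Proof. by vm_compute. Qed.

Definition ztrace (q : zquat) : zphi := q.1.1.1.
Fixpoint zcheb (t : zphi) (n : nat) : zphi * zphi :=
  if n is n'.+1 then let: (u, v) := zcheb t n' in (v, zsub (zmul t v) u) else (zint 1, t).
Definition zsum (l : seq zphi) : zphi := foldr zadd (zint 0) l.

(* the dimension of the invariants of rho_k, for even k < 60 *)
Definition invariant_dim (k : nat) : bool :=
  k \in [:: 0; 12; 20; 24; 30; 32; 36; 40; 42; 44; 48; 50; 52; 54; 56]%N.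

(** The character sequence of an element is periodic with its order; apart from +-1 the orders are
    3, 4, 5, 6 and 10. *)
Lemma icosians_periodic : all (fun q => zcheb (ztrace q) 60 == zcheb (ztrace q) 0) (drop 2 icosians).
Proof. by vm_compute. Qed.

(* The icosians 1 and -1 head the list; their characters grow with n and are dropped. *)
Definition zcharacter_sum (k : nat) : zphi :=
  zsum [seq (zcheb (ztrace q) k).1 | q <- drop 2 icosians].

(** The subtracted 2(k+1) is what 1 and -1 contribute together for even k. For odd k the elements g
    and -g cancel. *)
Lemma zcharacter_sum_table : all (fun k => zcharacter_sum k ==
  (if odd k then zint 0 else zsub (zint (120 * invariant_dim k)%N) (zint (2 * k.+1)%N))) (iota 0 60).
Proof. by vm_compute. Qed.

Section IcosahedralGroup.
Variable R : realType.
Local Notation SU2 := (SU2 R).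
Local Notation phi := (golden_ratio R).

Lemma golden_ratio_sqr : phi ^+ 2 = phi + 1.
Proof.
have s5 : Num.sqrt (5 : R) ^+ 2 = 5 by rewrite sqr_sqrtr.
rewrite /golden_ratio; move: s5; set s := Num.sqrt 5 => s5.
have -> : ((1 + s) / 2) ^+ 2 = (1 + 2 * s + s ^+ 2) / 4 by field.
by rewrite s5; field.
Qed.

Definition zeval (x : zphi) : R := x.1%:~R + x.2%:~R * phi.

Lemma zevalD x y : zeval (zadd x y) = zeval x + zeval y.
Proof. by rewrite /zeval /= !rmorphD /=; ring. Qed.
Lemma zevalN x : zeval (zopp x) = - zeval x.
Proof. by rewrite /zeval /= !rmorphN /=; ring. Qed.
Lemma zevalB x y : zeval (zsub x y) = zeval x - zeval y.
Proof. by rewrite /zsub zevalD zevalN. Qed.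
Lemma zevalM x y : zeval (zmul x y) = zeval x * zeval y.
Proof.
rewrite /zeval /= !rmorphD /= !rmorphM /=.
transitivity (x.1%:~R * y.1%:~R + (x.1%:~R * y.2%:~R + x.2%:~R * y.1%:~R) * phi +
  x.2%:~R * y.2%:~R * (phi + 1)); first by ring.
by rewrite -golden_ratio_sqr; ring.
Qed.
Lemma zeval_int n : zeval (zint n) = n%:~R.
Proof. by rewrite /zeval /= mul0r addr0. Qed.

Definition zevalE := (zevalD, zevalN, zevalB, zevalM, zeval_int).

Lemma zeval_neq0 x : znorm x != 0 -> zeval x != 0.
Proof.
move=> nx; apply/eqP => x0.
have : (znorm x)%:~R = 0 :> R.
  (* The second factor is the Galois conjugate a + b - b phi of a + b phi, so the product is the
     norm. *)
  transitivity (zeval x * (x.1%:~R + x.2%:~R - x.2%:~R * phi)); last by rewrite x0 mul0r.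
  rewrite /znorm /zeval rmorphB rmorphD !rmorphXn rmorphM /=.
  transitivity (x.1%:~R ^+ 2 + x.1%:~R * x.2%:~R - x.2%:~R ^+ 2 * (phi + 1 - phi)); first by ring.
  by rewrite -golden_ratio_sqr; ring.
by move/eqP; rewrite intr_eq0 (negbTE nx).
Qed.

Definition zq_mx (q : zquat) : 'M[R[i]]_2 := let: (a, b, c, d) := q in
  mxq (zeval a / 2) (zeval b / 2) (zeval c / 2) (zeval d / 2).

(** [insubd] supplies 1 outside SU(2); by [icosianE] this default does not interfere on the list
    [icosians]. *)
Definition icosian (q : zquat) : SU2 := insubd (1%g : SU2) (zq_mx q).

Lemma icosianE q : q \in icosians -> let: (a, b, c, d) := q in
  [/\ q0 (icosian q) = zeval a / 2, q1 (icosian q) = zeval b / 2,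
      q2 (icosian q) = zeval c / 2 & q3 (icosian q) = zeval d / 2].
Proof.
move=> qI; have /eqP := allP icosians_norm q qI.
case: q qI => [[[a b] c] d] _ /= /(congr1 zeval); rewrite !zevalE => N.
apply: SU2_mxq_eq; rewrite /icosian val_insubd.
suff -> : SU2_pred (zq_mx (a, b, c, d)) by [].
apply: SU2_quat; rewrite !expr_div_n -!mulrDl.
transitivity ((4%:~R : R) / 2 ^+ 2); last by field.
by congr (_ / _); rewrite -N; ring.
Qed.

Definition zcol (v : zvec) : 'cV[R]_3 :=
  \col_i nth 0 [:: zeval v.1.1; zeval v.1.2; zeval v.2] i.

Lemma cV3_eqP (u v : 'cV[R]_3) : u 0 0 = v 0 0 -> u 1 0 = v 1 0 -> u 2 0 = v 2 0 -> u = v.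
Proof. by move=> ? ? ?; apply/matrixP => i j; rewrite (ord1 j); elim/I3_cases: i. Qed.

Lemma icosian_act q v : q \in icosians ->
  double_cover (icosian q) *m zcol v = 4^-1 *: zcol (zrot q v).
Proof.
move=> /icosianE; case: q => [[[a b] c] d]; case: v => [[x y] z] [h0 h1 h2 h3].
by rewrite double_coverE h0 h1 h2 h3; apply: cV3_eqP;
  rewrite !mxE sum3 !mxE /= !zevalE /=; field.
Qed.

Lemma zeval_sign e x : zeval (zsign e x) = (-1) ^+ e * zeval x.
Proof. by case: e; rewrite /zsign ?zevalN ?expr1 ?expr0 ?mulN1r ?mul1r. Qed.

Lemma zeval1 : zeval (1, 0) = 1. Proof. by rewrite /zeval /= mul0r addr0. Qed.
Lemma zevalphi : zeval (0, 1) = phi. Proof. by rewrite /zeval /= add0r mul1r. Qed.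

Lemma standardP (v : 'cV[R]_3) :
  standard_icosahedron v <-> exists2 z, z \in zvertices & v = zcol z.
Proof.
split.
- move=> [c [e1 [e2 [h0 h1 h2]]]]; exists (zvertex c e1 e2).
    by elim/I3_cases: c {h0 h1 h2}; case: e1; case: e2; vm_compute.
  elim/I3_cases: c h0 h1 h2; rewrite ?I3_addE => h0 h1 h2; apply: cV3_eqP;
  by rewrite !mxE /= ?zeval_sign ?zeval1 ?zevalphi ?zeval_int ?mulr1.
- move=> [z /(allP zverticesE)/hasP[c + /hasP[e1 _ /hasP[e2 _ /eqP ->]]] ->].
  rewrite !inE => /or3P[]/eqP ->; [exists 0|exists 1|exists 2]; exists e1, e2;
    by rewrite ?I3_addE; split; rewrite !mxE /= ?zeval_sign ?zeval1 ?zevalphi ?zeval_int ?mulr1.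
Qed.

Let V0 := @standard_icosahedron R.

Lemma icosian_sub q v : q \in icosians -> V0 v -> V0 (double_cover (icosian q) *m v).
Proof.
move=> qI /standardP[z zI ->]; rewrite icosian_act //; apply/standardP.
have /allP/(_ z zI)/hasP[w wI /eqP ->] := allP icosians_act q qI.
by exists w => //; apply: cV3_eqP; rewrite !mxE /= !zevalE; field.
Qed.

Lemma icosian_conj q : q \in icosians -> icosian (zconj q) = (icosian q)^-1%g.
Proof.
move=> qI; have cI := allP icosians_conj q qI.
have := icosianE qI; have := icosianE cI.
case: q qI cI => [[[a b] c] d] _ _ [k0 k1 k2 k3] [h0 h1 h2 h3].
by apply: SU2_eqP; rewrite qV ?k0 ?k1 ?k2 ?k3 ?h0 ?h1 ?h2 ?h3 ?zevalN ?mulNr.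
Qed.

Lemma icosian_neg q : q \in icosians ->
  [/\ q0 (icosian (zneg q)) = - q0 (icosian q), q1 (icosian (zneg q)) = - q1 (icosian q),
      q2 (icosian (zneg q)) = - q2 (icosian q) & q3 (icosian (zneg q)) = - q3 (icosian q)].
Proof.
move=> qI; have cI := allP icosians_neg q qI.
have := icosianE qI; have := icosianE cI.
case: q qI cI => [[[a b] c] d] _ _ [k0 k1 k2 k3] [h0 h1 h2 h3].
by rewrite k0 k1 k2 k3 h0 h1 h2 h3 !zevalN !mulNr.
Qed.

Definition preserves (V : set 'cV[R]_3) (g : SU2) : Prop :=
  [set double_cover g *m v | v in V] = V.

Lemma icosian_preserves q : q \in icosians -> preserves V0 (icosian q).
Proof.
move=> qI; apply/seteqP; split => [_ [v Vv <-]|v Vv]; first exact: icosian_sub.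
have cI := allP icosians_conj q qI.
exists (double_cover (icosian (zconj q)) *m v); first exact: icosian_sub.
by rewrite mulmxA -double_coverM icosian_conj // mulgV double_cover1 mul1mx.
Qed.

Lemma dot_double_cover (g : SU2) (u v : 'cV[R]_3) :
  (double_cover g *m u)^T *m (double_cover g *m v) = u^T *m v.
Proof.
rewrite trmx_mul mulmxA -[_ *m _ *m double_cover g]mulmxA.
by rewrite (mulmx1C (double_cover_orth g)) mulmx1.
Qed.

Lemma dot_zcol u v : ((zcol u)^T *m zcol v) 0 0 = zeval (zdot u v).
Proof. by rewrite !mxE sum3 !mxE /= !zevalE. Qed.

(** The image of the pair ([zv0], [zv1]) keeps its inner product, so some icosian produces the same
    image. The quotient fixes two independent vertices and is therefore +-1; the sign is absorbed by
    [zneg]. *)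
Lemma preserves_icosian (g : SU2) : preserves V0 g -> exists2 q, q \in icosians & g = icosian q.
Proof.
move=> gV.
have img z : z \in zvertices -> exists2 w, w \in zvertices & double_cover g *m zcol z = zcol w.
  move=> zI; apply/standardP; rewrite -/V0 -gV; exists (zcol z) => //.
  by apply/standardP; exists z.
have i0 : zv0 \in zvertices by vm_compute.
have i1 : zv1 \in zvertices by vm_compute.
have [v vI ve] := img _ i0; have [w wI we] := img _ i1.
have D : zeval (zdot v w) = zeval (zdot zv0 zv1).
  by rewrite -!dot_zcol -ve -we dot_double_cover.
have := allP (allP icosians_transitive v vI) w wI.
case: ifP => _; last first.
  by move/zeval_neq0; rewrite zevalB D subrr eqxx.
move=> /hasP[q qI /andP[/eqP qv /eqP qw]].
have four (u : zvec) : 4^-1 *: zcol (zscale (zint 4) u) = zcol u.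
  by apply: cV3_eqP; rewrite !mxE /= !zevalE; field.
have ev : double_cover (icosian q) *m zcol zv0 = zcol v by rewrite icosian_act // qv four.
have ew : double_cover (icosian q) *m zcol zv1 = zcol w by rewrite icosian_act // qw four.
pose h := ((icosian q)^-1 * g)%g.
have fix0 u : double_cover (icosian q) *m u = double_cover g *m u -> double_cover h *m u = u.
  move=> e; rewrite /h double_coverM -mulmxA -e mulmxA -double_coverM mulVg double_cover1.
  by rewrite mul1mx.
have f0 := fix0 _ _ (etrans ev (esym ve)); have f1 := fix0 _ _ (etrans ew (esym we)).
have p0 : 0 < phi by rewrite /golden_ratio divr_gt0 // addr_gt0 // sqrtr_gt0.
(* Fixing (0, 1, phi) and (0, 1, -phi) prescribes column 1 plus and minus phi times column 2; as phi
   > 0 both columns follow. *)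
have fx i : double_cover h i 1 = (1%:M : 'M[R]_3) i 1 /\
    double_cover h i 2 = (1%:M : 'M[R]_3) i 2.
  have xy (x y s t : R) : x * 1 - y * phi = s - t * phi -> x * 1 + y * phi = s + t * phi ->
      x = s /\ y = t.
    move=> k1 k2; have kx : x = s by lra.
    by split=> //; apply: (mulIf (lt0r_neq0 p0)); lra.
  move: (double_cover h) f0 f1 => A f0 f1; apply: xy.
  - have := congr1 (fun M : 'cV[R]_3 => M i 0) f1.
    rewrite !mxE !sum3 !mxE /zv1 /= !zevalN !zeval1 !zevalphi !zeval_int !mulr0z !mulr0 !add0r.
    rewrite mulrN => ->.
    by elim/I3_cases: i => /=; rewrite ?mul0r ?mul1r ?subr0 ?sub0r ?oppr0.
  - have := congr1 (fun M : 'cV[R]_3 => M i 0) f0.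
    rewrite !mxE !sum3 !mxE /zv0 /= !zeval1 !zevalphi !zeval_int !mulr0z !mulr0 !add0r => ->.
    by elim/I3_cases: i => /=; rewrite ?mul0r ?mul1r ?addr0 ?add0r.
have [h1 h2 h3 h0] := double_cover_fix (fun i => (fx i).1) (fun i => (fx i).2).
have gE : g = (icosian q * h)%g by rewrite /h mulgA mulgV mul1g.
case: h0 => h0.
- exists q => //; rewrite gE; apply: SU2_eqP; rewrite qM h0 h1 h2 h3; ring.
- exists (zneg q); first exact: (allP icosians_neg q qI).
  have [n0 n1 n2 n3] := icosian_neg qI.
  rewrite gE; apply: SU2_eqP; rewrite qM h0 h1 h2 h3 ?n0 ?n1 ?n2 ?n3; ring.
Qed.

End IcosahedralGroup.

Section BinaryIcosahedral.
Variable R : realType.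
Local Notation SU2 := (SU2 R).

Lemma uniq_icosian : uniq [seq icosian R q | q <- icosians].
Proof.
rewrite uniq_pairwise pairwise_map.
apply: (@sub_in_pairwise _ (mem icosians) zdistinct); [|exact/allP|exact: icosians_distinct].
move=> q r qI rI D; apply/negP => /= /eqP E; move: D.
have := icosianE R qI; have := icosianE R rI; rewrite -E.
case: q r {E qI rI} => [[[a b] c] d] [[[a' b'] c'] d'] [h0 h1 h2 h3] [k0 k1 k2 k3] /=.
have e (x y : zphi) (z : R) : z = zeval R y / 2 -> z = zeval R x / 2 -> znorm (zsub x y) == 0.
  move=> -> /(congr1 (fun t => t * 2)); rewrite !divfK ?pnatr_eq0 // => xy.
  by apply: contraTT isT => /(zeval_neq0 R); rewrite zevalB xy subrr eqxx.
by rewrite (e _ _ _ h0 k0) (e _ _ _ h1 k1) (e _ _ _ h2 k2) (e _ _ _ h3 k3).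
Qed.

Lemma rotation_group_double_cover (V : set 'cV[R]_3) (g : SU2) :
  rotation_group V (double_cover g) <-> preserves V g.
Proof.
by split=> [[]//|H]; split=> //; [exact: double_cover_orth|exact: det_double_cover].
Qed.

Lemma standard_opp (v : 'cV[R]_3) : standard_icosahedron v -> standard_icosahedron (- v).
Proof.
move=> [c [e1 [e2 [h0 h1 h2]]]]; exists c, (~~ e1), (~~ e2).
by rewrite !mxE h0 h1 h2 oppr0 !signrN mulNr.
Qed.

Lemma conj_stable (V : set 'cV[R]_3) (r : R) (D A : 'M[R]_3) : r != 0 -> D^T *m D = 1%:M ->
  [set A *m v | v in [set r *: (D *m v) | v in V]] = [set r *: (D *m v) | v in V] <->
  [set (D^T *m A *m D) *m v | v in V] = V.
Proof.
move=> r0 DTD; have DDT : D *m D^T = 1%:M by exact: mulmx1C.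
have push v : A *m (r *: (D *m v)) = r *: (D *m ((D^T *m A *m D) *m v)).
  by rewrite -scalemxAr !mulmxA DDT mul1mx.
have inj u v : r *: (D *m u) = r *: (D *m v) -> u = v.
  move=> /(scalerI r0) E; rewrite -[u]mul1mx -DTD -mulmxA E mulmxA DTD mul1mx //.
split=> E.
- apply/seteqP; split=> [_ [v Vv <-]|v Vv].
    have : [set r *: (D *m v) | v in V] (A *m (r *: (D *m v))).
      by rewrite -[X in X _]E; exists (r *: (D *m v)) => //; exists v.
    by rewrite push => -[w Vw /inj <-].
  have : [set r *: (D *m v) | v in V] (r *: (D *m v)) by exists v.
  by rewrite -[X in X _]E => -[_ [w Vw <-]]; rewrite push => /inj <-; exists w.
- apply/seteqP; split=> [_ [_ [v Vv <-] <-]|_ [v Vv <-]].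
    by rewrite push; exists (D^T *m A *m D *m v) => //; rewrite -E; exists v.
  move: Vv; rewrite -{1}E => -[w Vw <-].
  by exists (r *: (D *m w)); [exists w|rewrite push].
Qed.

Lemma binary_icosahedralP (Gamma : set SU2) : binary_icosahedral Gamma ->
  exists h : SU2, Gamma = [set` [seq (h * icosian R q * h^-1)%g | q <- icosians]].
Proof.
move=> [V [r [Q [r0 QQ ->]]] ->].
have [h Eh] : exists h : SU2, [set r *: (Q *m v) | v in @standard_icosahedron R] =
    [set r *: (double_cover h *m v) | v in @standard_icosahedron R].
  have QQ' : Q^T *m Q = 1%:M by exact: mulmx1C.
  have := congr1 determinant QQ; rewrite det_mulmx det_tr det1 -expr2 => /eqP.
  rewrite -[X in _ == X](expr1n _ 2) eqf_sqr => /orP[]/eqP dQ.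
    by have [h <-] := double_cover_surj QQ dQ; exists h.
  (* An improper Q is replaced by -Q, which gives the same vertex set because the icosahedron is
     symmetric about the origin. *)
  have [||h Eh] := @double_cover_surj R (- Q).
  - by rewrite linearN /= mulmxN mulNmx opprK.
  - by rewrite -scaleN1r detZ dQ -signr_odd /= expr1 mulrNN mulr1.
  exists h; rewrite Eh; apply/seteqP; split=> [_ [v Vv <-]|_ [v Vv <-]];
    by exists (- v); [exact: standard_opp|rewrite mulmxN ?mulNmx ?opprK].
have key g : rotation_group [set r *: (Q *m v) | v in @standard_icosahedron R] (double_cover g) <->
    preserves (@standard_icosahedron R) (h^-1 * g * h)%g.
  rewrite rotation_group_double_cover Eh /preserves !double_coverM double_coverV.
  apply: conj_stable; first exact: lt0r_neq0.
  exact: mulmx1C (double_cover_orth h).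
exists h; apply/seteqP; split=> g.
- move=> /key/preserves_icosian[q qI qE]; apply/mapP; exists q => //.
  by rewrite -qE !mulgA mulgV mul1g -mulgA mulgV mulg1.
- move=> /mapP[q qI ->]; apply/key.
  by rewrite !mulgA mulVg mul1g -mulgA mulVg mulg1; exact: icosian_preserves.
Qed.

End BinaryIcosahedral.

(** * Invariants of a finite group by averaging *)

Section Averaging.
Variable K : numFieldType.

(** For the rank factorisation P = C R, cancelling C on the left and R on the right in P^2 = P gives
    R C = 1. *)
Lemma idempotent_trace n (P : 'M[K]_n) : P *m P = P -> \tr P = (\rank P)%:R.
Proof.
move=> PP; rewrite -{1}(mulmx_base P) mxtrace_mulC.
suff -> : row_base P *m col_base P = 1%:M by rewrite mxtrace1.
apply: (row_full_inj (col_base_full P)); apply: (row_free_inj (row_base_free P)).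
by rewrite /= mulmx1 (mulmxA (col_base P) (row_base P)) mulmx_base -mulmxA mulmx_base.
Qed.

Variables (T : groupType) (n : nat) (r : T -> 'M[K]_n) (S : seq T).
Hypothesis rM : forall g h, r (g * h)%g = r g *m r h.
Hypothesis uS : uniq S.
Hypothesis S0 : S != [::].
Hypothesis Smul : forall g h, g \in S -> h \in S -> (g * h)%g \in S.

Definition average : 'M[K]_n := (size S)%:R^-1 *: \sum_(g <- S) r g.

Let sizeS : (size S)%:R != 0 :> K.
Proof. by rewrite pnatr_eq0 size_eq0. Qed.

(** Right multiplication by g is injective and maps the finite list into itself, hence permutes
    it. *)
Lemma average_mul g : g \in S -> average *m r g = average.
Proof.
move=> gS; rewrite /average -scalemxAl mulmx_suml; congr (_ *: _).
under eq_bigr do rewrite -rM.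
rewrite -(big_map (fun h => (h * g)%g) xpredT r); apply: perm_big.
have um : uniq [seq (h * g)%g | h <- S] by rewrite map_inj_uniq //; exact: mulIg.
have sub : {subset [seq (h * g)%g | h <- S] <= S}.
  by move=> _ /mapP[h hS ->]; exact: Smul.
have [_ E] : (size [seq (h * g)%g | h <- S] = size S) * ([seq (h * g)%g | h <- S] =i S).
  by apply: uniq_min_size; rewrite ?size_map.
exact: uniq_perm.
Qed.

Lemma average_id (v : 'rV[K]_n) : (v <= average)%MS <-> (forall g, g \in S -> v *m r g = v).
Proof.
split=> [/submxP[D ->] g gS|H]; first by rewrite -mulmxA average_mul.
apply/submxP; exists v; rewrite /average -scalemxAr mulmx_sumr.
rewrite (eq_big_seq (fun=> v)) => [|g]; last exact: H.
by rewrite big_const_seq count_predT iter_addr_0 -(scaler_nat (size S) v) scalerA mulVf // scale1r.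
Qed.

Lemma average_idem : average *m average = average.
Proof.
rewrite {2}/average -scalemxAr mulmx_sumr (eq_big_seq (fun=> average)) => [|g]; last first.
  exact: average_mul.
by rewrite big_const_seq count_predT iter_addr_0 -(scaler_nat (size S) average) scalerA mulVf // scale1r.
Qed.

Lemma average_rank : ((size S) * \rank average)%:R = \sum_(g <- S) \tr (r g).
Proof.
rewrite natrM -idempotent_trace ?average_idem // /average mxtraceZ mulrA mulfV // mul1r.
by rewrite raddf_sum.
Qed.

End Averaging.

(** * Characters and the dimension of the invariants *)

Section InvariantDimension.
Variable R : realType.
Local Notation SU2 := (SU2 R).
Local Notation C := R[i].

Lemma tr_rho_conj (K : fieldType) n (P A : 'M[K]_2) : P \in unitmx ->
  \tr (rho n (P *m A *m invmx P)) = \tr (rho n A).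
Proof.
move=> uP; rewrite rhoM mxtrace_mulC -rhoM mulmxA mulVmx // mul1mx //.
Qed.

(** Schur triangularisation reduces the trace to the sum of the a^(n-p) d^p for the diagonal entries
    a and d, which satisfy a d = 1 and a + d = 2 q0. *)
Lemma tr_rho_SU2 n (g : SU2) : \tr (rho n (SU2val g)) = (cheb ((2 * q0 g)%:C : C) n).1.
Proof.
have [P Pu tP] := @Schur _ 2 (SU2val g) isT.
have uP : P \in unitmx by exact: unitarymx_unit.
have {}tP : is_trig_mx (conjmx P (SU2val g)) by exact: tP.
pose B := P *m SU2val g *m invmx P.
have B01 : B 0 1 = 0 by rewrite /B -conjumx //; move/is_trig_mxP: tP; exact.
rewrite -(tr_rho_conj n (SU2val g) uP) tr_rho_trig //.
have dB : B 0 0 * B 1 1 = 1.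
  have : \det B = 1.
    rewrite /B !det_mulmx det_inv mulrAC mulfV ?mul1r -?unitfE -?unitmxE //.
    by case: (g) => x /= /andP[_ /eqP].
  by rewrite (mx2_eta B) det_mx2 B01 mul0r subr0 !mxE.
have tB : B 0 0 + B 1 1 = (2 * q0 g)%:C.
  transitivity (\tr B).
    rewrite /mxtrace !big_ord_recl big_ord0 addr0; congr (_ + B _ _); exact: val_inj.
  rewrite /B mxtrace_mulC mulmxA mulVmx // mul1mx SU2_mxq /mxtrace !big_ord_recl big_ord0.
  by rewrite !mxE /=; simpc; congr (_ +i* _); ring.
by rewrite -/B -/(geom _ _ n) -tB geom_cheb.
Qed.

Lemma cheb_zcheb t n : cheb ((zeval R t)%:C : C) n =
  ((zeval R (zcheb t n).1)%:C, (zeval R (zcheb t n).2)%:C).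
Proof.
elim: n => [|n IH] /=; first by rewrite zeval_int rmorph1.
rewrite IH; case: (zcheb t n) => u v /=.
by rewrite zevalB zevalM !rmorphB !rmorphM.
Qed.

Lemma zcheb_period t N n j : zcheb t N = zcheb t 0 -> zcheb t (n + N * j) = zcheb t n.
Proof.
move=> p; have step k : zcheb t (k + N) = zcheb t k.
  by elim: k => [|k IH] //; rewrite addSn /= IH.
elim: j => [|j IH]; first by rewrite muln0 addn0.
by rewrite mulnS addnCA addnC step.
Qed.

Lemma zcheb_2 n : zcheb (zint 2) n = (zint n.+1, zint n.+2).
Proof.
elim: n => [|n IH] //=; rewrite IH; congr (_, _).
by rewrite /zsub /zadd /zmul /zint /=; congr (_, _); lia.
Qed.

Lemma zcheb_N2 n : zcheb (zint (- 2)) n = (zint ((-1) ^+ n * n.+1%:Z), zint ((-1) ^+ n.+1 * n.+2%:Z)).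
Proof.
elim: n => [|n IH] //=; rewrite IH; congr (_, _).
rewrite /zsub /zadd /zmul /zint /= !exprS; congr (_, _); last by ring.
by rewrite !intS; ring.
Qed.

Lemma zeval_zsum l : zeval R (zsum l) = \sum_(x <- l) zeval R x.
Proof.
elim: l => [|x l IH]; first by rewrite big_nil zeval_int.
by rewrite big_cons /= zevalD IH.
Qed.

Lemma character_sum k j : (k < 60)%N ->
  \sum_(q <- icosians) zeval R (zcheb (ztrace q) (k + 60 * j)).1 =
  (if odd k then 0 else (120 * (j + invariant_dim k))%:R).
Proof.
move=> k60; have -> : icosians = [:: (zint 2, zint 0, zint 0, zint 0);
   (zint (- 2), zint 0, zint 0, zint 0)] ++ drop 2 icosians by [].
have -> : \sum_(q <- [:: (zint 2, zint 0, zint 0, zint 0); (zint (- 2), zint 0, zint 0, zint 0)] ++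
     drop 2 icosians) zeval R (zcheb (ztrace q) (k + 60 * j)).1 =
    (k + 60 * j).+1%:R + (-1) ^+ (k + 60 * j) * (k + 60 * j).+1%:R + zeval R (zcharacter_sum k).
  have two (F : zquat -> R) a b : \sum_(q <- [:: a; b]) F q = F a + F b.
    by rewrite !big_cons big_nil addr0.
  rewrite big_cat two -[ztrace _]/(zint 2) zcheb_2.
  rewrite -[ztrace _]/(zint (- 2)) zcheb_N2 !zeval_int.
  congr (_ + _); first by rewrite rmorphM rmorphXn rmorphN1.
  rewrite /zcharacter_sum zeval_zsum big_map; apply: eq_big_seq => q qI.
  by rewrite zcheb_period //; apply/eqP; exact: (allP icosians_periodic).
have kI : k \in iota 0 60 by rewrite mem_iota.
have /eqP -> := allP zcharacter_sum_table k kI.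
have ok : odd (k + 60 * j) = odd k by rewrite oddD oddM /= addbF.
rewrite -signr_odd ok; case: (odd k); rewrite ?zevalB !zeval_int /=.
  by rewrite expr1 mulN1r subrr add0r.
rewrite expr0 mul1r -[(k + 60 * j).+1]addn1 -[k.+1]addn1 !(natrD, natrM).
by ring.
Qed.

Lemma SU2_rhoM n (g h : SU2) : rho n (SU2val (g * h)%g) = rho n (SU2val g) *m rho n (SU2val h).
Proof. exact: rhoM. Qed.

Lemma invariant_space (Gamma : set SU2) n : binary_icosahedral Gamma ->
  exists d (W : 'M[C]_(d, n.+1)), [/\ row_free W,
    (forall v : 'rV[C]_n.+1, (v <= W)%MS <-> (forall g, Gamma g -> v *m rho n (SU2val g) = v))
  & forall k j, (k < 60)%N -> n = (k + 60 * j)%N ->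
      d = if odd k then 0%N else (j + invariant_dim k)%N].
Proof.
move=> /binary_icosahedralP[h ->].
set S := [seq _ | q <- icosians].
have uS : uniq S.
  rewrite /S (map_comp (fun x : SU2 => (h * x * h^-1)%g) (icosian R)) map_inj_uniq ?uniq_icosian //.
  by move=> x y /mulIg/mulgI.
have sS : size S = 120%N by rewrite size_map size_icosians.
(* Closure under products follows from the description as the stabiliser of the vertex set, in place
   of a table of 120^2 products. *)
have Smul g g' : g \in S -> g' \in S -> (g * g')%g \in S.
  move=> /mapP[q qI ->] /mapP[q' qI' ->].
  have [|q2 q2I q2E] := @preserves_icosian R (icosian R q * icosian R q')%g.
    have p := icosian_preserves R qI; have p' := icosian_preserves R qI'.
    rewrite /preserves double_coverM; apply/seteqP; split=> [_ [v Vv <-]|v].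
      by rewrite -mulmxA; do 2 apply: icosian_sub => //.
    rewrite -{1}p => -[w + <-]; rewrite -{1}p' => -[x Vx <-].
    by exists x; rewrite ?mulmxA.
  apply/mapP; exists q2 => //; rewrite -q2E.
  by rewrite !mulgA -(mulgA (h * icosian R q)%g) mulVg mulg1.
pose A := average (fun g : SU2 => rho n (SU2val g)) S.
exists (\rank A), (row_base A); split.
- exact: row_base_free.
- move=> v; rewrite eq_row_base.
  have S0 : S != [::] by rewrite -size_eq0 sS.
  rewrite average_id //; last exact: SU2_rhoM.
- move=> k j k60 nE.
  have S0 : S != [::] by rewrite -size_eq0 sS.
  have := average_rank (SU2_rhoM n) uS S0 Smul; rewrite sS -/A.
  have -> : \sum_(g <- S) \tr (rho n (SU2val g)) =
      (\sum_(q <- icosians) zeval R (zcheb (ztrace q) n).1)%:C.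
    rewrite /S big_map rmorph_sum; apply: eq_big_seq => q qI.
    have -> : \tr (rho n (SU2val (h * icosian R q * h^-1)%g)) = \tr (rho n (SU2val (icosian R q))).
      by apply: tr_rho_conj; exact: SU2_unitmx.
    rewrite tr_rho_SU2; have := icosianE R qI.
    case: q {qI} => [[[a b] c] d] [-> _ _ _].
    by rewrite mulrC divfK ?pnatr_eq0 // cheb_zcheb.
  have := character_sum j k60; rewrite -nE => ->; case: (odd k).
    by rewrite rmorph0 => /eqP; rewrite pnatr_eq0 muln_eq0 /= => /eqP.
  rewrite rmorph_nat => /eqP; rewrite eqr_nat eqn_pmul2l // => /eqP -> //.
Qed.

End InvariantDimension.

(** * The spectrum of the Dirac operator *)

Section Bridge.
Variable R : realType.
Local Notation SU2 := (SU2 R).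
Local Notation C := R[i].
Local Notation spinor := (spinor R).

Definition spinor_entry (psi : spinor) (k : 'I_2) : SU2 -> C := fun g => psi g k 0.
Definition cre (psi : spinor) (k : 'I_2) : SU2 -> R := fun g => complex.Re (psi g k 0).
Definition cim (psi : spinor) (k : 'I_2) : SU2 -> R := fun g => complex.Im (psi g k 0).

Lemma cV_cvgP T (F : set_system T) (FF : Filter F) (u : T -> 'cV[C]_2) (v : 'cV[C]_2) :
  (u x @[x --> F] --> v) <->
  (forall k, (complex.Re (u x k 0) @[x --> F] --> complex.Re (v k 0)) /\
             (complex.Im (u x k 0) @[x --> F] --> complex.Im (v k 0))).
Proof.
rewrite cvg_mxP; split=> [H k|H k j]; first by apply/cvg_complexP; exact: H.
by rewrite (ord1 j); apply/cvg_complexP; exact: H.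
Qed.

Lemma continuous_comp_spinor (psi : spinor) : continuous psi <->
  (forall k, continuous (cre psi k) /\ continuous (cim psi k)).
Proof.
split=> [H k|H g].
  by split=> g; have [] := (cV_cvgP _ _ _).1 (H g) k.
apply: (cV_cvgP (nbhs_filter g) psi (psi g)).2 => k.
by have [h1 h2] := H k; split; [exact: h1|exact: h2].
Qed.

Lemma lie_quotientE i psi g t k : lie_quotient i psi g t k 0 =
  (t^-1 * (cre psi k (g * su2_exp i t)%g - cre psi k g)) +i*
  (t^-1 * (cim psi k (g * su2_exp i t)%g - cim psi k g)).
Proof.
rewrite /lie_quotient !mxE /cre /cim.
case: (psi (g * su2_exp i t)%g k 0) (psi g k 0) => [a b] [c d] /=.
by simpc; congr (_ +i* _); ring.
Qed.

Lemma lie_quotient_cvg i psi g (v : 'cV[C]_2) :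
  (lie_quotient i psi g t @[t --> (0 : R)^'] --> v) <->
  (forall k, is_derive (0 : R) (1 : R) (orbit_map (cre psi k) i g) (complex.Re (v k 0)) /\
             is_derive (0 : R) (1 : R) (orbit_map (cim psi k) i g) (complex.Im (v k 0))).
Proof.
rewrite cV_cvgP.
have e k : ((complex.Re (lie_quotient i psi g t k 0) @[t --> (0 : R)^'] --> complex.Re (v k 0)) /\
             (complex.Im (lie_quotient i psi g t k 0) @[t --> (0 : R)^'] --> complex.Im (v k 0))) <->
  (is_derive (0 : R) (1 : R) (orbit_map (cre psi k) i g) (complex.Re (v k 0)) /\
             is_derive (0 : R) (1 : R) (orbit_map (cim psi k) i g) (complex.Im (v k 0))).
  rewrite -!is_derive0P /orbit_map su2_exp0 mulg1.
  by under eq_cvg do rewrite lie_quotientE /=;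
     under [X in _ /\ X]eq_cvg do rewrite lie_quotientE /=.
by split=> H k; apply/e; exact: H.
Qed.

Lemma lie_derivableP i psi : lie_derivable i psi <->
  (forall k, drv i (cre psi k) /\ drv i (cim psi k)).
Proof.
split=> [H k|H g].
  by split=> g; have /cvg_ex[v /lie_quotient_cvg/(_ k)[[d1 _] [d2 _]]] := H g.
apply/cvg_ex; exists (\col_k (dR i (cre psi k) g +i* dR i (cim psi k) g)).
apply/lie_quotient_cvg => k; have [h1 h2] := H k; rewrite !mxE /=.
by split; exact: dRP.
Qed.

Lemma lie_deriveE i psi : lie_derivable i psi ->
  forall g k, lie_derive i psi g k 0 = dR i (cre psi k) g +i* dR i (cim psi k) g.
Proof.
move=> H g k.
have cv : lie_quotient i psi g t @[t --> (0 : R)^'] --> lie_derive i psi g by exact: H.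
have [h1 h2] := (lie_quotient_cvg _ _ _ _).1 cv k.
by rewrite (dR_unique h1) (dR_unique h2); case: (lie_derive i psi g k 0).
Qed.

Lemma Cn_CnR n psi : Cn n psi <-> (forall k, CnR n (cre psi k) /\ CnR n (cim psi k)).
Proof.
elim: n psi => [|n IH] psi.
  split=> [[/continuous_comp_spinor H _] k|H]; first by have [] := H k.
  by split=> //; apply/continuous_comp_spinor => k; have [[h1 _] [h2 _]] := H k.
have der i : lie_derivable i psi -> forall k,
    cre (lie_derive i psi) k = dR i (cre psi k) /\ cim (lie_derive i psi) k = dR i (cim psi k).
  by move=> H k; split; apply/funext => g; rewrite /cre /cim (lie_deriveE H).
split=> [[/continuous_comp_spinor H D] k|H].
  have [h1 h2] := H k.
  split; split=> // i; have [/[dup] L /lie_derivableP/(_ k)[d1 d2] /IH/(_ k)[c1 c2]] := D i;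
    by have [e1 e2] := der i L k; rewrite e1 in c1; rewrite e2 in c2.
split; first by apply/continuous_comp_spinor => k; have [[h1 _] [h2 _]] := H k.
move=> i; have L : lie_derivable i psi.
  by apply/lie_derivableP => k; have [h1 h2] := H k; split; [exact: (CnR_drv i h1)|exact: (CnR_drv i h2)].
split=> //; apply/IH => k; have [h1 h2] := H k; have [-> ->] := der i L k.
by split; [exact: (CnR_dR i h1)|exact: (CnR_dR i h2)].
Qed.

Lemma smooth_compP psi : smooth psi <-> (forall k, smoothC (spinor_entry psi k)).
Proof.
split=> H.
  by move=> k n; have /Cn_CnR/(_ k) := H n.
by move=> n; apply/Cn_CnR => k; exact: H.
Qed.

Definition spin (f : 'I_2 -> smoothfun R) : spinor := fun g => \col_k sfval (f k) g.

Lemma spinP psi : smooth psi <-> exists f, psi = spin f.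
Proof.
split=> [/smooth_compP H|[f ->]].
  by exists (fun k => mksf (H k)); apply/funext => g; apply/matrixP => k j; rewrite !mxE (ord1 j).
apply/smooth_compP => k; have := sfunP (f k).
by congr smoothC; apply/funext => g; rewrite /spinor_entry mxE.
Qed.

Lemma lie_derive_spin i f g k : lie_derive i (spin f) g k 0 = sfval (sX i (f k)) g.
Proof.
have L : lie_derivable i (spin f).
  apply/lie_derivableP => k'; have [h1 h2] := sfun_drv (f k') i.
  split; [have := h1|have := h2]; congr drv; apply/funext => g'; by rewrite /cre /cim mxE.
rewrite (lie_deriveE L) /= /XC.
by congr (dR i _ g +i* dR i _ g); apply/funext => g'; rewrite /cre /cim mxE.
Qed.

Lemma sval_cst c (g : SU2) : sfval (scst c) g = c. Proof. by []. Qed.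

Lemma dirac_spin f (mu : R) : Defs.dirac (spin f) = mu%:C *: (spin f : SU2 -> 'cV[C]_2) <->
  scst 'i * sX 0 (f 0) + sX 1 (f 1) + scst 'i * sX 2 (f 1) = scst (mu + 3 / 2)%:C * f 0 /\
  - (scst 'i * sX 0 (f 1)) - sX 1 (f 0) + scst 'i * sX 2 (f 0) = scst (mu + 3 / 2)%:C * f 1.
Proof.
have sumI3 (F : 'I_3 -> 'cV[C]_2) : \sum_i F i = F 0 + F 1 + F 2.
  rewrite !big_ord_recl big_ord0 addr0 addrA.
  by congr (_ + F _ + F _); exact: val_inj.
have D g : Defs.dirac (spin f) g = \col_k (if k == 0
   then 'i * sfval (sX 0 (f 0)) g + sfval (sX 1 (f 1)) g + 'i * sfval (sX 2 (f 1)) g - 3 / 2 * sfval (f 0) g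
   else - ('i * sfval (sX 0 (f 1)) g) - sfval (sX 1 (f 0)) g + 'i * sfval (sX 2 (f 0)) g - 3 / 2 * sfval (f 1) g).
  rewrite /Defs.dirac sumI3.
  have A i k : sfval (sX i (f k)) g = lie_derive i (spin f) g k 0 by rewrite lie_derive_spin.
  have W k : sfval (f k) g = spin f g k 0 by rewrite mxE.
  rewrite !A !W /su2_basis !(tnth_nth 0) /=.
  move: (lie_derive 0 _ g) (lie_derive 1 _ g) (lie_derive 2 _ g) (spin f g) => u v w p.
  apply/matrixP => k j; rewrite (ord1 j) {j} !mxE !big_ord_recl !big_ord0 !mxE /=.
  have -> : lift 0 0 = 1 :> 'I_2 by exact: val_inj.
  have o : ord0 = 0 :> 'I_2 by exact: val_inj.
  have iE : Num.imaginary = 'i%C :> C by rewrite complexiE.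
  case: k => [[|[|//]] hk] /=.
    rewrite (_ : Ordinal hk = 0) ?o //=; last exact: val_inj.
    by rewrite ?iE; ring.
  rewrite (_ : Ordinal hk = 1) ?o //=; last exact: val_inj.
  by rewrite ?iE; ring.
have mu32 : (mu + 3 / 2)%:C = mu%:C + 3 / 2 :> C.
  by rewrite rmorphD /= fmorph_div !rmorph_nat.
split=> [E|[E0 E1]].
  have Eg (g : SU2) k : Defs.dirac (spin f) g k 0 = mu%:C * sfval (f k) g by rewrite E !mxE.
  split; apply: sfun_ext => g; [have := Eg g 0|have := Eg g 1]; rewrite D mxE ?eqxx;
    [|rewrite (_ : (1 == 0 :> 'I_2) = false) //];
    move=> /eqP; rewrite subr_eq => /eqP E'.
    by rewrite !svalD !svalM !sval_cst E' mu32; ring.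
  by rewrite !svalD !svalN !svalM !sval_cst E' mu32; ring.
apply/funext => g; rewrite D; apply/matrixP => k j; rewrite (ord1 j) {j} mxE.
have e0 := congr1 (fun u => sfval u g) E0; have e1 := congr1 (fun u => sfval u g) E1.
rewrite !svalD !svalM !sval_cst mu32 in e0; rewrite !svalD !svalN !svalM !sval_cst mu32 in e1.
have -> : (mu%:C *: (spin f : SU2 -> 'cV[C]_2)) g k 0 = mu%:C * sfval (f k) g by rewrite !mxE.
case: k => [[|[|//]] hk] /=.
  by rewrite e0 (_ : Ordinal hk = 0); [ring|exact: val_inj].
by rewrite e1 (_ : Ordinal hk = 1); [ring|exact: val_inj].
Qed.

End Bridge.

(** * The sl_2 frame on smooth functions *)

Section Frame.
Variable R : realType.
Local Notation SU2 := (SU2 R).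
Local Notation C := R[i].
Local Notation S := (smoothfun R).

Lemma smoothC_real (f : SU2 -> R) : (forall n, CnR n f) -> smoothC (fun g => (f g)%:C).
Proof. by move=> H n; split; [exact: H|exact: CnR_cst]. Qed.

Lemma CnR_q n : [/\ CnR n (@q0 R), CnR n (@q1 R), CnR n (@q2 R) & CnR n (@q3 R)].
Proof.
by split; [have := CnR_lin n (1 : R) 0 0 0|have := CnR_lin n (0 : R) 1 0 0
  |have := CnR_lin n (0 : R) 0 1 0|have := CnR_lin n (0 : R) 0 0 1]; congr CnR;
  apply/funext => g; ring.
Qed.

Definition sq0 : S := mksf (smoothC_real (fun n => let: And4 a _ _ _ := CnR_q n in a)).
Definition sq1 : S := mksf (smoothC_real (fun n => let: And4 _ a _ _ := CnR_q n in a)).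
Definition sq2 : S := mksf (smoothC_real (fun n => let: And4 _ _ a _ := CnR_q n in a)).
Definition sq3 : S := mksf (smoothC_real (fun n => let: And4 _ _ _ a := CnR_q n in a)).

Lemma sX_real i (f : S) (u v : SU2 -> R) : sfval f =1 (fun g => (u g)%:C) -> dR i u = v ->
  forall g, sfval (sX i f) g = (v g)%:C.
Proof.
move=> Ef Eu g; rewrite /= /XC -Eu.
have -> : (fun g => complex.Re (sfval f g)) = u by apply/funext => k; rewrite Ef.
have -> : (fun g => complex.Im (sfval f g)) = fun=> 0 by apply/funext => k; rewrite Ef.
by have [_ ->] := dR_cst i (0 : R).
Qed.

Lemma sX_sq i :
  [/\ forall g, sfval (sX i sq0) g = (- (qdelta R i 0 * q1 g + qdelta R i 1 * q2 g + qdelta R i 2 * q3 g))%:C,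
      forall g, sfval (sX i sq1) g = (qdelta R i 0 * q0 g + qdelta R i 2 * q2 g - qdelta R i 1 * q3 g)%:C,
      forall g, sfval (sX i sq2) g = (qdelta R i 1 * q0 g - qdelta R i 2 * q1 g + qdelta R i 0 * q3 g)%:C
    & forall g, sfval (sX i sq3) g = (qdelta R i 2 * q0 g + qdelta R i 1 * q1 g - qdelta R i 0 * q2 g)%:C].
Proof.
have [[_ e0] [_ e1] [_ e2] [_ e3]] := dR_q R i.
by split; [apply: (sX_real _ e0)|apply: (sX_real _ e1)|apply: (sX_real _ e2)|apply: (sX_real _ e3)].
Qed.

Lemma sX_sqE : [/\
  [/\ sX 0 sq0 = - sq1, sX 0 sq1 = sq0, sX 0 sq2 = sq3 & sX 0 sq3 = - sq2],
  [/\ sX 1 sq0 = - sq2, sX 1 sq1 = - sq3, sX 1 sq2 = sq0 & sX 1 sq3 = sq1] &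
  [/\ sX 2 sq0 = - sq3, sX 2 sq1 = sq2, sX 2 sq2 = - sq1 & sX 2 sq3 = sq0]].
Proof.
by split; [have [e0 e1 e2 e3] := sX_sq 0|have [e0 e1 e2 e3] := sX_sq 1|have [e0 e1 e2 e3] := sX_sq 2];
  split; apply: sfun_ext => g; rewrite ?(e0, e1, e2, e3) ?svalN /qdelta /=;
  simpc; congr (_ +i* _); ring.
Qed.

Local Notation ii := (scst ('i : C)).
Local Notation hh := (scst (2^-1 : C)).

Lemma ii2 : ii * ii = -1 :> S.
Proof. by rewrite -rmorphM -expr2 sqr_i rmorphN1. Qed.
Lemma hh2 : 2 * hh = 1 :> S.
Proof.
by rewrite -(rmorph_nat (@scst R) 2) -rmorphM divff ?rmorph1 // pnatr_eq0.
Qed.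

(* X_1 = i H, X_2 = E - F, X_3 = i (E + F) *)
Definition sH (f : S) : S := - ii * sX 0 f.
Definition sE (f : S) : S := hh * (sX 1 f - ii * sX 2 f).
Definition sF (f : S) : S := - hh * (sX 1 f + ii * sX 2 f).

Fact sH_zmod : zmod_morphism sH. Proof. by move=> a b; rewrite /sH raddfB /=; ring. Qed.
Fact sE_zmod : zmod_morphism sE. Proof. by move=> a b; rewrite /sE !raddfB /=; ring. Qed.
Fact sF_zmod : zmod_morphism sF. Proof. by move=> a b; rewrite /sF !raddfB /=; ring. Qed.
HB.instance Definition _ := GRing.isZmodMorphism.Build S S sH sH_zmod.
HB.instance Definition _ := GRing.isZmodMorphism.Build S S sE sE_zmod.
HB.instance Definition _ := GRing.isZmodMorphism.Build S S sF sF_zmod.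

(* row j of the coordinate matrix g is (sx j, sy j) *)
Definition sx (j : bool) : S := if j then - sq2 + ii * sq3 else sq0 + ii * sq1.
Definition sy (j : bool) : S := if j then sq0 - ii * sq1 else sq2 + ii * sq3.

Lemma sHM a b : sH (a * b) = sH a * b + a * sH b.
Proof. by rewrite /sH sX_mul; ring. Qed.
Lemma sEM a b : sE (a * b) = sE a * b + a * sE b.
Proof. by rewrite /sE !sX_mul; ring. Qed.
Lemma sFM a b : sF (a * b) = sF a * b + a * sF b.
Proof. by rewrite /sF !sX_mul; ring. Qed.

Lemma sX_cstM i c (f : S) : sX i (scst c * f) = scst c * sX i f.
Proof. by rewrite sX_mul sX_cst mul0r add0r. Qed.

Lemma sX_opp i (f : S) : sX i (- f) = - sX i f. Proof. exact: raddfN. Qed.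
Lemma sX_add i (f h : S) : sX i (f + h) = sX i f + sX i h. Proof. exact: raddfD. Qed.

Lemma sEH f : sE (sH f) = sH (sE f) - 2 * sE f.
Proof.
have [c1 c2 c3] := sX_comm3 f; have i2 := ii2; have h2 := hh2.
rewrite /sE /sH !mulNr !(sX_add, sX_cstM, sX_opp) /= c3 c1.
move: (sX 0 f) (sX 1 (sX 0 f)) (sX 0 (sX 2 f)) (sX 1 f) (sX 2 f) => a b c d e.
ring: i2.
Qed.
Lemma sFH f : sF (sH f) = sH (sF f) + 2 * sF f.
Proof.
have [c1 c2 c3] := sX_comm3 f; have i2 := ii2; have h2 := hh2.
rewrite /sF /sH !mulNr !(sX_add, sX_cstM, sX_opp) /= c3 c1.
move: (sX 0 f) (sX 1 (sX 0 f)) (sX 0 (sX 2 f)) (sX 1 f) (sX 2 f) => a b c d e.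
ring: i2.
Qed.
Lemma sEF f : sE (sF f) = sF (sE f) + sH f.
Proof.
have [c1 c2 c3] := sX_comm3 f; have i2 := ii2; have h2 := hh2.
rewrite /sF /sE /sH !mulNr !(sX_add, sX_cstM, sX_opp) /= c2.
move: (sX 0 f) (sX 1 (sX 1 f)) (sX 2 (sX 1 f)) (sX 2 (sX 2 f)) => a b c d.
(* The unit (2 hh)^2 is inserted because the other terms carry a factor hh^2. *)
have -> : - (ii * a) = - ((2 * hh) * (2 * hh) * (ii * a)) by rewrite h2 !mul1r.
ring.
Qed.

Lemma lap_casimir f : sH (sH f) + 2 * sH f + 4 * sF (sE f) = - lap f.
Proof.
have [c1 c2 c3] := sX_comm3 f; have i2 := ii2; have h2 := hh2.
rewrite /sF /sE /sH /lap !mulNr !(sX_add, sX_cstM, sX_opp) /= c2.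
move: (sX 0 f) (sX 0 (sX 0 f)) (sX 1 (sX 1 f)) (sX 2 (sX 1 f)) (sX 2 (sX 2 f)) => a z b c d.
transitivity (- (z + (2 * hh) * (2 * hh) * (b + d)) - 2 * ((1 - (2 * hh) * (2 * hh)) * (ii * a))).
  ring: i2.
by rewrite h2; ring.
Qed.

Lemma frame_coords : [/\ (forall j, sH (sx j) = sx j) /\ (forall j, sH (sy j) = - sy j),
  (forall j, sE (sx j) = 0) /\ (forall j, sE (sy j) = sx j) &
  (forall j, sF (sx j) = sy j) /\ (forall j, sF (sy j) = 0)].
Proof.
have [[e00 e01 e02 e03] [e10 e11 e12 e13] [e20 e21 e22 e23]] := sX_sqE.
have i2 := ii2; have h2 := hh2.
have E := (e00, e01, e02, e03, e10, e11, e12, e13, e20, e21, e22, e23).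
split; split; case; rewrite /sH /sE /sF /sx /sy !(sX_add, sX_cstM, sX_opp) !E;
  move: sq0 sq1 sq2 sq3 i2 h2 => a b c d i2 h2; try ring: i2.
all: by rewrite -[RHS]mul1r -h2; ring: i2.
Qed.

Lemma frame_det : sx false * sy true - sy false * sx true = 1.
Proof.
rewrite /sx /sy; have i2 := ii2.
transitivity (sq0 * sq0 + sq1 * sq1 + sq2 * sq2 + sq3 * sq3).
  by move: sq0 sq1 sq2 sq3 i2 => a b c d i2; ring: i2.
apply: sfun_ext => g; rewrite !svalD !svalM /= -!rmorphM -!rmorphD /= -!expr2 SU2_norm.
by [].
Qed.
End Frame.

(** * Matrix coefficients of the symmetric powers *)

Section MatrixCoefficients.
Variable R : realType.
Local Notation SU2 := (SU2 R).
Local Notation C := R[i].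
Local Notation S := (smoothfun R).
Local Notation opH := (@sH R). Local Notation opE := (@sE R). Local Notation opF := (@sF R).
Local Notation fx := (@sx R). Local Notation fy := (@sy R).
Local Notation h := (hcoef fx fy).

Lemma sHx j : opH (fx j) = fx j. Proof. by case: (frame_coords R) => -[]. Qed.
Lemma sHy j : opH (fy j) = - fy j. Proof. by case: (frame_coords R) => -[]. Qed.
Lemma sEx j : opE (fx j) = 0. Proof. by case: (frame_coords R) => _ []. Qed.
Lemma sEy j : opE (fy j) = fx j. Proof. by case: (frame_coords R) => _ []. Qed.
Lemma sFx j : opF (fx j) = fy j. Proof. by case: (frame_coords R) => _ _ []. Qed.
Lemma sFy j : opF (fy j) = 0. Proof. by case: (frame_coords R) => _ _ []. Qed.

Lemma scst_frame c : [/\ opH (scst c) = 0, opE (scst c) = 0 & opF (scst c) = 0].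
Proof. by rewrite /sH /sE /sF !sX_cst; split; ring. Qed.

Lemma casimir0_cst c : casimir_eq opH opE opF 0 c -> c = scst (sfval c 1%g).
Proof.
rewrite /casimir_eq lap_casimir mul0r mul0r => /eqP; rewrite oppr_eq0 => /eqP.
exact: lap_eq0.
Qed.

Lemma coord_inv (g : SU2) (i k : bool) : sfval (minv fx fy i k) g = SU2val g^-1%g (inord i) (inord k).
Proof.
have e : SU2val g^-1%g = mxq (q0 g) (- q1 g) (- q2 g) (- q3 g) by rewrite SU2_mxq !qV.
rewrite e.
by case: i; case: k; rewrite ?inord_false ?inord_true !mxE /minv /sx /sy !(svalN, svalD, svalM) /=;
  simpc; rewrite ?opprK.
Qed.

Lemma hcoef_hc (g : SU2) n p q : sfval (h n p q) g = hc (SU2val g^-1%g) n p q.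
Proof.
elim: n p q => [|n IH] p q.
  rewrite /= /hc /binary_form; case: p => [|p]; last by rewrite bin_small // mul0r.
  by rewrite bin0 mul1r !expr0 mul1r coef1; case: q.
rewrite hcoefS !big_bool !svalD !svalM !coord_inv inord_false inord_true hc_rec /guard.
move: (SU2val g^-1%g) IH => m IH.
case: p => [|p]; case: q => [|q] /=; rewrite ?subn0 ?subn1 -/h ?IH ?sval0 /=; ring.
Qed.

Lemma smooth_sum I (r : seq I) (P : pred I) (f : I -> S) (g : SU2) :
  sfval (\sum_(k <- r | P k) f k) g = \sum_(k <- r | P k) sfval (f k) g.
Proof. exact: (raddf_sum (sev g)). Qed.

Lemma smooth_nat n (f : S) (g : SU2) : sfval (n%:R * f) g = n%:R * sfval f g.
Proof. by rewrite -(rmorph_nat (@scst R)) svalM. Qed.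

(* matc Y is the function g |-> tr(Y rho(g^-1)), see matcE *)
Definition matc n (Y : 'M[C]_n.+1) : S :=
  \sum_(p < n.+1) \sum_(q < n.+1) scst (Y q p / 'C(n, p)%:R) * h n p q.

Lemma matcE n (Y : 'M[C]_n.+1) (g : SU2) :
  sfval (matc Y) g = \tr (Y *m rho n (SU2val g^-1%g)).
Proof.
rewrite /matc smooth_sum mxtrace_mulC /mxtrace; apply: eq_bigr => p _.
rewrite smooth_sum mxE; apply: eq_bigr => q _; rewrite svalM hcoef_hc /hc !mxE /=.
have b0 : 'C(n, p)%:R != 0 :> C by rewrite pnatr_eq0 -lt0n bin_gt0 -ltnS.
by rewrite mulrA divfK // mulrC.
Qed.

Fact matc_zmod n : zmod_morphism (@matc n).
Proof.
move=> Y Z; apply: sfun_ext => g.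
by rewrite svalD svalN !matcE mulmxBl raddfB.
Qed.
HB.instance Definition _ n := GRing.isZmodMorphism.Build 'M[C]_n.+1 S (@matc n) (@matc_zmod n).

Lemma matcZ n a (Y : 'M[C]_n.+1) : matc (a *: Y) = scst a * matc Y.
Proof. by apply: sfun_ext => g; rewrite svalM !matcE -scalemxAl mxtraceZ. Qed.

Lemma fact_unit n : (2 ^ n * n`!)%:R != 0 :> C.
Proof. by rewrite pnatr_eq0 muln_eq0 expn_eq0 /= -lt0n fact_gt0. Qed.

(** Linear independence of the matrix entries as functions; it carries eigenvalue and invariance
    conditions from functions back to matrices. *)
Lemma matc_eq0 n (Y : 'M[C]_n.+1) : matc Y = 0 -> Y = 0.
Proof.
move=> Y0; apply/matrixP => q p; rewrite mxE.
pose c p q : S := scst (Y (inord q) (inord p) / 'C(n, p)%:R).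
have e : \sum_(p < n.+1) \sum_(q < n.+1) c p q * h n p q = 0.
  transitivity (matc Y) => //; apply: eq_bigr => p' _; apply: eq_bigr => q' _.
  by rewrite /c !inord_val.
have := hcoef_free (@sHM R) (@sEM R) (@sFM R) sHx sHy sEx sEy sFx sFy (@frame_det R)
  (fun p q => scst_frame (Y (inord q) (inord p) / 'C(n, p)%:R)) e (leq_ord p) (leq_ord q).
move=> /(congr1 (fun f : S => sfval f 1%g)); rewrite smooth_nat sval0 /c /= !inord_val => /eqP.
rewrite mulf_eq0 (negPf (fact_unit n)) mulf_eq0 invr_eq0 pnatr_eq0 /= => /orP[/eqP //|].
by rewrite -leqn0 leqNgt bin_gt0 -ltnS ltn_ord.
Qed.

Lemma casimir_matc n (f : S) : casimir_eq opH opE opF n f -> exists Y : 'M[C]_n.+1, f = matc Y.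
Proof.
move=> cf.
pose c p q : S := lcoef opH opE opF fx fy n p q f.
have cc p q : c p q = scst (sfval (c p q) 1%g).
  apply: casimir0_cst; rewrite /c.
  exact: (casimir_eq_lcoef (@sHM R) (@sEM R) (@sFM R) (@sEH R) (@sFH R) (@sEF R)
    sHx sHy sEx sEy sFx sFy).
(* Read off from [expansion]; the binomial compensates the denominator in [matc]. *)
exists (\matrix_(q, p) ('C(n, p)%:R * sfval (c p q) 1%g / (2 ^ n * n`!)%:R)).
have u := fact_unit n.
apply: sfun_ext => g; apply: (mulfI u); rewrite -!smooth_nat.
have -> : (2 ^ n * n`!)%:R * f = \sum_(p < n.+1) \sum_(q < n.+1) c p q * h n p q.
  exact: (expansion (@sHM R) (@sEM R) (@sFM R) (@sEH R) (@sFH R) (@sEF R)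
    sHx sHy sEx sEy sFx sFy (@frame_det R)).
rewrite /matc smooth_nat !smooth_sum mulr_sumr; apply: eq_bigr => p _.
rewrite !smooth_sum mulr_sumr; apply: eq_bigr => q _; rewrite cc !svalM mxE /=.
have b0 : 'C(n, p)%:R != 0 :> C by rewrite pnatr_eq0 -lt0n bin_gt0 -ltnS.
rewrite mulrA; congr (_ * _).
move: u; rewrite natrM mulf_eq0 negb_or => /andP[u1 u2].
by field; rewrite b0 u2.
Qed.

End MatrixCoefficients.

Section Action.
Variable R : realType.
Local Notation SU2 := (SU2 R).
Local Notation C := R[i].
Local Notation S := (smoothfun R).
Local Notation opH := (@sH R). Local Notation opE := (@sE R). Local Notation opF := (@sF R).
Local Notation fx := (@sx R). Local Notation fy := (@sy R).
Local Notation h := (hcoef fx fy).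
Local Notation L := (lower opH opE opF fx fy).
Local Notation Bop := (bop opH opE opF fx fy).

Lemma sval_nat n (g : SU2) : sfval (n%:R : S) g = n%:R.
Proof. by rewrite -(rmorph_nat (@scst R)). Qed.

(** In homogeneous variables (w_0, w_1) the operator acts on the n-th power of the bilinear form as
    twice w_j d/dw_k. Hence p is untouched and only q moves. *)
Lemma raise_lower_hcoef n (j k : bool) p q : (p <= n)%N -> (q <= n)%N ->
  \sum_i minv fx fy i k * L n i j (h n p q) =
  2 * (if (j <= q)%N then (if k then (q - j).+1 else n - (q - j))%N%:R * h n p (q - j + k)%N else 0).
Proof.
case: n => [|n] pn qn.
  move: pn qn; rewrite !leqn0 => /eqP -> /eqP ->.
  have [H1 E1 F1] : [/\ opH 1 = 0, opE 1 = 0 & opF 1 = 0] by rewrite -(rmorph1 (@scst R)); exact: scst_frame.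
  rewrite big1 => [|i _]; last first.
    by rewrite /lower /= H1 E1 F1; case: i; ring.
  by case: j; case: k; rewrite /= ?mulr0 ?mul0r ?mulr0.
under eq_bigr => i _ do rewrite (lower_hcoef (@sHM R) (@sEM R) (@sFM R)
  (sHx R) (sHy R) (sEx R) (sEy R) (sFx R) (sFy R) (@frame_det R)).
case: (leqP j q) => jq; last first.
  by rewrite big1 ?mulr0 // => i _; rewrite /guard (leqNgt j) jq andbF !mulr0.
apply: sfun_ext => g.
have E a m P r : sfval (2 * (a%:R * h m P r)) g = 2 * (a%:R * hc (SU2val g^-1%g) m P r).
  by rewrite !svalM !sval_nat hcoef_hc.
rewrite E {E} big_bool svalD !svalM !coord_inv !sval_nat inord_false inord_true /guard jq !andbT /= subn0.
have rn : (q - j <= n.+1)%N by exact: leq_trans (leq_subr _ _) qn.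
have e (P : nat -> S) : sfval (if (0 < p)%N then P (p - 1)%N else 0) g =
    if p is p'.+1 then sfval (P p') g else 0.
  by case: p {pn} => // p; rewrite subn1.
rewrite (e (fun p => h n p (q - j)%N)) {e}.
move: (q - j)%N rn => r rn; rewrite natrM.
rewrite !hcoef_hc; case: k => /=.
  rewrite inord_true addn1 -hc_index1.
  by case: p {pn} => [|p]; rewrite ?hcoef_hc; ring.
rewrite inord_false addn0 -hc_index0 //.
by case: p {pn} => [|p]; rewrite ?hcoef_hc; ring.
Qed.

(* the matrix of [bop] on coefficients, see [bop_matc] *)
Definition bmx n (j k : bool) : 'M[C]_n.+1 := \matrix_(r, q)
  ((if (q + k == r + j)%N then 2 * (if k then r : nat else n - r)%N%:R else 0)
   - ((j == k) && (r == q))%:R * n%:R).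

Lemma bop_hcoef n j k p (q : 'I_n.+1) : (p <= n)%N ->
  \sum_i minv fx fy i k * L n i j (h n p q) - (j == k)%:R * (n%:R * h n p q) =
  \sum_(r < n.+1) scst (bmx n j k r q) * h n p r.
Proof.
move=> pn; rewrite raise_lower_hcoef //; last by rewrite -ltnS.
under eq_bigr => r _ do rewrite mxE rmorphB mulrBl.
rewrite sumrB; congr (_ - _); last first.
  rewrite (bigD1 q) //= eqxx andbT big1 ?addr0 => [|r rq].
    by rewrite rmorphM !rmorph_nat mulrA.
  by rewrite (negPf rq) andbF mul0r rmorph0 mul0r.
case: (leqP j q) => jq; last first.
  rewrite mulr0 big1 // => r _; case: ifP => [/eqP e|_]; last by rewrite rmorph0 mul0r.
  have [-> ->] : k = true /\ r = 0%N :> nat by move: j k jq e => [] []; lia.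
  by rewrite mulr0 rmorph0 mul0r.
have eq_r (r : nat) : (q + k == r + j)%N = (r == q - j + k)%N by move: j k jq => [] []; lia.
(* Overflow occurs only for q = n, j false and k true, where [hcoef] vanishes and no matrix row is
   present. *)
case: (ltnP (q - j + k) n.+1) => rn; last first.
  rewrite hcoef_out ?rn ?orbT // !mulr0 big1 // => r _; rewrite eq_r ltn_eqF ?rmorph0 ?mul0r //.
  exact: leq_trans (ltn_ord r) rn.
rewrite (bigD1 (Ordinal rn)) //= big1 ?addr0 => [|r rq]; last first.
  by rewrite eq_r -[(_ == _)%N]/(r == Ordinal rn) (negPf rq) rmorph0 mul0r.
rewrite eq_r eqxx rmorphM !rmorph_nat -mulrA; congr (_ * (_%:R * _)).
by case: k {eq_r rn}; rewrite ?addn1 ?addn0.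
Qed.

Lemma bop_matc n (Y : bool -> 'M[C]_n.+1) j :
  Bop (fun k => matc (Y k)) j = matc (\sum_k bmx n j k *m Y k).
Proof.
rewrite (bop_lower _ _ _ (@frame_det R) n) raddf_sum /=.
have -> : n%:R * matc (Y j) = \sum_k (j == k)%:R * (n%:R * matc (Y k)).
  by rewrite big_bool; case: j => /=; rewrite mul0r mul1r ?addr0 ?add0r.
rewrite -sumrB; apply: eq_bigr => k _.
pose c (p q : 'I_n.+1) : C := Y k q p / 'C(n, p)%:R.
transitivity (\sum_(p < n.+1) \sum_(q < n.+1) scst (c p q) *
  (\sum_i minv fx fy i k * L n i j (h n p q) - (j == k)%:R * (n%:R * h n p q))).
  have [H0 E0 F0] : [/\ forall p q, opH (scst (c p q)) = 0, forall p q, opE (scst (c p q)) = 0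
      & forall p q, opF (scst (c p q)) = 0] by split=> p q; case: (scst_frame (c p q)).
  have eL i : L n i j (matc (Y k)) = \sum_(p < n.+1) \sum_(q < n.+1) scst (c p q) * L n i j (h n p q).
    rewrite /matc lower_sum; apply: eq_bigr => p _; rewrite lower_sum; apply: eq_bigr => q _.
    rewrite -/(c p q) (lower_const fx fy (@sHM R) (@sEM R) (@sFM R)); [by []|exact: H0|exact: E0|exact: F0].
  under eq_bigr => i _ do rewrite eL mulr_sumr.
  rewrite exchange_big /matc !mulr_sumr -sumrB /=; apply: eq_bigr => p _.
  under eq_bigr => i _ do rewrite mulr_sumr.
  rewrite exchange_big !mulr_sumr -sumrB /=; apply: eq_bigr => q _.
  rewrite mulrBr mulr_sumr; congr (_ - _); first by apply: eq_bigr => i _; rewrite mulrCA.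
  by rewrite -/(c p q); ring.
rewrite /matc; apply: eq_bigr => p _.
under eq_bigr => q _ do rewrite (bop_hcoef _ _ _ (leq_ord p)) mulr_sumr.
rewrite exchange_big; apply: eq_bigr => r _ /=.
rewrite mxE mulr_suml rmorph_sum mulr_suml; apply: eq_bigr => q _.
by rewrite mulrA -rmorphM /c; congr (scst _ * _); rewrite mulrC mulrA.
Qed.
End Action.

(** * Change of trivialisation *)

Section Gauge.
Variable R : realType.
Local Notation SU2 := (SU2 R).
Local Notation C := R[i].
Local Notation S := (smoothfun R).
Local Notation opH := (@sH R). Local Notation opE := (@sE R). Local Notation opF := (@sF R).
Local Notation fx := (@sx R). Local Notation fy := (@sy R).
Local Notation Bop := (bop opH opE opF fx fy).
Local Notation m := (minv fx fy).

Definition gcol (s : bool -> S) (g : SU2) : 'cV[C]_2 := \col_j sfval (s (j == 1)) g.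

Definition gspin (s : bool -> S) : spinor R := fun g => SU2val g^-1%g *m gcol s g.

Definition unframe (s : bool -> S) (i : bool) : S := m i false * s false + m i true * s true.

Lemma gspin_spin s : gspin s = spin (fun i : 'I_2 => unframe s (i == 1)).
Proof.
apply/funext => g; apply/matrixP => i j; rewrite !mxE /unframe svalD !svalM !coord_inv.
rewrite (ord1 j) !big_ord_recl big_ord0 addr0 /gcol !mxE /=.
have -> : lift 0 0 = 1 :> 'I_2 by exact: val_inj.
have -> : inord (i == 1) = i :> 'I_2.
  by case: i => [[|[|//]] hi]; apply: val_inj; rewrite /= inordK.
by rewrite inord_false inord_true.
Qed.

Lemma gcol_gspin s g : gcol s g = SU2val g *m gspin s g.
Proof. by rewrite mulmxA mulmxV ?mul1mx // SU2_unitmx. Qed.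

Lemma gcol_inj s t : gcol s =1 gcol t -> s =1 t.
Proof.
move=> E k; apply: sfun_ext => g.
have := congr1 (fun v : 'cV[C]_2 => v (if k then 1 else 0) 0) (E g); rewrite !mxE.
by case: k.
Qed.

Lemma smooth_gspin psi : smooth psi <-> exists s, psi = gspin s.
Proof.
split=> [/spinP[f ->]|[s ->]]; last by apply/spinP; eexists; exact: gspin_spin.
exists (fun j => fx j * f 0 + fy j * f 1); rewrite gspin_spin.
congr spin; apply/funext => i; rewrite /unframe.
transitivity ((fx false * fy true - fy false * fx true) * f i); first by rewrite frame_det mul1r.
case: i => [[|[|//]] hi]; rewrite /minv /=.
  by rewrite (_ : Ordinal hi = 0); [ring|exact: val_inj].
by rewrite (_ : Ordinal hi = 1); [ring|exact: val_inj].
Qed.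

Lemma gspin_equivariant s (Gamma : set SU2) :
  (forall g gamma, Gamma gamma -> gspin s (g * gamma)%g = SU2val (gamma^-1)%g *m gspin s g) <->
  (forall j g gamma, Gamma gamma -> sfval (s j) (g * gamma)%g = sfval (s j) g).
Proof.
split=> [H j g gamma Gg|H g gamma Gg].
  have : gcol s (g * gamma)%g = gcol s g.
    rewrite !gcol_gspin H // mulmxA /= -[in X in X *m _ = _]mulmxA mulmxV ?mulmx1 //.
    exact: SU2_unitmx.
  move=> /(congr1 (fun v : 'cV[C]_2 => v (if j then 1 else 0) 0)); rewrite !mxE.
  by case: j.
rewrite {1}/gspin (_ : gcol s (g * gamma)%g = gcol s g).
  by rewrite invgM /= -mulmxA.
by apply/matrixP => i j; rewrite !mxE H.
Qed.

Lemma dirac_gspin s (lambda : R) : Defs.dirac (gspin s) = lambda%:C *: (gspin s : SU2 -> 'cV[C]_2) <->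
  forall j, Bop s j = scst (lambda - 3 / 2)%:C * s j.
Proof.
(* [P0] and [P1] are the components of (D + 3/2) psi. Multiplying by the invertible matrix g brings
   in [dirac_gauge], whose 3 turns lambda + 3/2 into lambda - 3/2. *)
pose P0 : S := - opH (unframe s false) - 2 * opF (unframe s true).
pose P1 : S := opH (unframe s true) - 2 * opE (unframe s false).
pose mu : S := scst (lambda + 3 / 2)%:C.
have h2 := hh2 R.
have g j : fx j * P0 + fy j * P1 = 3 * s j + Bop s j.
  exact: (dirac_gauge (@sHM R) (@sEM R) (@sFM R) (sHx R) (sHy R) (sEy R) (sFx R) (@frame_det R)).
have opE j : s j = fx j * unframe s false + fy j * unframe s true.
  transitivity ((fx false * fy true - fy false * fx true) * s j); first by rewrite frame_det mul1r.
  by rewrite /unframe /minv; case: j; ring.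
have mu3 : mu = scst (lambda - 3 / 2)%:C + 3.
  rewrite /mu -(rmorph_nat (@scst R)) -rmorphD /=; congr scst.
  by rewrite -(rmorph_nat (real_complex R)) -rmorphD /=; congr (_ +i* _); field.
have -> : Defs.dirac (gspin s) = lambda%:C *: (gspin s : SU2 -> 'cV[C]_2) <->
    P0 = mu * unframe s false /\ P1 = mu * unframe s true.
  rewrite gspin_spin dirac_spin /=.
  have -> : P0 = scst 'i * sX 0 (unframe s false) + sX 1 (unframe s true) +
      scst 'i * sX 2 (unframe s true).
    transitivity (scst 'i * sX 0 (unframe s false) + (2 * scst (2^-1 : C)) * (sX 1 (unframe s true) +
      scst 'i * sX 2 (unframe s true))); last by rewrite h2; ring.
    by rewrite /P0 /sH /sF; ring.
  have -> // : P1 = - (scst 'i * sX 0 (unframe s true)) - sX 1 (unframe s false) +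
      scst 'i * sX 2 (unframe s false).
  transitivity (- (scst 'i * sX 0 (unframe s true)) + (2 * scst (2^-1 : C)) * (- sX 1 (unframe s false) +
    scst 'i * sX 2 (unframe s false))); last by rewrite h2; ring.
  by rewrite /P1 /sH /sE; ring.
split=> [[E0 E1] j|H].
  have := g j; rewrite E0 E1 => e.
  have e' : mu * s j = 3 * s j + Bop s j by rewrite -e {1}opE; ring.
  by apply: (addrI (3 * s j)); rewrite -e' mu3; ring.
have g' j : fx j * P0 + fy j * P1 = mu * s j by rewrite g H mu3; ring.
split.
- transitivity ((fx false * fy true - fy false * fx true) * P0); first by rewrite frame_det mul1r.
  transitivity (fy true * (fx false * P0 + fy false * P1) - fy false * (fx true * P0 + fy true * P1)).
    by ring.
  by rewrite !g' /unframe /minv; ring.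
- transitivity ((fx false * fy true - fy false * fx true) * P1); first by rewrite frame_det mul1r.
  transitivity (fx false * (fx true * P0 + fy true * P1) - fx true * (fx false * P0 + fy false * P1)).
    by ring.
  by rewrite !g' /unframe /minv; ring.
Qed.

Lemma matc_invariant n (Y : 'M[C]_n.+1) (Gamma : set SU2) :
  (forall g gamma, Gamma gamma -> sfval (matc Y) (g * gamma)%g = sfval (matc Y) g) <->
  (forall gamma, Gamma gamma -> Y *m rho n (SU2val gamma) = Y).
Proof.
have tr g gamma : sfval (matc Y) (g * gamma)%g =
    sfval (matc (Y *m rho n (SU2val gamma^-1%g))) g.
  by rewrite !matcE invgM SU2_rhoM mulmxA.
have rV gamma : rho n (SU2val gamma^-1%g) *m rho n (SU2val gamma) = 1%:M.
  by rewrite -SU2_rhoM mulVg /= rho1.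
split=> [H gamma Gg|H g gamma Gg].
  have e : Y *m rho n (SU2val gamma^-1%g) = Y.
    apply/eqP; rewrite -subr_eq0; apply/eqP; apply: matc_eq0; rewrite raddfB /=.
    by apply: sfun_ext => g; rewrite svalD svalN -tr H // subrr.
  by rewrite -{1}e -mulmxA rV mulmx1.
by rewrite tr -{1}(H gamma Gg) -mulmxA -SU2_rhoM mulgV /= rho1 mulmx1.
Qed.

End Gauge.

(** * Eigenvectors of the coefficient matrix *)

Section EigenMatrices.
Variable R : realType.
Local Notation C := R[i].

(* The eigenvectors of [bop] of weight n for b are the A Z with Z an arbitrary matrix; the
   second clause gives injectivity of A and lets it detect any row space. *)
Definition parametrizes n (b : C) K (A : bool -> 'M[C]_(n.+1, K)) : Prop :=
  (forall Y : bool -> 'M[C]_n.+1, (forall j, \sum_k bmx R n j k *m Y k = b *: Y j) <->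
    exists Z : 'M[C]_(K, n.+1), forall k, Y k = A k *m Z) /\
  (forall d (W : 'M[C]_(d, n.+1)) (Z : 'M[C]_(K, n.+1)), (forall k, (A k *m Z <= W)%MS) -> (Z <= W)%MS).

Lemma bmx_entry n (j k : bool) (Y : 'M[C]_n.+1) r c :
  (bmx R n j k *m Y) r c = 2 * (if k then r : nat else n - r)%N%:R * Y (inord (r + j - k)) c
    - (j == k)%:R * n%:R * Y r c.
Proof.
rewrite mxE.
under eq_bigr => q _ do rewrite mxE mulrBl.
rewrite sumrB; congr (_ - _); last first.
  rewrite (bigD1 r) //= eqxx andbT big1 ?addr0 // => q qr.
  by rewrite (eq_sym r) (negPf qr) andbF !mul0r.
set w := (_ * _%:R).
(* A vanishing weight covers the indices that leave the range: r = 0 with k true and j false, and r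
   = n with k false and j true. *)
have [w0|w0] := eqVneq w 0.
  by rewrite w0 mul0r big1 // => q _; case: ifP; rewrite mul0r.
have {}w0 : (if k then r : nat else n - r)%N != 0%N.
  by apply: contraNneq w0; rewrite /w => ->; rewrite mulr0.
have rn := ltn_ord r.
have lt : (r + j - k < n.+1)%N by case: k j w0 {w} => [] []; lia.
have e (q : 'I_n.+1) : (q + k == r + j)%N = (q == inord (r + j - k)).
  by rewrite -val_eqE /= inordK //; case: k j w0 {w lt} => [] []; lia.
rewrite (bigD1 (inord (r + j - k))) //= e eqxx big1 ?addr0 // => q qr.
by rewrite e (negPf qr) mul0r.
Qed.

Lemma eig_eqP n (b : C) (Y : bool -> 'M[C]_n.+1) :
  (forall j, \sum_k bmx R n j k *m Y k = b *: Y j) <->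
  forall (r c : 'I_n.+1), 2 * (n - r)%N%:R * Y false r c - n%:R * Y false r c + 2 * r%:R * Y true (inord r.-1) c
     = b * Y false r c /\
   2 * (n - r)%N%:R * Y false (inord r.+1) c + 2 * r%:R * Y true r c - n%:R * Y true r c = b * Y true r c.
Proof.
have e (r : 'I_n.+1) c j : (\sum_k bmx R n j k *m Y k) r c = if j then
    2 * (n - r)%N%:R * Y false (inord r.+1) c + 2 * r%:R * Y true r c - n%:R * Y true r c
  else 2 * (n - r)%N%:R * Y false r c - n%:R * Y false r c + 2 * r%:R * Y true (inord r.-1) c.
  rewrite big_bool mxE !bmx_entry; case: j => /=; rewrite ?addn0 ?subn0 ?addn1 ?subn1 /= inord_val; ring.
split=> [H r c|H j].
  by split; [rewrite -(e r c false)|rewrite -(e r c true)]; rewrite H mxE.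
apply/matrixP => r c; rewrite e mxE.
by have [h1 h2] := H r c; case: j.
Qed.

(** For b = n the equations say that row r of Y false is row r-1 of Y true, so both are windows on
    one sequence of n+2 rows: the copy of rho_(n+1) in rho_n tensor rho_1. *)
Definition amx_pos n (k : bool) : 'M[C]_(n.+1, n.+2) := \matrix_(q, i) (i == q + k :> nat)%N%:R.

Lemma amx_posE n (k : bool) (Z : 'M[C]_(n.+2, n.+1)) q c :
  (amx_pos n k *m Z) q c = Z (inord (q + k)) c.
Proof.
have lt : (q + k < n.+2)%N by have := ltn_ord q; case: k; lia.
rewrite mxE (bigD1 (inord (q + k))) //= mxE inordK // eqxx mul1r big1 ?addr0 // => i ir.
by rewrite mxE -[X in _ == X](inordK lt) val_eqE (negPf ir) mul0r.
Qed.

Lemma amx_pos_parametrizes n : parametrizes n%:R (amx_pos n).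
Proof.
split=> [Y|d W Z H].
  rewrite eig_eqP; split=> [H|[Z E] r c].
    exists (\matrix_(i, c) if i == 0 then Y false 0 c else Y true (inord i.-1) c) => k.
    apply/matrixP => q c; rewrite amx_posE mxE -val_eqE /=.
    have lt : (q + k < n.+2)%N by have := ltn_ord q; case: (k); lia.
    rewrite inordK //; case: k lt => lt; first by rewrite addn1 /= inord_val.
    rewrite addn0; case: eqP => q0; first by congr (Y false _ c); exact: val_inj.
    have [h _] := H q c.
    have qn0 : (q : nat)%:R != 0 :> C by rewrite pnatr_eq0; apply/eqP.
    have nq : n%:R = (n - q)%N%:R + q%:R :> C by rewrite -natrD subnK // -ltnS.
    have : 2 * q%:R * (Y true (inord q.-1) c - Y false q c) = 0 :> C.
      transitivity (2 * (n - q)%:R * Y false q c - n%:R * Y false q c + 2 * q%:R * Y true (inord q.-1) c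
        - n%:R * Y false q c); last by rewrite h subrr.
      by rewrite nq; ring.
    by move=> /eqP; rewrite !mulf_eq0 pnatr_eq0 /= (negPf qn0) /= subr_eq0 => /eqP.
  have nq : n%:R = (n - r)%N%:R + r%:R :> C by rewrite -natrD subnK // -ltnS.
  rewrite !E !amx_posE /= !addn0 !addn1; split.
    case: (posnP r) => [->|r0]; first by rewrite subn0; ring.
    rewrite (inordK (_ : r.-1 < n.+1)%N); last by have := ltn_ord r; lia.
    by rewrite prednK // nq; ring.
  have [->|rn] := eqVneq (r : nat) n; first by rewrite subnn; ring.
  rewrite (inordK (_ : r.+1 < n.+1)%N); last by have := ltn_ord r; move: rn => /eqP; lia.
  by rewrite nq; ring.
apply/row_subP => i.
have row_le k q : (row q (amx_pos n k *m Z) <= W)%MS by apply: submx_trans (H k); exact: row_sub.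
have [lt|ge] := ltnP i n.+1.
  have <- : row (Ordinal lt) (amx_pos n false *m Z) = row i Z; last exact: row_le.
  by apply/rowP => c; rewrite [LHS]mxE amx_posE mxE; congr (Z _ _); apply: val_inj; rewrite /= inordK addn0.
have <- : row ord_max (amx_pos n true *m Z) = row i Z; last exact: row_le.
apply/rowP => c; rewrite [LHS]mxE amx_posE mxE; congr (Z _ _).
by apply: val_inj; rewrite /= inordK addn1 //; have := ltn_ord i; lia.
Qed.

(** For b = -n-2 the equations read (n-r) Y false (r+1) + (r+1) Y true r = 0, with row 0 of Y false
    and row n of Y true zero. Taking the coefficients crosswise solves them: the copy of rho_(n-1)
    in rho_n tensor rho_1. *)
Definition amx_neg n (k : bool) : 'M[C]_(n.+1, n) := \matrix_(q, i)
  if k then (i == q :> nat)%N%:R * (n - i)%N%:R else - (i.+1 == q :> nat)%N%:R * i.+1%:R.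

Lemma amx_neg_trueE n (Z : 'M[C]_(n, n.+1)) (i : 'I_n) c :
  (amx_neg n true *m Z) (widen_ord (leqnSn n) i) c = (n - i)%N%:R * Z i c.
Proof.
rewrite mxE (bigD1 i) //= mxE eqxx mul1r big1 ?addr0 // => j ji.
by rewrite mxE /= val_eqE (negPf ji) !mul0r.
Qed.

Lemma amx_neg_falseE n (Z : 'M[C]_(n, n.+1)) (i : 'I_n) c :
  (amx_neg n false *m Z) (lift 0 i) c = - i.+1%:R * Z i c.
Proof.
rewrite mxE (bigD1 i) //= mxE eqxx mulN1r big1 ?addr0 // => j ji.
by rewrite mxE /= /bump /= add1n eqSS val_eqE (negPf ji) oppr0 !mul0r.
Qed.

Lemma amx_neg_max n (Z : 'M[C]_(n, n.+1)) c : (amx_neg n true *m Z) ord_max c = 0.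
Proof. by rewrite mxE big1 // => j _; rewrite mxE /= ltn_eqF // !mul0r. Qed.

Lemma amx_neg_0 n (Z : 'M[C]_(n, n.+1)) c : (amx_neg n false *m Z) 0 c = 0.
Proof. by rewrite mxE big1 // => j _; rewrite mxE /= oppr0 !mul0r. Qed.

Lemma amx_neg_parametrizes n : parametrizes (- n.+2%:R) (amx_neg n).
Proof.
split=> [Y|d W Z H]; last first.
  apply/row_subP => i.
  have ni : (n - i)%N%:R != 0 :> C by rewrite pnatr_eq0 -lt0n subn_gt0.
  have -> : row i Z = (n - i)%N%:R^-1 *: row (widen_ord (leqnSn n) i) (amx_neg n true *m Z).
    by apply/rowP => c; rewrite [RHS]mxE [in RHS]mxE amx_neg_trueE mulKf // mxE.
  by apply: scalemx_sub; apply: submx_trans (H true); exact: row_sub.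
have n2 : n.+2%:R = n%:R + 2 :> C by rewrite -addn2 natrD.
have w_lift (i : 'I_n) : inord i.+1 = lift 0 i :> 'I_n.+1.
  by apply: val_inj; rewrite /= inordK // ltnS.
have w_wid (i : 'I_n) : inord i = widen_ord (leqnSn n) i :> 'I_n.+1.
  by apply: val_inj; rewrite /= inordK // ltnW // ltnS.
rewrite eig_eqP; split=> [H|[Z E] r c].
  have H0 c : Y false 0 c = 0.
    have [h _] := H 0 c; move: h; rewrite /= subn0 => h.
    have : 2 * n.+1%:R * Y false 0 c = 0.
      transitivity (2 * n%:R * Y false 0 c - n%:R * Y false 0 c + 2 * 0%:R * Y true (inord 0) c
         - - n.+2%:R * Y false 0 c); last by rewrite h subrr.
      by rewrite n2 -[n.+1%:R]natr1; ring.
    by move=> /eqP; rewrite !mulf_eq0 !pnatr_eq0 /= => /eqP.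
  have Hn c : Y true ord_max c = 0.
    have [_ h] := H ord_max c; move: h; rewrite /= subnn => h.
    have : 2 * n.+1%:R * Y true ord_max c = 0.
      transitivity (2 * 0%:R * Y false (inord n.+1) c + 2 * n%:R * Y true ord_max c - n%:R * Y true ord_max c
         - - n.+2%:R * Y true ord_max c); last by rewrite h subrr.
      by rewrite n2 -[n.+1%:R]natr1; ring.
    by move=> /eqP; rewrite !mulf_eq0 !pnatr_eq0 /= => /eqP.
  exists (\matrix_(i, c) (Y true (widen_ord (leqnSn n) i) c / (n - i)%N%:R)).
  have ni (i : 'I_n) : (n - i)%N%:R != 0 :> C by rewrite pnatr_eq0 -lt0n subn_gt0.
  case; apply/matrixP => q c.
    case: (unliftP ord_max q) => [i|] ->; last by rewrite amx_neg_max.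
    have -> : lift ord_max i = widen_ord (leqnSn n) i by apply: val_inj; rewrite /= /bump leqNgt ltn_ord.
    by rewrite amx_neg_trueE mxE mulrC divfK.
  case: (unliftP 0 q) => [i|] ->; last by rewrite amx_neg_0.
  rewrite amx_neg_falseE mxE; have [_ h] := H (widen_ord (leqnSn n) i) c; move: h => /=.
  rewrite w_lift => h.
  apply: (mulfI (ni i)); apply: (mulfI (_ : 2 != 0)); first by rewrite pnatr_eq0.
  transitivity (- n.+2%:R * Y true (widen_ord (leqnSn n) i) c -
     (2 * i%:R * Y true (widen_ord (leqnSn n) i) c - n%:R * Y true (widen_ord (leqnSn n) i) c)).
    by rewrite -h; ring.
  by rewrite n2 -[i.+1%:R]natr1; field; exact: ni.
rewrite !E; split.
  case: (unliftP 0 r) => [i|] ->; last by rewrite amx_neg_0 /=; ring.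
  rewrite amx_neg_falseE /= /bump /= add1n w_wid amx_neg_trueE.
  have in' := ltn_ord i; rewrite !natrB ?(ltnW in') // n2 -[i.+1%:R]natr1; ring.
case: (unliftP ord_max r) => [i|] ->; last by rewrite amx_neg_max /= subnn; ring.
have -> : lift ord_max i = widen_ord (leqnSn n) i by apply: val_inj; rewrite /= /bump leqNgt ltn_ord.
rewrite amx_neg_trueE /= w_lift amx_neg_falseE.
have in' := ltn_ord i; rewrite !natrB ?(ltnW in') // n2 -[i.+1%:R]natr1; ring.
Qed.

End EigenMatrices.

Lemma has_dim_range (K : fieldType) (V : lmodType K) m n (f : 'M[K]_(m, n) -> V) :
  (forall a A B, f (a *: A + B) = a *: f A + f B) -> (forall A, f A = 0 -> A = 0) ->
  has_dim (range f) (m * n).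
Proof.
move=> fl f0.
have f00 : f 0 = 0 by apply: (addrI (f 0)); have := fl 1 0 0; rewrite !scale1r !addr0 => <-.
have fs I (r : seq I) (c : I -> K) (A : I -> 'M[K]_(m, n)) :
    f (\sum_(i <- r) c i *: A i) = \sum_(i <- r) c i *: f (A i).
  by elim: r => [|i r IH]; rewrite ?big_nil ?big_cons // fl IH.
have vE (c : 'I_(m * n) -> K) : \sum_i c i *: vec_mx (delta_mx 0 i) = vec_mx (\row_i c i) :> 'M[K]_(m, n).
  rewrite [\row_i c i]row_sum_delta linear_sum; apply: eq_bigr => i _.
  by rewrite linearZ /= mxE.
exists (fun i => f (vec_mx (delta_mx 0 i))); split=> [c|].
  rewrite -fs vE => /f0/(congr1 mxvec); rewrite vec_mxK linear0 => /rowP H i.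
  by have := H i; rewrite !mxE.
apply/seteqP; split=> v /=.
  move=> [A _ <-]; exists (fun i => mxvec A 0 i) => //.
  rewrite -fs vE; congr f; apply: (can_inj mxvecK); rewrite vec_mxK.
  by apply/rowP => i; rewrite mxE.
by move=> [c _ <-]; exists (vec_mx (\row_i c i)); rewrite // -fs vE.
Qed.

(** * Dimensions of the eigenspaces *)

Section Multiplicity.
Variable R : realType.
Local Notation SU2 := (SU2 R).
Local Notation C := R[i].
Local Notation S := (smoothfun R).
Local Notation opH := (@sH R). Local Notation opE := (@sE R). Local Notation opF := (@sF R).
Local Notation fx := (@sx R). Local Notation fy := (@sy R).
Local Notation Bop := (bop opH opE opF fx fy).

Lemma bop_eigen (s : bool -> S) (b : C) : (forall j, Bop s j = scst b * s j) ->
  forall j, opH (opH (s j)) + 2 * opH (s j) + 4 * opF (opE (s j)) = scst (b * (b + 2)) * s j.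
Proof.
move=> H j.
rewrite -(bop_sqr (@sHM R) (@sEM R) (@sFM R) (@sEH R) (@sFH R) (@sEF R)
  (sHx R) (sHy R) (sEx R) (sEy R) (sFx R) (sFy R) (@frame_det R)).
have -> : Bop s = fun j => scst b * s j by apply/funext.
have -> : Bop (fun j => scst b * s j) j = scst b * Bop s j.
  have [H0 E0 F0] := scst_frame b.
  rewrite /bop mulr_sumr; apply: eq_bigr => k _; rewrite mulr_sumr; apply: eq_bigr => i _.
  rewrite (lower_const fx fy (@sHM R) (@sEM R) (@sFM R)) //.
  by rewrite mulrCA.
by rewrite H rmorphM rmorphD (rmorph_nat (@scst R)); ring.
Qed.

Lemma gspinE (s : bool -> S) (t : bool -> S) (a : C) (u : bool -> S) :
  (forall k, u k = scst a * s k + t k) -> gspin u = a *: (gspin s : SU2 -> 'cV[C]_2) + gspin t.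
Proof.
move=> E; apply/funext => g.
rewrite [RHS](_ : _ = a *: gspin s g + gspin t g) // /gspin scalemxAr -mulmxDr; congr (_ *m _).
by apply/matrixP => i j; rewrite !mxE E.
Qed.

(** Here b = -1 and b(b+2) = -1, a negative value for minus the Laplacian, which [lap_eq_id]
    excludes. *)
Lemma dirac_eigenspace_m1 (Gamma : set SU2) : has_dim (dirac_eigenspace Gamma (1 / 2 : R)) 0.
Proof.
exists (fun _ => 0); split=> [c _ []//|].
apply/seteqP; split=> psi /=.
  move=> [[/smooth_gspin[s ->] _] /dirac_gspin/bop_eigen H].
  exists (fun _ => 0) => //; rewrite big_ord0.
  suff s0 j : s j = 0.
    apply/funext => g; rewrite /gspin (_ : gcol s g = 0) ?mulmx0 //.
    by apply/matrixP => i j; rewrite !mxE s0.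
  apply: lap_eq_id; have := H j; rewrite lap_casimir => /(congr1 (fun f => - f)); rewrite opprK => ->.
  have -> : (1 / 2 - 3 / 2 : R) = -1 by field.
  have -> : (-1)%:C * ((-1)%:C + 2) = -1 :> C by rewrite rmorphN1; ring.
  by rewrite rmorphN1 mulN1r opprK.
move=> [c _ <-]; rewrite big_ord0; split; first split.
- apply/smooth_gspin; exists (fun=> 0); apply/funext => g; rewrite /gspin.
  by rewrite (_ : gcol _ g = 0) ?mulmx0 //; apply/matrixP => i j; rewrite !mxE.
- by move=> g gamma _; rewrite [X in _ *m X](_ : _ = 0) // mulmx0.
have -> : 0 = gspin (fun=> 0) :> spinor R.
  apply/funext => g; rewrite /gspin.
  by rewrite (_ : gcol _ g = 0) ?mulmx0 //; apply/matrixP => i j; rewrite !mxE.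
apply/dirac_gspin => j; rewrite mulr0 /bop big1 // => k _; rewrite big1 // => i _.
by rewrite lower0 mulr0.
Qed.

(** The coefficient matrices are exactly the A k T W: the left factor solves the eigenvalue
    equation, the right one makes the rows Gamma-invariant, and T is free of size K by d. *)
Lemma dirac_eigenspace_dim (Gamma : set SU2) (lambda : R) n K d (A : bool -> 'M[C]_(n.+1, K))
    (W : 'M[C]_(d, n.+1)) (b := (lambda - 3 / 2)%:C : C) :
  b * (b + 2) = n%:R * (n%:R + 2) -> parametrizes b A -> row_free W ->
  (forall v : 'rV_n.+1, (v <= W)%MS <-> forall g, Gamma g -> v *m rho n (SU2val g) = v) ->
  has_dim (dirac_eigenspace Gamma lambda) (K * d).
Proof.
move=> bE [P1 P2] Wf HW.
pose f (T : 'M[C]_(K, d)) : spinor R := gspin (fun k => matc (A k *m (T *m W))).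
suff -> : dirac_eigenspace Gamma lambda = range f.
  apply: has_dim_range => [a T U|T fT].
    apply: gspinE => k.
    by rewrite mulmxDl mulmxDr -scalemxAl -scalemxAr raddfD /= matcZ.
  have AT k : A k *m (T *m W) = 0.
    apply: matc_eq0.
    suff E : gcol (fun k => matc (A k *m (T *m W))) =1 gcol (fun=> 0) by exact: (gcol_inj E k).
    move=> g; rewrite gcol_gspin -/(f T) fT.
    by apply/matrixP => i j; rewrite !mxE big1 // => l _; rewrite mxE mulr0.
  have : (T *m W <= (0 : 'M[C]_n.+1))%MS by apply: P2 => k; rewrite AT sub0mx.
  rewrite submx0 => /eqP TW; apply: (row_free_inj Wf); by rewrite TW mul0mx.
have bopE (Y : bool -> 'M[C]_n.+1) : (forall j, Bop (fun k => matc (Y k)) j = scst b * matc (Y j)) <->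
    exists Z : 'M[C]_(K, n.+1), forall k, Y k = A k *m Z.
  rewrite -P1; split=> H j; last by rewrite bop_matc H matcZ.
  by apply/eqP; rewrite -subr_eq0; apply/eqP; apply: matc_eq0; rewrite raddfB /= -bop_matc H matcZ subrr.
have invE (Y : 'M[C]_n.+1) : (forall g gamma, Gamma gamma -> sfval (matc Y) (g * gamma)%g = sfval (matc Y) g) <->
    (Y <= W)%MS.
  rewrite matc_invariant; split=> [H|H gamma Gg].
    by apply/row_subP => i; apply/HW => g Gg; rewrite -row_mul H.
  apply/row_matrixP => i; rewrite row_mul.
  by have /HW := submx_trans (row_sub i Y) H; apply.
apply/seteqP; split=> psi /=.
  move=> [[/smooth_gspin[s ->] /gspin_equivariant Hs] /dirac_gspin Hb].
  have /= Hc := bop_eigen Hb.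
  have [Y sY] : exists Y : bool -> 'M[C]_n.+1, s = fun k => matc (Y k).
    have ex k : exists Y : 'M[C]_n.+1, s k = matc Y.
      apply: casimir_matc; rewrite /casimir_eq Hc -/b bE rmorphM rmorphD.
      by rewrite !(rmorph_nat (@scst R)).
    have [Y0 e0] := ex false; have [Y1 e1] := ex true.
    by exists (fun k => if k then Y1 else Y0); apply/funext => -[].
  have [Z YZ] := (bopE Y).1 (fun j => ltac:(by rewrite -/b in Hb; move: (Hb j); rewrite sY)).
  have ZW : (Z <= W)%MS by apply: P2 => k; rewrite -YZ; apply/invE => g gamma Gg; have := Hs k g gamma Gg; rewrite sY.
  have /submxP[T ZT] := ZW.
  by exists T => //; rewrite /f sY; congr gspin; apply/funext => k; rewrite YZ ZT.
move=> [T _ <-]; split; first split.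
- by apply/smooth_gspin; eexists.
- apply/gspin_equivariant => j; apply/invE.
  by rewrite mulmxA submxMl.
apply/dirac_gspin; apply/(bopE (fun k => A k *m (T *m W))).2; by exists (T *m W).
Qed.

End Multiplicity.

(** At u = 3/2 + k + 60j the first factor is n + 2 and the second is d_k + j; expanding their
    product is the origin of the tabulated coefficients. *)
Lemma spectral_value (R : realType) (k : nat) (u : R) : (k < 60)%N -> ~~ odd k ->
  (spectral_coefs R k).1 + (spectral_coefs R k).2 * u + 1 / 60 * u ^+ 2 =
  (u + 1 / 2) * ((invariant_dim k)%:R + (u - 3 / 2 - k%:R) / 60).
Proof.
move=> k60 ek; rewrite -(odd_double_half k) (negPf ek) add0n.
have : (k./2 < 30)%N by lia.
move: (k./2) => {ek k60 k} k; do 30 (case: k => [_|k]; first by rewrite ?doubleS double0 /=; field).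
by [].
Qed.

(** Reciprocity: in d_k + d_(58-k) the characters of elements other than +-1 cancel, while +-1 give
    (2(k+1) + 2(59-k))/120 = 1. *)
Lemma invariant_dim_dual k : (k <= 58)%N -> ~~ odd k ->
  (invariant_dim k + invariant_dim (58 - k) = 1)%N.
Proof.
move=> k60 ek; rewrite -(odd_double_half k) (negPf ek) add0n.
have : (k./2 < 30)%N by lia.
by move: (k./2) => {ek k60 k} k; do 30 (case: k => [_|k] //).
Qed.

Lemma natr2 (R : pzSemiRingType) n : n.+2%:R = n%:R + 2 :> R.
Proof. by rewrite -addn2 natrD. Qed.

Section Spectrum.
Variable R : realType.
Local Notation C := R[i].

Lemma dirac_mult_pos (Gamma : set (SU2 R)) n k j : binary_icosahedral Gamma ->
  (k < 60)%N -> n = (k + 60 * j)%N ->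
  dirac_mult Gamma (3 / 2 + n%:R) (n.+2 * (if odd k then 0 else j + invariant_dim k)%N).
Proof.
move=> hG k60 nE; have [d [W [Wf HW /(_ k j k60 nE) <-]]] := invariant_space n hG.
have bE : (3 / 2 + n%:R - 3 / 2 : R)%:C = n%:R :> C by rewrite addrAC subrr add0r rmorph_nat.
apply: (dirac_eigenspace_dim (A := amx_pos R n) _ _ Wf HW); rewrite bE //.
exact: amx_pos_parametrizes.
Qed.

Lemma dirac_mult_neg (Gamma : set (SU2 R)) n k j : binary_icosahedral Gamma ->
  (k < 60)%N -> n = (k + 60 * j)%N ->
  dirac_mult Gamma (3 / 2 - n.+2%:R) (n * (if odd k then 0 else j + invariant_dim k)%N).
Proof.
move=> hG k60 nE; have [d [W [Wf HW /(_ k j k60 nE) <-]]] := invariant_space n hG.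
have bE : (3 / 2 - n.+2%:R - 3 / 2 : R)%:C = - n.+2%:R :> C.
  by rewrite addrAC subrr add0r rmorphN rmorph_nat.
apply: (dirac_eigenspace_dim (A := amx_neg R n) _ _ Wf HW); rewrite bE.
  by rewrite natr2; ring.
exact: amx_neg_parametrizes.
Qed.

End Spectrum.

Theorem proposition11p1 (R : realType) (Gamma : set (SU2 R))
    (hGamma : binary_icosahedral Gamma) :
  exists P : 'I_60 -> {poly R},
    [/\ (forall (k : 'I_60) (j : int),
           let u : R := 3 / 2 + k%:R + 60 * j%:~R in
           exists2 m : nat, dirac_mult Gamma u m & (P k).[u] = m%:R),
        (forall k : 'I_60, odd k -> P k = 0)
      & (forall k : 'I_60, ~~ odd k ->
           P k = (spectral_coefs R k).1%:P + (spectral_coefs R k).2 *: 'X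
                 + (1 / 60) *: 'X^2)].
Proof.
exists (fun k : 'I_60 => if odd k then 0 else
  (spectral_coefs R k).1%:P + (spectral_coefs R k).2 *: 'X + (1 / 60) *: 'X^2).
split=> [k j u|k ->//|k /negPf -> //].
have k60 := ltn_ord k.
have PE : (if odd k then 0 else (spectral_coefs R k).1%:P + (spectral_coefs R k).2 *: 'X
    + (1 / 60) *: 'X^2).[u] =
    if odd k then 0 else (u + 1 / 2) * ((invariant_dim k)%:R + j%:~R).
  case: ifP => [_|/negbT ek]; first by rewrite horner0.
  rewrite !(hornerD, hornerC, hornerZ, hornerX, hornerXn) spectral_value //; congr (_ * (_ + _)).
  by rewrite /u; field.
rewrite PE {PE}.
case: j => j in u *.
  have uE : u = 3 / 2 + (k + 60 * j)%N%:R by rewrite /u natrD natrM addrA.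
  exists ((k + 60 * j).+2 * (if odd k then 0 else j + invariant_dim k))%N.
    by rewrite uE; exact: dirac_mult_pos.
  case: ifP => _; first by rewrite muln0.
  by rewrite natrM natrD uE (natr2 _ (k + 60 * j)) -pmulrn; field.
have jE : (Negz j)%:~R = - (j%:R + 1) :> R by rewrite NegzE rmorphN /= -pmulrn natr1.
(* On the negative side the weight is n = 58 - k + 60j, which is a natural number for every j
   exactly when k is at most 58. *)
have [k58|k59] := leqP k 58.
  have uE : u = 3 / 2 - (58 - k + 60 * j).+2%:R.
    by rewrite /u jE (natr2 _ (58 - k + 60 * j)) natrD natrB // natrM; ring.
  exists ((58 - k + 60 * j) * (if odd (58 - k) then 0 else j + invariant_dim (58 - k)))%N.
    rewrite uE; apply: dirac_mult_neg => //; lia.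
  rewrite oddB //=; case: ifP => [_|/negbT ek]; first by rewrite muln0.
  (* Here u + 1/2 = -n, and duality turns -(d_k - j - 1) into the required j + d_(58-k). *)
  have dE := congr1 (fun n => n%:R : R) (invariant_dim_dual k58 ek).
  rewrite natrD in dE; have -> : (invariant_dim k)%:R = 1 - (invariant_dim (58 - k))%:R :> R.
    by apply/eqP; rewrite eq_sym subr_eq dE.
  by rewrite jE uE natrM (natr2 _ (58 - k + 60 * j)) (natrD _ (58 - k)) (natrD _ j) natrB // natrM; field.
have kE : k = 59%N :> nat by lia.
exists 0%N; last by rewrite kE.
rewrite {}/u.
(* For k = 59 the weight would be -1 at the first negative step, which is the case b = -1;
   afterwards it is odd and there are no invariants. *)
case: j jE => [|j] jE.
  rewrite (_ : _ + _ = 1 / 2); first exact: dirac_eigenspace_m1.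
  by rewrite jE kE; field.
rewrite (_ : _ + _ = 3 / 2 - (59 + 60 * j).+2%:R); last first.
  by rewrite jE kE (natr2 _ (59 + 60 * j)) natrD natrM -[j.+1%:R]natr1; ring.
by have := dirac_mult_neg (k := 59) (j := j) hGamma isT erefl; rewrite muln0.
Qed.
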